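(* Let $d\ge1$, let $b_1,\dots,b_d\ge2$ be integers and let $\alpha_1,\dots,\alpha_d\in(0,1)$ with $\alpha_1,\dots,\alpha_d>1/3$. Let $W(t)=(W_{b_1,\alpha_1}(t),\dots,W_{b_d,\alpha_d}(t))$ for $t\in[0,1]$ and let $\alpha=\min\{\alpha_1,\dots,\alpha_d\}$. For every $N\in\mathbb N$ let $W_N(t)=(W_{b_1,\alpha_1,N}(t),\dots,W_{b_d,\alpha_d,N}(t))$, let $\mathbb A_N:\Delta_2\to\mathbb R^{d\times d}$ be given by $$\mathbb A_N^{i,j}(s,t)=\int_s^t\bigl(W_{b_i,\alpha_i,N}(r)-W_{b_i,\alpha_i,N}(s)\bigr)\,dW_{b_j,\alpha_j,N}(r),\qquad 1\le i,j\le d,$$ and let $\mathbf W_N(s,t)=\bigl(W_N(t)-W_N(s),\mathbb A_N(s,t)\bigr)$ for $(s,t)\in\Delta_2$. Let $\mathbb A:\Delta_2\to\mathbb R^{d\times d}$ be given by $\mathbb A^{i,j}(s,t)=\lim_{N\to\infty}\mathbb A_N^{i,j}(s,t)$ (these limits exist) and let $\mathbf W(s,t)=\bigl(W(t)-W(s),\mathbb A(s,t)\bigr)$. Then for every $\varepsilon\in(0,\alpha)$ we have $\mathbf W\in\mathscr C_g^{\alpha-\varepsilon}$. Furthermore, for every $\varepsilon\in(0,\alpha)$, every $\beta\in(\alpha-\varepsilon,\alpha)$ and every $\varepsilon'\in(0,\alpha)$, setting $\kappa:=1-\frac{\alpha-\varepsilon}{\beta}\in(0,1)$ and $$\rho:=\Bigl(\max\bigl\{b_1^{-\alpha_1+\varepsilon'},\dots,b_d^{-\alpha_d+\varepsilon'}\bigr\}\Bigr)^{\kappa}\in(0,1),$$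 there is a constant $C$, independent of $N$, such that for all $N\in\mathbb N$ $$\|\mathbf W-\mathbf W_N\|_{\alpha-\varepsilon,2\alpha-2\varepsilon}\le C\rho^N .$$
   Context: For an integer $b\ge2$, $\alpha\in(0,1)$ and $N\in\mathbb N$, $$W_{b,\alpha}(t)=\sum_{n=0}^\infty b^{-n\alpha}\cos(b^n\pi t),\qquad W_{b,\alpha,N}(t)=\sum_{n=0}^N b^{-n\alpha}\cos(b^n\pi t).$$ (Equivalently, with $a=b^{-\alpha}$, one has $0<a<1$ and $ab>1$.) Integrals of truncated sums are Riemann-Stieltjes integrals. Let $\Delta_2=\{(s,t):0\le s\le t\le 1\}$ and $\gamma\in(0,1)$. For $f:[0,1]\to\mathbb R^d$, write $f\in C^\gamma([0,1],\mathbb R^d)$ if $\sup_{s\ne t}\frac{|f(t)-f(s)|}{|t-s|^\gamma}<\infty$. For a map $\mathbf X=(X_{s,t},\mathbb X_{s,t}):\Delta_2\to\mathbb R^d\oplus\mathbb R^{d\times d}$ put $$\|\mathbf X\|_{\gamma,2\gamma}:=\sup_{s\neq t}\frac{|X_{s,t}|}{|t-s|^\gamma}+\sup_{s\ne t}\frac{|\mathbb X_{s,t}|}{|t-s|^{2\gamma}},$$ where $|\cdot|$ is any norm on $\mathbb R^d$, respectively $\mathbb R^{d\times d}$. The set $\mathscr C^\gamma$ consists of all such $\mathbf X$ for which there is $X\in C^\gamma([0,1],\mathbb R^d)$ with, for all $0\le s\le u\le t\le1$: (i) $X_{s,t}=X(t)-X(s)$; (ii) $\mathbb X_{s,t}-\mathbb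 X_{s,u}-\mathbb X_{u,t}=X_{s,u}\otimes X_{u,t}$ (the matrix with $(i,j)$ entry $X^i_{s,u}X^j_{u,t}$); and (iii) $\|\mathbf X\|_{\gamma,2\gamma}<\infty$. It is equipped with the distance $\|\mathbf X-\mathbf Y\|_{\gamma,2\gamma}$, where the difference is taken componentwise. For $f\in C^\infty([0,1],\mathbb R^d)$ let $\iota(f)_{s,t}=\bigl(f(t)-f(s),\int_s^t(f(r)-f(s))\otimes f'(r)\,dr\bigr)$, where the second component is the matrix with $(i,j)$ entry $\int_s^t(f^i(r)-f^i(s))(f^j)'(r)\,dr$. The space $\mathscr C_g^\gamma$ of geometric rough paths is the closure in $\mathscr C^\gamma$ of $\iota(C^\infty([0,1],\mathbb R^d))$ with respect to $\|\cdot\|_{\gamma,2\gamma}$. *)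

(* Defs.v *)
From Stdlib Require Import Reals.
From Coquelicot Require Import Coquelicot.
From mathcomp Require Import ssreflect ssrfun ssrbool eqtype ssrnat seq fintype bigop.

Set Implicit Arguments.
Unset Strict Implicit.
Unset Printing Implicit Defensive.

Local Open Scope R_scope.

Definition weierstrass_term (b : nat) (alpha t : R) (n : nat) : R :=
  Rpower (INR b) (- (INR n * alpha)) * cos (INR b ^ n * PI * t).

Definition weierstrass (b : nat) (alpha t : R) : R :=
  Series (weierstrass_term b alpha t).

(* sum_n has N + 1 terms: n = 0, ..., N. *)
Definition weierstrass_trunc (b : nat) (alpha : R) (N : nat) (t : R) : R :=
  sum_n (weierstrass_term b alpha t) N.

(* Riemann-Stieltjes sum of f against g along a tagged subdivision, i.e.
   Coquelicot's Riemann_sum with increments of g in place of increments of the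
   identity.  The limit below is taken as the mesh tends to 0; there is no sign
   correction for b < a, so the integral is meant for a <= b only. *)
Definition RS_sum (f g : R -> R) (ptd : @SF_seq R) : R :=
  foldr Rplus 0
    (pairmap (fun x y : R * R => (g (fst y) - g (fst x)) * f (snd y))
       (SF_h ptd, 0) (SF_t ptd)).

Definition is_RSInt (f g : R -> R) (a b l : R) : Prop :=
  filterlim (RS_sum f g) (Riemann_fine a b) (locally l).

Definition ex_RSInt (f g : R -> R) (a b : R) : Prop :=
  exists l : R, is_RSInt f g a b l.

Definition RSInt (f g : R -> R) (a b : R) : R :=
  Hierarchy.iota (is_RSInt f g a b).

Definition vec (d : nat) : Type := 'I_d -> R.
Definition mat (d : nat) : Type := 'I_d * 'I_d -> R.

Definition is_norm (I : Type) (nrm : (I -> R) -> R) : Prop :=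
  [/\ forall x y : I -> R, nrm (fun i => x i + y i) <= nrm x + nrm y,
      forall (c : R) (x : I -> R), nrm (fun i => c * x i) = Rabs c * nrm x
    & forall x : I -> R, nrm x = 0 -> forall i : I, x i = 0].

(* A function on {(s,t) : 0 <= s <= t <= 1}; its values elsewhere are never
   used.  The same convention applies to functions on [0,1] given as R -> _. *)
Definition two_param (d : nat) : Type := R -> R -> vec d * mat d.

Definition unit_itv (x : R) : Prop := 0 <= x <= 1.

(* sup of |f(t) - f(s)| / |t - s|^gamma over s <> t in [0,1] *)
Definition holder_seminorm (d : nat) (nv : vec d -> R) (gamma : R)
    (f : R -> vec d) : Rbar :=
  Lub_Rbar (fun r => exists s t : R, [/\ unit_itv s, unit_itv t, s <> t
    & r = nv (fun i => f t i - f s i) / Rpower (Rabs (t - s)) gamma]).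

Definition in_holder (d : nat) (nv : vec d -> R) (gamma : R)
    (f : R -> vec d) : Prop :=
  Rbar_lt (holder_seminorm nv gamma f) p_infty.

(* sup of |A(s,t)| / |t - s|^gamma over 0 <= s < t <= 1 *)
Definition two_param_sup (I : Type) (nrm : (I -> R) -> R) (gamma : R)
    (A : R -> R -> I -> R) : Rbar :=
  Lub_Rbar (fun r => exists s t : R, [/\ 0 <= s, s < t, t <= 1
    & r = nrm (A s t) / Rpower (Rabs (t - s)) gamma]).

Definition rp_norm (d : nat) (nv : vec d -> R) (nm : mat d -> R) (gamma : R)
    (X : two_param d) : Rbar :=
  Rbar_plus (two_param_sup nv gamma (fun s t => fst (X s t)))
            (two_param_sup nm (2 * gamma) (fun s t => snd (X s t))).

Definition rp_sub (d : nat) (X Y : two_param d) : two_param d :=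
  fun s t => (fun i => fst (X s t) i - fst (Y s t) i,
              fun ij => snd (X s t) ij - snd (Y s t) ij).

Definition rough_path (d : nat) (nv : vec d -> R) (nm : mat d -> R) (gamma : R)
    (X : two_param d) : Prop :=
  exists x : R -> vec d,
    [/\ in_holder nv gamma x,
        forall s t : R, 0 <= s -> s <= t -> t <= 1 ->
          forall i : 'I_d, fst (X s t) i = x t i - x s i,
        forall s u t : R, 0 <= s -> s <= u -> u <= t -> t <= 1 ->
          forall i j : 'I_d,
            snd (X s t) (i, j) - snd (X s u) (i, j) - snd (X u t) (i, j)
            = fst (X s u) i * fst (X u t) j
      & Rbar_lt (rp_norm nv nm gamma X) p_infty].

(* Infinitely differentiable on [0,1], with one-sided derivatives at the
   endpoints: D n is the n-th derivative. *)
Definition smooth01 (f : R -> R) : Prop :=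
  exists D : nat -> R -> R,
    (forall x, unit_itv x -> D 0%N x = f x) /\
    (forall n x, unit_itv x -> D_in (D n) (D n.+1) unit_itv x).

(* On (0,1) the two-sided Derive is the derivative of f; at 0 and 1 it may
   depend on the values of f outside [0,1], which the integral does not see. *)
Definition smooth_lift (d : nat) (f : R -> vec d) : two_param d :=
  fun s t =>
    (fun i => f t i - f s i,
     fun ij => RInt (fun r => (f r (fst ij) - f s (fst ij)) *
                              Derive (fun u => f u (snd ij)) r) s t).

Definition geometric_rough_path (d : nat) (nv : vec d -> R) (nm : mat d -> R)
    (gamma : R) (X : two_param d) : Prop :=
  rough_path nv nm gamma X /\
  forall delta : R, 0 < delta ->
    exists f : R -> vec d,
      (forall i : 'I_d, smooth01 (fun t => f t i)) /\
      Rbar_lt (rp_norm nv nm gamma (rp_sub X (smooth_lift f))) delta.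

Section WeierstrassRoughPath.
Context (d : nat) (b : 'I_d -> nat) (alpha : 'I_d -> R).

Definition areaN (N : nat) (s t : R) (i j : 'I_d) : R :=
  RSInt (fun r => weierstrass_trunc (b i) (alpha i) N r
                  - weierstrass_trunc (b i) (alpha i) N s)
        (weierstrass_trunc (b j) (alpha j) N) s t.

Definition area (s t : R) (i j : 'I_d) : R :=
  real (Lim_seq (fun N => areaN N s t i j)).

Definition WN (N : nat) : two_param d := fun s t =>
  (fun i => weierstrass_trunc (b i) (alpha i) N t
            - weierstrass_trunc (b i) (alpha i) N s,
   fun ij => areaN N s t (fst ij) (snd ij)).

Definition W : two_param d := fun s t =>
  (fun i => weierstrass (b i) (alpha i) t - weierstrass (b i) (alpha i) s,
   fun ij => area s t (fst ij) (snd ij)).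

End WeierstrassRoughPath.

(* The minimum when d >= 1 and all entries are <= 1, respectively the maximum
   when d >= 1 and all entries are >= 0. *)
Definition min1 (d : nat) (v : 'I_d -> R) : R := \big[Rmin/1]_(i < d) v i.
Definition max0 (d : nat) (v : 'I_d -> R) : R := \big[Rmax/0]_(i < d) v i.

(* Main.v *)
Require Import Defs.
From Stdlib Require Import Reals Lra Lia Classical List Sorted Factorial.
From Stdlib Require Import FunctionalExtensionality.
From Coquelicot Require Import Coquelicot.
From HB Require Import structures.
From mathcomp Require Import ssreflect ssrfun ssrbool eqtype ssrnat seq fintype bigop.
From mathcomp Require Import finfun.
Local Open Scope R_scope.

(** The iterated integral of two truncations is a finite double sum of cells,
the integrals over [s,t] of cos(p r) - cos(p s) against d cos(q r), where
p = pi b_i^n and q = pi b_j^m, with weights b_i^(-n alpha_i) b_j^(-m alpha_j).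
A cell is at most p q (t - s)^2 (cell_short). It also has a bound that does
not depend on t - s (cell_long): the product of a cosine and a sine is a sum of
two sines without constant term, so that nothing grows with the length of the
interval and only the small denominator q / |q - p| appears. Interpolating
with weights 1 - g and g, and granting that q / |q - p| is at most a constant
times q^eta when p and q differ, one gets after multiplication by the weights
the bound (t - s)^(2g) times a geometric sequence in n and in m, as soon as
g + eta is smaller than all alpha_i (cell_geometric). The increments in N of
the areas are then geometrically small relative to (t - s)^(2g). This gives at
once the existence of the limits, the Hoelder bounds and the rate
(area_truncation_rate); the first level is the same with a single series
(increment_truncation_rate). Chen's relation passes to the limit, and the
truncations are lifts of smooth paths, so that the limit is geometric. The
rate rho of the theorem is at least as large as each of the ratios
b_i^(g + eta - alpha_i) when eta is small, because beta < alpha (rate_params).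

What remains is arithmetic: powers of two integers a and b may come close to
each other, and one needs |a^n - b^m| >= c b^(m (1 - eta)) whenever a^n and b^m
differ (power_gap). For multiplicatively dependent a and b this is immediate.
Otherwise it says that the linear form n log a - m log b is not smaller than
exp(- eta m log b), and a much stronger bound exp(- (log m)^30) comes out of
Gelfond's method, which over the reals needs nothing but Rolle's theorem.
Consider F(x) = sum of c_kl x^k a^(l x) over k < K and l < L, at the nodes
x = u + v theta, with theta = log b / log a. There a^(l x) is the integer
a^(l u) b^(l v), and if the linear form is tiny then theta is very close to
n/m, so that F(x) is very close to an integer divided by m^K. By the
pigeonhole principle (siegel) some nonzero bounded integer coefficients make
these integers vanish for all u, v < U. Then F is tiny at U^2 points, hence
small on a larger interval by an interpolation formula whose error term comes
from Rolle's theorem (interpolation_bound), hence the integers attached to the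
next larger box are of modulus less than one and vanish too (int_form_step).
Repeating this, F vanishes exactly at K L nonnegative integers, where v = 0 and
no approximation is involved; but a nonzero F has fewer than K L real zeros
(expoly_zeros). *)

(* Keeps the casts INR n.+1 in a form on which S_INR rewrites. *)
#[local] Arguments INR : simpl never.

HB.instance Definition _ := Monoid.isComLaw.Build R 0 Rplus
  (fun x y z => esym (Rplus_assoc x y z)) Rplus_comm Rplus_0_l.

Notation "\rsum_ ( i <- s ) F" := (\big[Rplus/0]_(i <- s) F)
  (at level 41, F at level 41, i, s at level 50).
Notation "\rsum_ ( i < n ) F" := (\big[Rplus/0]_(i < n) F)
  (at level 41, F at level 41, i, n at level 50).

(** * Finite sums of reals *)

Lemma rsum_le (I : Type) (s : seq I) (f g : I -> R) :
  (forall i, f i <= g i) -> \rsum_(i <- s) f i <= \rsum_(i <- s) g i.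
Proof.
by move=> h; elim/big_rec2: _ => [|i x y _ hxy]; [lra | have := h i; lra].
Qed.

Lemma rsum_abs (I : Type) (s : seq I) (f : I -> R) :
  Rabs (\rsum_(i <- s) f i) <= \rsum_(i <- s) Rabs (f i).
Proof.
elim/big_rec2: _ => [|i x y _ hxy]; first by rewrite Rabs_R0; lra.
by have := Rabs_triang (f i) y; have := Rabs_triang (f i) x; lra.
Qed.

Lemma rsum_mull (I : Type) (s : seq I) (a : R) (f : I -> R) :
  \rsum_(i <- s) (a * f i) = a * \rsum_(i <- s) f i.
Proof. by elim: s => [|i s IH]; rewrite !(big_nil, big_cons) ?IH /=; ring. Qed.

Lemma rsum_const (I : Type) (s : seq I) (a : R) :
  \rsum_(i <- s) a = INR (size s) * a.
Proof.
elim: s => [|x s IH]; first by rewrite big_nil [size _]/= INR_0; ring.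
by rewrite big_cons IH -[size (_ :: _)]/(size s).+1 S_INR /=; ring.
Qed.

Lemma rsum_ord_const (n : nat) (a : R) : \rsum_(i < n) a = INR n * a.
Proof.
have e : size (index_enum ('I_n)) = n by rewrite -[RHS](size_enum_ord n) enumT.
by rewrite rsum_const e.
Qed.

Lemma rsum_ge0 (I : Type) (s : seq I) (f : I -> R) :
  (forall i, 0 <= f i) -> 0 <= \rsum_(i <- s) f i.
Proof. by move=> h; elim/big_rec: _ => [|i x _ hx]; [lra | have := h i; lra]. Qed.

Lemma rsum_sub (I : Type) (s : seq I) (f g : I -> R) :
  \rsum_(i <- s) f i - \rsum_(i <- s) g i = \rsum_(i <- s) (f i - g i).
Proof. by elim: s => [|i s IH]; rewrite !(big_nil, big_cons) /= -?IH; ring. Qed.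

Lemma rsum_bound (n : nat) (f : 'I_n -> R) (B : R) :
  (forall i, f i <= B) -> \rsum_(i < n) f i <= INR n * B.
Proof. by move=> h; rewrite -rsum_ord_const; apply: rsum_le. Qed.

Lemma rsum_term_le (I : finType) (f : I -> R) (i : I) :
  (forall i, 0 <= f i) -> f i <= \big[Rplus/0]_(j : I) f j.
Proof.
move=> h; rewrite (bigD1 i) //=.
suff: 0 <= \big[Rplus/0]_(j | j != i) f j by lra.
by elim/big_rec: _ => [|j x _ hx]; [lra | have := h j; lra].
Qed.

Lemma is_derive_rsum (I : Type) (s : seq I) (f g : I -> R -> R) (x : R) :
  (forall i, is_derive (f i) x (g i x)) ->
  is_derive (fun y => \rsum_(i <- s) f i y) x (\rsum_(i <- s) g i x).
Proof.
move=> h; elim: s => [|i s IH].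
  rewrite big_nil; apply: (is_derive_ext (fun _ => 0)) => [t|].
    by rewrite big_nil.
  exact: is_derive_const.
rewrite big_cons; apply: (is_derive_ext (fun t => f i t + \rsum_(j <- s) f j t)).
  by move=> t; rewrite big_cons.
exact: (is_derive_plus (f i) _ x _ _ (h i) IH).
Qed.

(** * Rolle's theorem for many zeros and interpolation *)

Definition derivatives (f : nat -> R -> R) : Prop :=
  forall j x, is_derive (f j) x (f j.+1 x).

Lemma rolle_open (f g : R -> R) (x y : R) :
  (forall z, is_derive f z (g z)) -> x < y -> f x = 0 -> f y = 0 ->
  exists z, x < z < y /\ g z = 0.
Proof.
move=> h xy fx fy.
have [z [hz zxy]] : exists z, f y - f x = g z * (y - x) /\ x < z < y.
  by apply: MVT_cor2 => // c _; apply/is_derive_Reals.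
exists z; split=> //; rewrite fx fy in hz.
by apply: (Rmult_eq_reg_r (y - x)); lra.
Qed.

(** Lists of zeros are kept strictly increasing: Rolle's theorem then gives a
zero of the derivative in each gap, and these are again in increasing order. *)
Lemma rolle_list (f g : R -> R) (B : R) (s : seq R) (x : R) :
  (forall z, is_derive f z (g z)) ->
  StronglySorted Rlt (x :: s) -> List.Forall (fun y => f y = 0 /\ y <= B) (x :: s) ->
  exists s', [/\ StronglySorted Rlt s', size s' = size s
    & List.Forall (fun y => [/\ g y = 0, x < y & y <= B]) s'].
Proof.
move=> h; elim: s x => [|y s IH] x hs hz; first by exists [::]; split=> //; constructor.
have [hs1 hx] := StronglySorted_inv hs.
have [hzx hz1] : (f x = 0 /\ x <= B) /\ List.Forall (fun y => f y = 0 /\ y <= B) (y :: s).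
  by inversion hz.
have hzy : f y = 0 /\ y <= B by inversion hz1.
have xy : x < y by inversion hx.
have [s' [s's szs' hs']] := IH y hs1 hz1.
have [z [zxy gz]] := @rolle_open f g x y h xy (proj1 hzx) (proj1 hzy).
exists (z :: s'); split=> /=.
- constructor=> //; apply: List.Forall_impl hs' => t [_ yt _]; lra.
- by rewrite szs'.
- constructor; first by split=> //; lra.
  by apply: List.Forall_impl hs' => t [gt yt tB]; split=> //; lra.
Qed.

Lemma rolle_iter (f : nat -> R -> R) (A B : R) (n j : nat) (s : seq R) :
  derivatives f -> StronglySorted Rlt s -> size s = n.+1 ->
  List.Forall (fun y => f j y = 0 /\ A <= y <= B) s ->
  exists2 z, A <= z <= B & f (j + n)%N z = 0.
Proof.
move=> h; elim: n j s => [|n IH] j [|x s] // hs szs hz.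
  by inversion hz as [|y l [hx xAB] _]; subst; exists x; rewrite ?addn0.
have hz' : List.Forall (fun y => f j y = 0 /\ y <= B) (x :: s).
  by apply: List.Forall_impl hz => y [-> ?]; split=> //; lra.
have [s' [s's szs' hs']] := @rolle_list (f j) (f j.+1) B s x (h j) hs hz'.
rewrite -addSnnS; apply: (IH j.+1 s') => //.
  by rewrite szs'; case: szs.
have Ax : A <= x by inversion hz; lra.
by apply: List.Forall_impl hs' => t [gt xt tB]; split=> //; lra.
Qed.

Lemma sorted_insert (x : R) (s : seq R) :
  StronglySorted Rlt s -> ~ List.In x s ->
  exists s', [/\ StronglySorted Rlt s', size s' = (size s).+1
    & forall y, List.In y s' <-> y = x \/ List.In y s].
Proof.
elim: s => [|y s IH] hs hx.
  exists [:: x]; split=> //; first by constructor; constructor.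
  by move=> y /=; intuition.
have [hs1 hy] := StronglySorted_inv hs.
have [xy|yx] := Rlt_le_dec x y.
  exists [:: x, y & s]; split=> //=; last by intuition.
  constructor=> //; constructor=> //.
  by apply: List.Forall_impl hy => z; lra.
have {}yx : y < x by case: yx => // e; case: hx; left.
have [|s' [s's szs' ins']] := IH hs1; first by move=> h; apply: hx; right.
exists (y :: s'); split=> /=; last first.
- by move=> z; rewrite ins'; intuition.
- by rewrite szs'.
constructor=> //; apply/List.Forall_forall => z /ins' [-> //|hz].
by move/List.Forall_forall: hy; apply.
Qed.

Lemma sort_exists (s : seq R) : NoDup s ->
  exists s', [/\ StronglySorted Rlt s', size s' = size s
    & forall y, List.In y s' <-> List.In y s].
Proof.
elim: s => [|x s IH] hs; first by exists [::]; split=> //; constructor.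
have [hx hs1] : ~ List.In x s /\ NoDup s by inversion hs.
have [s1 [s1s szs1 ins1]] := IH hs1.
have [|s' [s's szs' ins']] := @sorted_insert x s1 s1s; first by rewrite ins1.
exists s'; split=> //; first by rewrite szs' szs1.
by move=> y; rewrite ins' ins1 /=; intuition.
Qed.

(** The j-th derivative of the product of the y - x over the x in s. Leibniz'
rule for a product with a factor of degree one has two terms only. *)
Fixpoint node_poly (s : seq R) (j : nat) (y : R) : R :=
  if s is x :: s' then (y - x) * node_poly s' j y + INR j * node_poly s' j.-1 y
  else if j is 0%N then 1 else 0.

Lemma node_poly_derivatives (s : seq R) : derivatives (node_poly s).
Proof.
elim: s => [|x s IH] j y /=.
  by case: j => [|j]; apply: is_derive_const.
have h1 := IH j y.
have h2 : is_derive (fun y => INR j * node_poly s j.-1 y) y (INR j * node_poly s j y).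
  case: j {h1} => [|j]; last by apply: (is_derive_scal _ _ _ _ (IH j y)).
  apply: (is_derive_ext (fun _ => 0)); first by move=> t /=; rewrite INR_0; ring.
  by rewrite /= Rmult_0_l; apply: is_derive_const.
have h3 : is_derive (fun y => y - x) y 1 by auto_derive; [|ring].
have h4 := is_derive_plus _ _ y _ _ (is_derive_mult _ _ y _ _ h3 h1 Rmult_comm) h2.
apply: (is_derive_ext _ _ _ _ (fun t => erefl _)).
have -> : (y - x) * node_poly s j.+1 y + INR j.+1 * node_poly s j y
  = 1 * node_poly s j y + (y - x) * node_poly s j.+1 y + INR j * node_poly s j y.
  by rewrite S_INR; ring.
exact: h4.
Qed.

Lemma node_poly_high (s : seq R) (j : nat) (y : R) :
  (size s < j)%N -> node_poly s j y = 0.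
Proof.
elim: s j => [|x s IH] [|j] //= hj.
by rewrite !IH //; [ring | exact: ltnW].
Qed.

Lemma node_poly_top (s : seq R) (y : R) :
  node_poly s (size s) y = INR (fact (size s)).
Proof.
elim: s => [|x s IH] //.
have -> : node_poly (x :: s) (size (x :: s)) y
  = (y - x) * node_poly s (size s).+1 y + INR (size s).+1 * node_poly s (size s) y by [].
by rewrite IH node_poly_high // Rmult_0_r Rplus_0_l -mult_INR.
Qed.

Lemma node_poly_root (s : seq R) (x : R) : List.In x s -> node_poly s 0 x = 0.
Proof. by elim: s => [|y s IH] //= [->|/IH ->]; rewrite INR_0; ring. Qed.

Lemma node_poly_upper (s : seq R) (y B : R) : 0 <= B ->
  (forall x, List.In x s -> Rabs (y - x) <= B) ->
  Rabs (node_poly s 0 y) <= B ^ size s.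
Proof.
move=> B0; elim: s => [|x s IH] h /=; first by rewrite Rabs_R1; lra.
rewrite INR_0 Rmult_0_l Rplus_0_r Rabs_mult.
apply: Rmult_le_compat; try exact: Rabs_pos; first by apply: h; left.
by apply: IH => z hz; apply: h; right.
Qed.

Lemma node_poly_lower (s : seq R) (y g : R) : 0 <= g ->
  (forall x, List.In x s -> g <= Rabs (y - x)) ->
  g ^ size s <= Rabs (node_poly s 0 y).
Proof.
move=> g0; elim: s => [|x s IH] h /=; first by rewrite Rabs_R1; lra.
rewrite INR_0 Rmult_0_l Rplus_0_r Rabs_mult.
apply: Rmult_le_compat => //; [exact: pow_le | by apply: h; left |].
by apply: IH => z hz; apply: h; right.
Qed.

Lemma In_map_mem (T : eqType) (x : T -> R) (s : seq T) (y : R) :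
  List.In y (map x s) -> exists2 i, i \in s & y = x i.
Proof.
elim: s => [|i s IH] //= [<-|/IH [j js ->]].
  by exists i => //; rewrite mem_head.
by exists j => //; rewrite in_cons js orbT.
Qed.

Lemma mem_In_map (T : eqType) (x : T -> R) (s : seq T) (i : T) :
  i \in s -> List.In (x i) (map x s).
Proof.
elim: s => [|j s IH] //; rewrite in_cons => /orP [/eqP ->|/IH h]; first by left.
by right.
Qed.

Lemma NoDup_map (T : eqType) (x : T -> R) (s : seq T) : uniq s ->
  (forall i j, i \in s -> j \in s -> i <> j -> x i <> x j) -> NoDup (map x s).
Proof.
elim: s => [|i s IH] /=; first by constructor.
move=> /andP [his hs] h; constructor; last first.
  by apply: IH => // j k hj hk; apply: h; rewrite in_cons ?hj ?hk orbT.
move=> /In_map_mem [j js]; apply: h; rewrite ?mem_head ?in_cons ?js ?orbT //.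
by move=> e; move: his; rewrite e js.
Qed.

Lemma rsum_le_seq (T : eqType) (s : seq T) (f g : T -> R) :
  (forall i, i \in s -> f i <= g i) -> \rsum_(i <- s) f i <= \rsum_(i <- s) g i.
Proof.
elim: s => [|i s IH] h; first by rewrite !big_nil; lra.
rewrite !big_cons; have := h i (mem_head _ _).
suff: \rsum_(j <- s) f j <= \rsum_(j <- s) g j by lra.
by apply: IH => j hj; apply: h; rewrite in_cons hj orbT.
Qed.

(** Lagrange interpolation with error term: subtracting from f its
interpolation polynomial and the right multiple of the node polynomial leaves
a function with one zero more than there are nodes, so that Rolle's theorem
controls f(y) by the N-th derivative. *)
Lemma interpolation_bound (T : eqType) (s : seq T) (x : T -> R)
    (f : nat -> R -> R) (B g D delta y : R) :
  derivatives f -> uniq s -> 0 < g -> g <= B -> 0 <= D ->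
  (forall i, i \in s -> 0 <= x i <= B) ->
  (forall i j, i \in s -> j \in s -> i <> j -> g <= Rabs (x i - x j)) ->
  (forall z, 0 <= z <= B -> Rabs (f (size s) z) <= D) ->
  0 <= delta -> (forall i, i \in s -> Rabs (f 0%N (x i)) <= delta) ->
  0 <= y <= B ->
  Rabs (f 0%N y) <= INR (size s) * (delta * (B / g) ^ (size s).-1)
     + D * (B ^ size s / INR (fact (size s))).
Proof.
move=> df us g0 gB D0 hx hg hD d0 hdelta hy; set N := size s.
have Bg1 : 1 <= B / g by apply/Rle_div_r; lra.
have Bgp : 1 <= (B / g) ^ N.-1 by apply: pow_R1_Rle.
have fN := INR_fact_lt_0 N.
have Bp : 0 <= B ^ N by apply: pow_le; lra.
have H2 : 0 <= D * (B ^ N / INR (fact N)).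
  by apply: Rmult_le_pos => //; apply: Rdiv_le_0_compat.
have [[i is_ yi]|hny] := classic (exists2 i, i \in s & y = x i).
  have N1 : 1 <= INR N.
    by apply: (le_INR 1); rewrite /N; case: (s) is_ => //= *; lia.
  rewrite yi; have := hdelta i is_.
  suff: delta <= INR N * (delta * (B / g) ^ N.-1) by lra.
  have: 1 * (delta * 1) <= INR N * (delta * (B / g) ^ N.-1).
    apply: Rmult_le_compat => //; try lra.
    by apply: Rmult_le_compat_l.
  lra.
pose nodes i := map x (rem i s).
pose w i := f 0%N (x i) / node_poly (nodes i) 0 (x i).
pose P j z := \rsum_(i <- s) (w i * node_poly (nodes i) j z).
pose om := node_poly (map x s).
have omy : om 0%N y <> 0.
  suff: 0 < Rabs (om 0%N y) by move=> h e; rewrite e Rabs_R0 in h; lra.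
  have hny' : forall z, List.In z (map x s) -> 0 < Rabs (y - z).
    by move=> z /In_map_mem [i is_ ->]; apply: Rabs_pos_lt => e; apply: hny; exists i => //; lra.
  rewrite /om; elim: (map x s) hny' => [|z l IH] h /=; first by rewrite Rabs_R1; lra.
  rewrite INR_0 Rmult_0_l Rplus_0_r Rabs_mult; apply: Rmult_lt_0_compat.
    by apply: h; left.
  by apply: IH => t ht; apply: h; right.
(* P is the interpolation polynomial of f; c is chosen so that f - P - c om
   has the additional zero y. *)
pose c := (f 0%N y - P 0%N y) / om 0%N y.
pose G j z := f j z - P j z - c * om j z.
have dG : derivatives G.
  move=> j z; apply: is_derive_minus; first (apply: is_derive_minus).
  - exact: df.
  - apply: (is_derive_rsum _ s (fun i z => w i * node_poly (nodes i) j z)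
        (fun i z => w i * node_poly (nodes i) j.+1 z)) => i.
    exact: (is_derive_scal _ _ _ _ (node_poly_derivatives _ _ _)).
  - exact: (is_derive_scal _ _ _ _ (node_poly_derivatives _ _ _)).
have in_rem i j : i \in s -> j \in rem i s = (j != i) && (j \in s).
  by move=> is_; rewrite mem_rem_uniq.
have nz i : i \in s -> node_poly (nodes i) 0 (x i) <> 0 /\
    Rabs (w i * node_poly (nodes i) 0 y) <= delta * (B / g) ^ N.-1.
  move=> is_.
  have szn : size (nodes i) = N.-1 by rewrite size_map size_rem.
  have lo : g ^ N.-1 <= Rabs (node_poly (nodes i) 0 (x i)).
    rewrite -szn; apply: node_poly_lower; first lra.
    move=> z /In_map_mem [j]; rewrite in_rem // => /andP [/eqP ji js] ->.
    by apply: hg => // e; apply: ji.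
  have up : Rabs (node_poly (nodes i) 0 y) <= B ^ N.-1.
    rewrite -szn; apply: node_poly_upper; first lra.
    move=> z /In_map_mem [j]; rewrite in_rem // => /andP [_ js] ->.
    by have := hx j js; move=> ?; apply: Rabs_le; lra.
  have gp : 0 < g ^ N.-1 by apply: pow_lt.
  have nzi : node_poly (nodes i) 0 (x i) <> 0.
    by move=> e; rewrite e Rabs_R0 in lo; lra.
  split=> //; rewrite /w /Rdiv !Rabs_mult Rabs_inv Rpow_mult_distr pow_inv Rmult_assoc.
  apply: Rmult_le_compat; try exact: Rabs_pos.
  - by apply: Rmult_le_pos; [apply: Rlt_le; apply: Rinv_0_lt_compat; lra | apply: Rabs_pos].
  - exact: hdelta.
  rewrite Rmult_comm; apply: Rmult_le_compat => //; first exact: Rabs_pos.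
    by apply: Rlt_le; apply: Rinv_0_lt_compat; lra.
  by apply: Rinv_le_contravar.
have Gx i : i \in s -> G 0%N (x i) = 0.
  move=> is_; rewrite /G /om node_poly_root; last exact: mem_In_map.
  suff -> : P 0%N (x i) = f 0%N (x i) by ring.
  rewrite /P (big_rem i) //= big1_seq /=.
    by rewrite /w; field; exact: (proj1 (nz i is_)).
  move=> j; rewrite in_rem // => /andP [ji js].
  rewrite node_poly_root; first ring.
  by apply: mem_In_map; rewrite in_rem // eq_sym ji.
have Gy : G 0%N y = 0 by rewrite /G /c; field.
have ndup : NoDup (y :: map x s).
  constructor; first by move=> /In_map_mem [i is_ e]; apply: hny; exists i.
  apply: NoDup_map => // i j is_ js ij e.
  by have := hg i j is_ js ij; rewrite e Rminus_diag Rabs_R0; lra.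
have [s' [s's szs' ins']] := sort_exists _ ndup.
have [||xi hxi Gxi] := @rolle_iter G 0 B N 0 s' dG s's.
- by rewrite szs' /= size_map.
- apply/List.Forall_forall => z /ins' /= [<- //|/In_map_mem [i is_ ->]].
  by split; [apply: Gx | apply: hx].
have PN : P N xi = 0.
  rewrite /P big1_seq // => i /andP [_ is_]; rewrite node_poly_high; first ring.
  rewrite size_map size_rem // -/N prednK //.
  by rewrite /N; case: (s) is_.
(* P has degree less than N, and om is monic of degree N. *)
have cN : c = f N xi / INR (fact N).
  have -> : f N xi = c * INR (fact N); last by field; lra.
  have <- : om N xi = INR (fact N).
    by have := node_poly_top (map x s) xi; rewrite size_map.
  by move: Gxi; rewrite /G add0n PN; lra.
have -> : f 0%N y = P 0%N y + c * om 0%N y by move: Gy; rewrite /G; lra.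
apply: Rle_trans (Rabs_triang _ _) _; apply: Rplus_le_compat.
  apply: (Rle_trans _ _ _ (rsum_abs _ _ _)); rewrite -rsum_const.
  by apply: rsum_le_seq => i is_; exact: (proj2 (nz i is_)).
rewrite cN Rabs_mult /Rdiv Rabs_mult Rmult_assoc (Rabs_pos_eq (/ _)); last first.
  by apply: Rlt_le; apply: Rinv_0_lt_compat.
apply: Rmult_le_compat; first exact: Rabs_pos.
- by apply: Rmult_le_pos; [apply: Rlt_le; apply: Rinv_0_lt_compat | exact: Rabs_pos].
- exact: hD.
rewrite Rmult_comm; apply: Rmult_le_compat_r.
  by apply: Rlt_le; apply: Rinv_0_lt_compat.
rewrite /om /N -(size_map x s); apply: node_poly_upper; first lra.
by move=> z /In_map_mem [i is_ ->]; have := hx i is_ => ?; apply: Rabs_le; lra.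
Qed.

(** * Exponential polynomials *)

Definition expoly (lam : R) (K L : nat) (c : nat -> nat -> R) (x : R) : R :=
  \rsum_(l < L) \rsum_(k < K) (c k l * x ^ k * exp (lam * INR l * x)).

(** The coefficients of the derivative of expoly; working on coefficients
makes higher derivatives mere iterates. *)
Definition coef_deriv (lam : R) (c : nat -> nat -> R) (k l : nat) : R :=
  INR k.+1 * c k.+1 l + lam * INR l * c k l.

(** A weighted norm that dominates expoly on [0,r] and that differentiation
multiplies by at most K/r + lam L. *)
Definition coef_norm (K L : nat) (r : R) (c : nat -> nat -> R) : R :=
  \rsum_(l < L) \rsum_(k < K) (Rabs (c k l) * r ^ k).

Definition degree_below (K : nat) (c : nat -> nat -> R) : Prop :=
  forall k l, (K <= k)%N -> c k l = 0.

Lemma rsum_shift (K : nat) (h : nat -> R) : h 0%N = 0 -> h K = 0 ->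
  \rsum_(k < K) h k.+1 = \rsum_(k < K) h k.
Proof.
move=> h0 hK.
have : \rsum_(k < K.+1) h k = h 0%N + \rsum_(k < K) h k.+1.
  by rewrite big_ord_recl; congr Rplus; apply: eq_bigr => i _; rewrite lift0.
by rewrite big_ord_recr /= h0 hK Rplus_0_l Rplus_0_r => ->.
Qed.

Lemma degree_below_iter (lam : R) (K : nat) (c : nat -> nat -> R) (j : nat) :
  degree_below K c -> degree_below K (iter j (coef_deriv lam) c).
Proof.
move=> h; elim: j => //= j IH k l hk.
by rewrite /coef_deriv !IH //; [ring | exact: leqW].
Qed.

Lemma expoly_deriv (lam : R) (K L : nat) (c : nat -> nat -> R) (x : R) :
  degree_below K c ->
  is_derive (expoly lam K L c) x (expoly lam K L (coef_deriv lam c) x).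
Proof.
move=> hc.
pose g (l k : nat) x := INR k * c k l * x ^ k.-1 * exp (lam * INR l * x)
   + lam * INR l * c k l * x ^ k * exp (lam * INR l * x).
have -> : expoly lam K L (coef_deriv lam c) x = \rsum_(l < L) \rsum_(k < K) g l k x.
  apply: eq_bigr => l _; rewrite big_split /=.
  rewrite -(rsum_shift K (fun k => INR k * c k l * x ^ k.-1 * exp (lam * INR l * x))).
  - rewrite -big_split /=; apply: eq_bigr => k _; rewrite /coef_deriv.
    ring.
  - by rewrite INR_0; ring.
  - by rewrite hc //; ring.
apply: (is_derive_rsum _ _ (fun (l : 'I_L) x => _) (fun (l : 'I_L) x => \rsum_(k < K) g l k x)) => l.
apply: (is_derive_rsum _ _ (fun (k : 'I_K) x => _) (fun (k : 'I_K) x => g l k x)) => k.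
auto_derive => //; rewrite /g; ring.
Qed.

Lemma expoly_derivatives (lam : R) (K L : nat) (c : nat -> nat -> R) :
  degree_below K c ->
  derivatives (fun j => expoly lam K L (iter j (coef_deriv lam) c)).
Proof. by move=> h j x; apply: expoly_deriv; apply: degree_below_iter. Qed.

Lemma coef_norm_ge0 (K L : nat) (r : R) (c : nat -> nat -> R) :
  0 <= r -> 0 <= coef_norm K L r c.
Proof.
move=> r0; apply: rsum_ge0 => l; apply: rsum_ge0 => k.
by apply: Rmult_le_pos; [apply: Rabs_pos | apply: pow_le].
Qed.

Lemma coef_norm_deriv (lam r : R) (K L : nat) (c : nat -> nat -> R) :
  0 <= lam -> 0 < r -> degree_below K c ->
  coef_norm K L r (coef_deriv lam c) <= (INR K / r + lam * INR L) * coef_norm K L r c.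
Proof.
move=> lam0 r0 hc; rewrite /coef_norm -rsum_mull; apply: rsum_le => l.
have lL : INR l <= INR L by apply: le_INR; apply/leP; apply: ltnW.
have l0 := pos_INR l.
apply: (Rle_trans _ (\rsum_(k < K) (INR k.+1 * Rabs (c k.+1 l) * r ^ k)
          + \rsum_(k < K) (lam * INR L * (Rabs (c k l) * r ^ k)))).
  rewrite -big_split; apply: rsum_le => k /=.
  have rk : 0 <= r ^ k by apply: pow_le; lra.
  have h1 := Rabs_triang (INR k.+1 * c k.+1 l) (lam * INR l * c k l).
  rewrite -Rmult_assoc -Rmult_plus_distr_r; apply: Rmult_le_compat_r => //.
  apply: (Rle_trans _ _ _ h1); rewrite !Rabs_mult !(Rabs_pos_eq (INR _)); try exact: pos_INR.
  rewrite (Rabs_pos_eq lam) //; apply: Rplus_le_compat_l; apply: Rmult_le_compat_r.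
    exact: Rabs_pos.
  exact: Rmult_le_compat_l.
rewrite Rmult_plus_distr_r; apply: Rplus_le_compat; last first.
  by rewrite rsum_mull; apply: Rle_refl.
rewrite (rsum_shift K (fun k => INR k * Rabs (c k l) * r ^ k.-1)).
- rewrite -rsum_mull; apply: rsum_le => k.
  have kK : INR k <= INR K by apply: le_INR; apply/leP; apply: ltnW.
  have -> : INR K / r * (Rabs (c k l) * r ^ k) = (INR K * Rabs (c k l)) * (r ^ k / r).
    by field; lra.
  have hp := Rabs_pos (c k l).
  case: (nat_of_ord k) kK hp => [|k'] kK hp.
    rewrite INR_0 !Rmult_0_l; apply: Rmult_le_pos; first by apply: Rmult_le_pos => //; apply: pos_INR.
    by apply: Rdiv_le_0_compat => //=; lra.
  have -> : r ^ k'.+1 / r = r ^ k' by rewrite /=; field; lra.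
  apply: Rmult_le_compat_r; first by apply: pow_le; lra.
  apply: Rmult_le_compat_r => //; exact: Rabs_pos.
- by rewrite INR_0; ring.
- by rewrite hc // Rabs_R0; ring.
Qed.

Lemma coef_norm_iter (lam r : R) (K L j : nat) (c : nat -> nat -> R) :
  0 <= lam -> 0 < r -> degree_below K c ->
  coef_norm K L r (iter j (coef_deriv lam) c)
    <= (INR K / r + lam * INR L) ^ j * coef_norm K L r c.
Proof.
move=> lam0 r0 hc; elim: j => [|j IH]; first by rewrite /=; lra.
rewrite iterS -tech_pow_Rmult Rmult_assoc.
apply: (Rle_trans _ _ _ (coef_norm_deriv _ _ _ _ _ lam0 r0 (degree_below_iter _ _ _ j hc))).
apply: Rmult_le_compat_l => //.
apply: Rplus_le_le_0_compat; first by apply: Rdiv_le_0_compat => //; apply: pos_INR.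
by apply: Rmult_le_pos => //; apply: pos_INR.
Qed.

Lemma expoly_bound (lam r x : R) (K L : nat) (c : nat -> nat -> R) :
  0 <= lam -> 0 <= x <= r ->
  Rabs (expoly lam K L c x) <= coef_norm K L r c * exp (lam * INR L * r).
Proof.
move=> lam0 hx; apply: (Rle_trans _ _ _ (rsum_abs _ _ _)).
rewrite Rmult_comm -rsum_mull; apply: rsum_le => l.
apply: (Rle_trans _ _ _ (rsum_abs _ _ _)); rewrite -rsum_mull; apply: rsum_le => k.
rewrite !Rabs_mult (Rabs_pos_eq (exp _)); last by apply: Rlt_le; apply: exp_pos.
have hp := Rabs_pos (c k l).
have e : exp (lam * INR l * x) <= exp (lam * INR L * r).
  have lL : INR l <= INR L by apply: le_INR; apply/leP; apply: ltnW.
  have := pos_INR l => l0.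
  have : lam * INR l * x <= lam * INR L * r.
    apply: Rmult_le_compat; try lra; first exact: Rmult_le_pos.
    exact: Rmult_le_compat_l.
  by case=> [h|->]; [left; apply: exp_increasing | right].
rewrite Rmult_comm; apply: Rmult_le_compat => //.
- by apply: Rlt_le; apply: exp_pos.
- by apply: Rmult_le_pos => //; apply: Rabs_pos.
apply: Rmult_le_compat_l => //; rewrite -RPow_abs; apply: pow_incr.
by rewrite Rabs_pos_eq; lra.
Qed.

(** Descending induction on the degree: the operator is triangular, with
diagonal entries lam l. *)
Lemma coef_deriv_inj (lam : R) (K l : nat) (c : nat -> nat -> R) :
  0 < lam -> (0 < l)%N -> degree_below K c ->
  (forall k, coef_deriv lam c k l = 0) -> forall k, c k l = 0.
Proof.
move=> lam0 l0 hc h.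
suff H : forall i k, (K <= k + i)%N -> c k l = 0 by move=> k; apply: (H K); rewrite leq_addl.
elim=> [|i IH] k hk; first by apply: hc; rewrite addn0 in hk.
have := h k; rewrite /coef_deriv (IH k.+1); last by rewrite addSnnS.
rewrite Rmult_0_r Rplus_0_l.
have lp : 0 < INR l by apply: (lt_INR 0); apply/ltP.
by move=> /Rmult_integral [] // e; have := Rmult_lt_0_compat _ _ lam0 lp; lra.
Qed.

Lemma upper_bound_list (s : seq R) : exists B, List.Forall (fun y => y <= B) s.
Proof.
elim: s => [|y s [B hB]]; first by exists 0; constructor.
exists (Rmax y B); constructor; first exact: Rmax_l.
by apply: List.Forall_impl hB => z ?; apply: (Rle_trans _ B) => //; apply: Rmax_r.
Qed.

(** The base of the zero count: the derivative determines all coefficients but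
the constant term, and one zero settles the latter. *)
Lemma expoly_const_zero (lam : R) (K L : nat) (c : nat -> nat -> R) (x : R) :
  0 < lam -> degree_below K c -> expoly lam K L.+1 c x = 0 ->
  (forall k l, (l <= L)%N -> coef_deriv lam c k l = 0) ->
  forall k l, (l <= L)%N -> c k l = 0.
Proof.
move=> lam0 hc hx hD.
have cl k l : (0 < l)%N -> (l <= L)%N -> c k l = 0.
  by move=> l0 lL; apply: (@coef_deriv_inj lam K l c) => // k'; apply: hD.
have cS k : c k.+1 0%N = 0.
  have := hD k 0%N isT; rewrite /coef_deriv INR_0 Rmult_0_r Rmult_0_l Rplus_0_r.
  by move=> /Rmult_integral [] // e; have := lt_0_INR k.+1 (Nat.lt_0_succ k); lra.
have c0 : c 0%N 0%N = 0.
  case: (posnP K) => [K0|Kp]; first by apply: hc; rewrite K0.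
  move: hx; rewrite /expoly big_ord_recl [X in _ + X]big1 /=; last first.
    move=> i _; apply: big1 => k _; rewrite cl //.
    by rewrite !Rmult_0_l.
  case: K Kp {hc} => // K _; rewrite big_ord_recl big1 /=.
    by rewrite !Rmult_0_r Rmult_0_l exp_0; lra.
  by move=> i _; rewrite cS !Rmult_0_l.
by move=> [|k] [|l] hl //; apply: cl.
Qed.

(** A nonzero exponential polynomial has fewer real zeros than coefficients:
differentiating lowers the degree of the polynomial without exponential
factor, and once this one has disappeared, a division by exp(lam x) leaves
one exponential less. *)
Lemma expoly_zeros (lam : R) (K L J : nat) (c : nat -> nat -> R) (s : seq R) :
  0 < lam -> degree_below K c -> (forall k, (J <= k)%N -> c k 0%N = 0) ->
  StronglySorted Rlt s -> (size s = J + K * L)%N ->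
  List.Forall (fun x => expoly lam K L.+1 c x = 0) s ->
  forall k l, (l <= L)%N -> c k l = 0.
Proof.
move=> lam0; elim: L J c s => [|L IHL]; elim=> [|J IHJ] c s hc hJ hs szs hz.
1: by move=> k l; rewrite leqn0 => /eqP ->; apply: hJ.
2: { have E y : expoly lam K L.+2 c y
         = exp (lam * y) * expoly lam K L.+1 (fun k l => c k l.+1) y.
       rewrite /expoly big_ord_recl big1 /=; last first.
         by move=> i _; rewrite hJ //; ring.
       rewrite Rplus_0_l -rsum_mull; apply: eq_bigr => l _.
       rewrite -rsum_mull; apply: eq_bigr => k _; rewrite /bump /= add1n S_INR.
       by rewrite Rmult_plus_distr_l Rmult_plus_distr_r exp_plus Rmult_1_r; ring.
     have H : forall k l, (l <= L)%N -> c k l.+1 = 0.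
       apply: (IHL K (fun k l => c k l.+1) s) => //.
       - by move=> k l; apply: hc.
       - by move=> k; apply: hc.
       - by rewrite szs add0n mulnS.
       apply: List.Forall_impl hz => y; rewrite E => /Rmult_integral [] // e.
       by have := exp_pos (lam * y); lra.
     by move=> k [|l] hl; [apply: hJ | apply: H]. }
all: case: s hs szs hz => [|x s] hs // [szs] hz;
  apply: (@expoly_const_zero lam K _ c x) => //; first by inversion hz.
all: have [B hB] := upper_bound_list (x :: s).
all: have hz' := List.Forall_and hz hB.
all: have [s' [s's szs' hs']] := @rolle_list _ _ B s x
    (fun y => expoly_deriv lam K _ c y hc) hs hz'.
all: apply: (IHJ (coef_deriv lam c) s') => //.
all: try exact: (degree_below_iter lam K c 1).
all: try by rewrite szs' szs.
all: try by apply: List.Forall_impl hs' => y [].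
all: by move=> k' hk'; rewrite /coef_deriv (hJ k'.+1) // INR_0; ring.
Qed.

(** * Siegel's lemma *)

(** Pigeonhole: a system with bounded nonnegative integer coefficients and
twice as many unknowns as equations takes fewer values on the box of side H
than the box has points, so that two distinct points have the same image. *)
Lemma siegel (E X : finType) (A : E -> X -> nat) (B : nat) :
  (0 < #|E|)%N -> #|X| = (2 * #|E|)%N -> (0 < B)%N ->
  (forall e x, (A e x <= B)%N) ->
  exists f g : X -> nat,
    [/\ forall x, (f x <= #|X| * B)%N, forall x, (g x <= #|X| * B)%N,
        exists x, f x <> g x
      & forall e, (\sum_x f x * A e x = \sum_x g x * A e x)%N].
Proof.
move=> E0 XE B0 hA; pose H := (#|X| * B)%N.
have H0 : (0 < H)%N by rewrite muln_gt0 B0 XE muln_gt0 E0.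
have hs (f : {ffun X -> 'I_H.+1}) e : (\sum_x f x * A e x < (H * H).+1)%N.
  rewrite ltnS; apply: (@leq_trans (\sum_(x : X) H * B)%N).
    apply: leq_sum => x _; apply: leq_mul; [exact: leq_ord | exact: hA].
  by rewrite sum_nat_const mulnCA -/H.
pose F (f : {ffun X -> 'I_H.+1}) : {ffun E -> 'I_(H * H).+1} :=
  [ffun e => Ordinal (hs f e)].
have [inj|] := boolP (injectiveb F).
  have := leq_card F (injectiveP F inj).
  rewrite !card_ffun !card_ord XE leqNgt; case/negP.
  rewrite expnM ltn_exp2r // -mulnn.
  by rewrite mulSn mulnS addSn ltnS addnA -[X in (X < _)%N]add0n ltn_add2r addn_gt0 H0.
case/injectivePn => f [g fg Ffg].
exists (fun x => nat_of_ord (f x)), (fun x => nat_of_ord (g x)); split; try by move=> x; apply: leq_ord.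
  apply: NNPP => hn; case/eqP: fg; apply/ffunP => x; apply: val_inj.
  by apply: NNPP => hx; apply: hn; exists x.
by move=> e; have := congr1 (fun h : {ffun E -> 'I_(H * H).+1} => nat_of_ord (h e)) Ffg; rewrite !ffunE.
Qed.

(** * A lower bound for linear forms in two logarithms *)

Lemma pow_div_fact_le (x : R) (n : nat) : 0 <= x -> x ^ n / INR (fact n) <= exp x.
Proof.
move=> x0.
suff H : forall y, 0 <= y -> y ^ n / INR (fact n) <= exp y by exact: H.
elim: n => [|n IH] y y0.
  rewrite /= Rdiv_1_r; have := exp_ineq1_le y; lra.
have fn := INR_fact_lt_0 n.
have fE : INR (fact n.+1) = INR n.+1 * INR (fact n) by rewrite -mult_INR.
have Sn : 0 < INR n.+1 by apply: lt_0_INR; lia.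
pose h z := exp z - z ^ n.+1 / INR (fact n.+1).
have dh z : is_derive h z (exp z - z ^ n / INR (fact n)).
  rewrite /h; auto_derive => //; rewrite fE; field; lra.
case: y0 => [y0|<-]; last by rewrite pow_i; [rewrite /Rdiv Rmult_0_l exp_0; lra | lia].
have [z [hz zy]] : exists z, h y - h 0 = (exp z - z ^ n / INR (fact n)) * (y - 0) /\ 0 < z < y.
  by apply: MVT_cor2 => // z _; apply/is_derive_Reals; apply: dh.
have h0 : h 0 = 1 by rewrite /h exp_0 pow_i; [rewrite /Rdiv Rmult_0_l; lra | lia].
have : 0 <= (exp z - z ^ n / INR (fact n)) * (y - 0).
  by apply: Rmult_le_pos; [have := IH z; lra | lra].
rewrite /h in hz h0 *; lra.
Qed.

(** Compare the exponential with the term of degree p + 1 of its series. *)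
Lemma exp_dominates (C : R) (p : nat) :
  exists w0 : R, forall x, w0 <= x -> C * x ^ p <= exp x.
Proof.
exists (Rmax 1 (C * INR (fact p.+1))) => x hx.
have x1 : 1 <= x by apply: Rle_trans hx; apply: Rmax_l.
have xC : C * INR (fact p.+1) <= x by apply: Rle_trans hx; apply: Rmax_r.
have := pow_div_fact_le x p.+1; have fp := INR_fact_lt_0 p.+1.
have xp : 0 <= x ^ p by apply: pow_le; lra.
suff : C * x ^ p <= x ^ p.+1 / INR (fact p.+1) by lra.
have e : x ^ p.+1 = x * x ^ p by [].
apply: (Rmult_le_reg_r _ _ _ fp); rewrite /Rdiv Rmult_assoc [X in _ <= X]Rmult_assoc Rinv_l; last lra.
rewrite e; have := Rmult_le_compat_r _ _ _ xp xC; lra.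
Qed.

Lemma ln_nat_ge (a : nat) : (2 <= a)%N -> / 2 < ln (INR a).
Proof.
move=> ha; apply: Rlt_le_trans ln_lt_2 _; apply: ln_le; first lra.
by apply: (le_INR 2); apply/leP.
Qed.

Lemma nat_dist (p q : nat) : p <> q -> 1 <= Rabs (INR p - INR q).
Proof.
move=> pq; have [h|h] : (p.+1 <= q)%coq_nat \/ (q.+1 <= p)%coq_nat by lia.
  have := le_INR _ _ h; rewrite S_INR => ?; rewrite Rabs_left1; lra.
have := le_INR _ _ h; rewrite S_INR => ?; rewrite Rabs_pos_eq; lra.
Qed.

Lemma INR_mul (p q : nat) : INR (p * q)%N = INR p * INR q.
Proof. exact: mult_INR. Qed.

Lemma INR_exp (a p : nat) : INR (a ^ p)%N = INR a ^ p.
Proof. by elim: p => [|p IH]; rewrite ?expnS ?INR_mul ?IH. Qed.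

Lemma exp_mul_ln (a p : nat) : (0 < a)%N -> exp (INR p * ln (INR a)) = INR (a ^ p)%N.
Proof.
move=> a0; have ap : 0 < INR a by apply: lt_0_INR; apply/ltP.
by rewrite -/(Rpower (INR a) (INR p)) Rpower_pow // INR_exp.
Qed.

(** Distinct integers differ by at least one; read on the logarithms of powers. *)
Lemma log_form_liouville (a b p q : nat) : (2 <= a)%N -> (2 <= b)%N ->
  (a ^ p)%N <> (b ^ q)%N ->
  exp (- (INR p * ln (INR a) + INR q * ln (INR b)))
    <= Rabs (INR p * ln (INR a) - INR q * ln (INR b)).
Proof.
move=> ha hb hne; set x := INR p * _; set y := INR q * _.
have x0 : 0 <= x.
  by apply: Rmult_le_pos; [apply: pos_INR | have := ln_nat_ge _ ha; lra].
have y0 : 0 <= y.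
  by apply: Rmult_le_pos; [apply: pos_INR | have := ln_nat_ge _ hb; lra].
have := nat_dist _ _ hne; rewrite -!exp_mul_ln; try exact: ltnW.
rewrite -/x -/y => hd.
have key s t : 0 <= s -> 0 <= t -> 1 <= exp t - exp s -> exp (- (s + t)) <= t - s.
  move=> s0 t0 h; have h1 := exp_ineq1_le (s - t).
  have h2 : exp (s - t) = exp s / exp t by rewrite exp_plus exp_Ropp.
  have pt := exp_pos t.
  have : 1 - exp (s - t) >= exp (- t).
    rewrite h2 exp_Ropp; have -> : 1 - exp s / exp t = (exp t - exp s) * / exp t by field; lra.
    have := Rinv_0_lt_compat _ pt; nra.
  have : exp (- (s + t)) <= exp (- t).
    by case: s0 => [s0|<-]; [left; apply: exp_increasing; lra | rewrite Rplus_0_l; lra].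
  lra.
have [xy|yx] := Rle_lt_dec x y.
  have exy : exp x <= exp y by case: xy => [?|->]; [left; apply: exp_increasing | right].
  have h1 : 1 <= exp y - exp x by move: hd; rewrite Rabs_left1; lra.
  by have := key x y x0 y0 h1; rewrite Rabs_left1; lra.
have exy : exp y <= exp x by left; apply: exp_increasing.
have h1 : 1 <= exp x - exp y by move: hd; rewrite Rabs_pos_eq; lra.
by have := key y x y0 x0 h1; rewrite (Rplus_comm y) Rabs_pos_eq; lra.
Qed.

(** The node u + v log b / log a, at which a^x = a^u b^v is an integer. *)
Definition node (a b : nat) (uv : nat * nat) : R :=
  INR uv.1 + INR uv.2 * (ln (INR b) / ln (INR a)).

Definition mult_independent (a b : nat) : Prop :=
  forall p q : nat, (a ^ p)%N = (b ^ q)%N -> p = 0%N /\ q = 0%N.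

(** Differences of nodes are linear forms in log a and log b with small
integral coefficients, to which Liouville's bound applies; nonvanishing is
multiplicative independence. *)
Lemma node_gap (a b U : nat) (i j : nat * nat) :
  (2 <= a)%N -> (2 <= b)%N -> mult_independent a b ->
  (i.1 <= U)%N -> (i.2 <= U)%N -> (j.1 <= U)%N -> (j.2 <= U)%N -> i <> j ->
  exp (- (INR U * (ln (INR a) + ln (INR b)))) / ln (INR a) <= Rabs (node a b i - node a b j).
Proof.
move=> ha hb hab; case: i j => [u v] [u' v'] /= hu hv hu' hv' hne.
have la := ln_nat_ge _ ha; have lb := ln_nat_ge _ hb.
set A := ln (INR a) in la *; set B := ln (INR b) in lb *.
have -> : Rabs (node a b (u, v) - node a b (u', v'))
   = Rabs ((INR u - INR u') * A + (INR v - INR v') * B) / A.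
  have -> : node a b (u, v) - node a b (u', v')
      = ((INR u - INR u') * A + (INR v - INR v') * B) * / A.
    by rewrite /node /= -/A -/B; field; lra.
  by rewrite Rabs_mult Rabs_inv (Rabs_pos_eq A) //; lra.
apply: Rmult_le_compat_r; first by apply: Rlt_le; apply: Rinv_0_lt_compat; lra.
have leU p : (p <= U)%N -> INR p <= INR U by move=> /leP /le_INR.
have key (p q : nat) : (p <= U)%N -> (q <= U)%N -> (p, q) <> (0%N, 0%N) ->
    exp (- (INR U * (A + B))) <= Rabs (INR p * A + INR q * B) /\
    exp (- (INR U * (A + B))) <= Rabs (INR p * A - INR q * B).
  move=> pU qU pq; have p0 := pos_INR p; have q0 := pos_INR q.
  have pU' := leU _ pU; have qU' := leU _ qU.
  have h : exp (- (INR U * (A + B))) <= Rabs (INR p * A - INR q * B).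
    apply: (Rle_trans _ (exp (- (INR p * A + INR q * B)))).
      have : - (INR U * (A + B)) <= - (INR p * A + INR q * B) by nra.
      by case=> [?|->]; [left; apply: exp_increasing | right].
    apply: log_form_liouville => // e.
    by have [e1 e2] := hab _ _ e; apply: pq; rewrite e1 e2.
  split=> //; apply: (Rle_trans _ _ _ h).
  rewrite (Rabs_pos_eq (_ + _)); last nra.
  by apply: Rabs_le; nra.
have sub p q : (q <= p)%N -> INR (p - q)%N = INR p - INR q.
  by move=> h; rewrite minus_INR //; apply/leP.
have bd p q : (p <= U)%N -> (p - q <= U)%N by move=> h; apply: leq_trans h; apply: leq_subr.
have ne0 p q : p <> q -> (p - q = 0)%N -> (p < q)%N.
  by move=> h /eqP; rewrite subn_eq0 ltn_neqAle => ->; rewrite andbT; apply/eqP.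
(* Truncated subtraction: the four cases below are the signs of u - u' and
   v - v', and pr says that the absolute differences are not both zero. *)
have pr (p q r t : nat) : (q <= p)%N -> (t <= r)%N -> ((p, r) <> (q, t)) -> ((p - q, r - t) <> (0, 0))%N.
  move=> qp tr h [/eqP e1 /eqP e2]; apply: h; congr pair; apply/eqP; rewrite eqn_leq.
    by rewrite -subn_eq0 e1 qp.
  by rewrite -subn_eq0 e2 tr.
case: (leqP u' u) => [h1|/ltnW h1]; case: (leqP v' v) => [h2|/ltnW h2].
- by have [] := key _ _ (bd u u' hu) (bd v v' hv) (pr _ _ _ _ h1 h2 hne); rewrite !sub.
- have [] := key (u - u')%N (v' - v)%N (bd _ _ hu) (bd _ _ hv').
    by apply: pr => // -[e1 e2]; apply: hne; rewrite e1 e2.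
  rewrite !sub // => _; congr (_ <= Rabs _); ring.
- have [] := key (u' - u)%N (v - v')%N (bd _ _ hu') (bd _ _ hv).
    by apply: pr => // -[e1 e2]; apply: hne; rewrite e1 e2.
  rewrite !sub // => _; rewrite -Rabs_Ropp; congr (_ <= Rabs _); ring.
- have [] := key _ _ (bd u' u hu') (bd v' v hv') (pr _ _ _ _ h1 h2 (fun e => hne (esym e))).
  rewrite !sub // => + _; rewrite -Rabs_Ropp; congr (_ <= Rabs _); ring.
Qed.

Lemma exp_le (x y : R) : x <= y -> exp x <= exp y.
Proof. by case=> [?|->]; [left; apply: exp_increasing | right]. Qed.

(** The numerator, over the denominator m^K, of the monomial x^k exp(lam l x)
at the node u + v theta once the factor x has been replaced by its rational
approximation u + v n/m. *)
Definition int_value (a b m n K k l u v : nat) : nat :=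
  ((u * m + v * n) ^ k * m ^ (K - k) * (a ^ (l * u) * b ^ (l * v)))%N.

Lemma int_value_bound (a b m n K L U k l u v : nat) :
  (0 < a)%N -> (0 < b)%N -> (0 < m)%N -> (0 < U)%N ->
  (k <= K)%N -> (l <= L)%N -> (u <= U)%N -> (v <= U)%N ->
  (int_value a b m n K k l u v <= (U * (m + n)) ^ K * (a * b) ^ (L * U))%N.
Proof.
move=> a0 b0 m0 U0 hk hl hu hv; rewrite /int_value [((a * b) ^ _)%N]expnMn.
apply: leq_mul; last first.
  by apply: leq_mul; apply: leq_pexp2l => //; apply: leq_mul.
rewrite -{2}(subnKC hk) expnD; apply: leq_mul.
  case: k {hk} => // k; rewrite leq_exp2r // mulnDr.
  by apply: leq_add; apply: leq_mul.
case: (K - k)%N => // j; rewrite leq_exp2r // -[X in (X <= _)%N]mul1n.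
by apply: leq_mul => //; apply: leq_addr.
Qed.

Lemma pow_diff_bound (x y r : R) (k : nat) :
  0 <= x <= r -> 0 <= y <= r -> 1 <= r ->
  Rabs (x ^ k - y ^ k) <= INR k * r ^ k * Rabs (x - y).
Proof.
move=> hx hy r1; elim: k => [|k IH].
  by rewrite /= Rminus_diag Rabs_R0 INR_0; lra.
have -> : x ^ k.+1 - y ^ k.+1 = x * (x ^ k - y ^ k) + (x - y) * y ^ k by rewrite /=; ring.
apply: (Rle_trans _ _ _ (Rabs_triang _ _)); rewrite !Rabs_mult S_INR.
have rk : 1 <= r ^ k by apply: pow_R1_Rle.
have d0 := Rabs_pos (x - y).
have h1 : Rabs x * Rabs (x ^ k - y ^ k) <= r * (INR k * r ^ k * Rabs (x - y)).
  apply: Rmult_le_compat => //; try exact: Rabs_pos.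
  by rewrite Rabs_pos_eq; lra.
have h2 : Rabs (x - y) * Rabs (y ^ k) <= Rabs (x - y) * r ^ k.+1.
  apply: Rmult_le_compat_l => //; rewrite -RPow_abs (Rabs_pos_eq y); last lra.
  apply: (Rle_trans _ (r ^ k)); first exact: pow_incr.
  by rewrite /=; nra.
have e : r ^ k.+1 = r * r ^ k by [].
rewrite e in h2 *; lra.
Qed.

(** Exactness of the exponential factors at the nodes: only the powers of the
node are affected by the rational approximation. *)
Lemma expoly_node_approx (a b m n K L u v : nat) (c : nat -> nat -> R) (H r : R) :
  (2 <= a)%N -> (2 <= b)%N -> (0 < m)%N ->
  1 <= r -> node a b (u, v) <= r -> INR u + INR v * (INR n / INR m) <= r ->
  (forall k l, Rabs (c k l) <= H) ->
  Rabs (expoly (ln (INR a)) K L c (node a b (u, v))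
     - (\rsum_(l < L) \rsum_(k < K) (c k l * INR (int_value a b m n K k l u v))) / INR m ^ K)
  <= INR L * (INR K * (H * (INR K * r ^ K * (INR v *
       Rabs (ln (INR b) / ln (INR a) - INR n / INR m))) * exp (ln (INR a) * INR L * r))).
Proof.
move=> ha hb m0 r1 xr yr hc.
have la := ln_nat_ge _ ha; have lb := ln_nat_ge _ hb.
set A := ln (INR a) in la *; set B := ln (INR b) in lb *.
have mp : 0 < INR m by apply: lt_0_INR; apply/ltP.
set x := node a b (u, v) in xr *; set y := _ + _ in yr.
have u0 := pos_INR u; have v0 := pos_INR v; have n0 := pos_INR n.
have x0 : 0 <= x.
  rewrite /x /node /= -/A -/B.
  by apply: Rplus_le_le_0_compat => //; apply: Rmult_le_pos => //; apply: Rdiv_le_0_compat; lra.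
have y0 : 0 <= y.
  by apply: Rplus_le_le_0_compat => //; apply: Rmult_le_pos => //; apply: Rdiv_le_0_compat; lra.
have hxy : Rabs (x - y) <= INR v * Rabs (B / A - INR n / INR m).
  have -> : x - y = INR v * (B / A - INR n / INR m) by rewrite /x /node /= -/A -/B /y; ring.
  by rewrite Rabs_mult (Rabs_pos_eq (INR v)) //; lra.
have H0 : 0 <= H by apply: Rle_trans (hc 0%N 0%N); apply: Rabs_pos.
rewrite /Rdiv [X in _ - X]Rmult_comm -rsum_mull /expoly rsum_sub.
apply: (Rle_trans _ _ _ (rsum_abs _ _ _)); apply: rsum_bound => l.
rewrite -rsum_mull rsum_sub.
apply: (Rle_trans _ _ _ (rsum_abs _ _ _)); apply: rsum_bound => k.
have kK : (k <= K)%N by apply: ltnW.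
have kKR : INR k <= INR K by apply: le_INR; apply/leP.
have E : exp (A * INR l * x) = INR (a ^ (l * u))%N * INR (b ^ (l * v))%N.
  rewrite -!exp_mul_ln; try exact: ltnW.
  rewrite -exp_plus /x /node /= -/A -/B !INR_mul; congr exp; field; lra.
have Ebd : exp (A * INR l * x) <= exp (A * INR L * r).
  apply: exp_le; have lL : INR l <= INR L by apply: le_INR; apply/leP; apply: ltnW.
  have l0 := pos_INR l.
  apply: Rmult_le_compat => //; first by apply: Rmult_le_pos; lra.
  by apply: Rmult_le_compat_l; lra.
have Em : / INR m ^ K * (c k l * INR (int_value a b m n K k l u v))
    = c k l * y ^ k * exp (A * INR l * x).
  rewrite E /int_value !INR_mul !INR_exp plus_INR !INR_mul.
  have -> : INR m ^ K = INR m ^ k * INR m ^ (K - k).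
    by rewrite -pow_add; congr pow; rewrite -[(_ + _)%coq_nat]/(k + (K - k))%N subnKC.
  have -> : INR u * INR m + INR v * INR n = y * INR m by rewrite /y; field; lra.
  have p1 : INR m ^ k <> 0 by apply: pow_nonzero; lra.
  have p2 : INR m ^ (K - k) <> 0 by apply: pow_nonzero; lra.
  by rewrite Rpow_mult_distr; field.
rewrite Em -Rmult_minus_distr_r -Rmult_minus_distr_l !Rabs_mult.
rewrite (Rabs_pos_eq (exp _)); last by apply: Rlt_le; apply: exp_pos.
apply: Rmult_le_compat => //.
- by apply: Rmult_le_pos; apply: Rabs_pos.
- by apply: Rlt_le; apply: exp_pos.
apply: Rmult_le_compat => //; try exact: Rabs_pos.
apply: (Rle_trans _ _ _ (pow_diff_bound x y r k (conj x0 xr) (conj y0 yr) r1)).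
have rk : 0 <= r ^ k by apply: pow_le; lra.
apply: Rmult_le_compat => //; [ | exact: Rabs_pos | ].
  by apply: Rmult_le_pos => //; apply: pos_INR.
apply: Rmult_le_compat => //; first exact: pos_INR.
by apply: Rle_pow => //; apply/leP.
Qed.

(** Smallness at many points forces smallness everywhere. The main term
combines (K + X)^N / N! <= exp(3 (K + X)) exp(-N), where X = lam L r, with a
factor exp X that bounds the exponentials: N nodes gain a factor exp(-N). *)
Lemma expoly_small (T : eqType) (s : seq T) (x : T -> R) (lam r g delta y : R)
    (K L : nat) (c : nat -> nat -> R) :
  0 < lam -> degree_below K c -> uniq s -> 0 < g -> g <= r ->
  (forall i, i \in s -> 0 <= x i <= r) ->
  (forall i j, i \in s -> j \in s -> i <> j -> g <= Rabs (x i - x j)) ->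
  0 <= delta -> (forall i, i \in s -> Rabs (expoly lam K L c (x i)) <= delta) ->
  0 <= y <= r ->
  Rabs (expoly lam K L c y) <= INR (size s) * (delta * (r / g) ^ (size s).-1)
    + coef_norm K L r c * exp (4 * (lam * INR L * r) + 3 * INR K - INR (size s)).
Proof.
move=> lam0 hc us g0 gr hx hg d0 hd hy; set N := size s.
have r0 : 0 < r by lra.
have lL : 0 <= lam * INR L by apply: Rmult_le_pos; [lra | apply: pos_INR].
have Kr : 0 <= INR K / r by apply: Rdiv_le_0_compat => //; apply: pos_INR.
set q := INR K / r + lam * INR L.
have q0 : 0 <= q by apply: Rplus_le_le_0_compat.
have cn := coef_norm_ge0 K L r c (Rlt_le _ _ r0).
set D := q ^ N * coef_norm K L r c * exp (lam * INR L * r).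
have D0 : 0 <= D.
  apply: Rmult_le_pos; last by apply: Rlt_le; apply: exp_pos.
  by apply: Rmult_le_pos => //; apply: pow_le.
have hD z : 0 <= z <= r -> Rabs (expoly lam K L (iter N (coef_deriv lam) c) z) <= D.
  move=> hz; apply: (Rle_trans _ _ _ (expoly_bound _ _ _ _ _ _ (Rlt_le _ _ lam0) hz)).
  apply: Rmult_le_compat_r; first by apply: Rlt_le; apply: exp_pos.
  by apply: coef_norm_iter => //; lra.
have := interpolation_bound T s x (fun j => expoly lam K L (iter j (coef_deriv lam) c)) r g D delta y
   (expoly_derivatives lam K L c hc) us g0 gr D0 hx hg hD d0 hd hy.
rewrite -/N [iter 0 _ _]/= => h; apply: (Rle_trans _ _ _ h); apply: Rplus_le_compat_l.
have fN := INR_fact_lt_0 N.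
have -> : D * (r ^ N / INR (fact N)) = coef_norm K L r c * (exp (lam * INR L * r) *
    ((q * r) ^ N / INR (fact N))) by rewrite /D Rpow_mult_distr; field; lra.
apply: Rmult_le_compat_l => //.
have -> : q * r = INR K + lam * INR L * r by rewrite /q; field; lra.
set X := lam * INR L * r; have X0 : 0 <= X by apply: Rmult_le_pos; lra.
have K0 := pos_INR K.
have -> : 4 * X + 3 * INR K - INR N = X + (3 * (INR K + X) - INR N) by ring.
rewrite exp_plus; apply: Rmult_le_compat_l; first by apply: Rlt_le; apply: exp_pos.
have h1 := pow_div_fact_le (exp 1 * (INR K + X)) N.
have e1 := exp_le_3; have e0 := exp_pos 1.
have eN : exp 1 ^ N = exp (INR N).
  by rewrite -Rpower_pow // /Rpower ln_exp Rmult_1_r.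
have eNp := exp_pos (INR N).
have h2 : (INR K + X) ^ N / INR (fact N) = (exp 1 * (INR K + X)) ^ N / INR (fact N) * exp (- INR N).
  by rewrite Rpow_mult_distr eN exp_Ropp; field; lra.
rewrite h2 /Rminus exp_plus; apply: Rmult_le_compat_r; first by apply: Rlt_le; apply: exp_pos.
apply: (Rle_trans _ _ _ (h1 _)); first by apply: Rmult_le_pos; lra.
by apply: exp_le; apply: Rmult_le_compat_r; lra.
Qed.

Lemma exp_neg1_lt : exp (-1) < / 2.
Proof.
have -> : exp (-1) = / exp 1 by rewrite -exp_Ropp; congr exp; lra.
by apply: Rinv_lt_contravar; [have := exp_pos 1; lra | have := exp_ineq1 1; lra].
Qed.

Lemma pow_exp_le (x y : R) (k : nat) : 0 <= x -> x <= exp y -> x ^ k <= exp (y * INR k).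
Proof.
move=> x0 hx; apply: (Rle_trans _ (exp y ^ k)); first exact: pow_incr.
rewrite -Rpower_pow; last exact: exp_pos.
by rewrite /Rpower ln_exp Rmult_comm; lra.
Qed.

(** The exponent of the contribution of the rational approximation of theta.
All terms but the last are at most of order W^25. *)
Lemma exponent_perturbation (W U nu mu : R) :
  40 <= W -> 0 <= U <= 2 * W ^ 8 -> 0 <= nu <= W / 10 -> 0 <= mu <= nu ->
  W * (2 * W ^ 6) + 1 + (2 * W + (2 * W + nu * U) * (U * U))
   + (4 * W + W * (2 * W ^ 6) + (W + 3 * W * (2 * W ^ 6) + mu * W ^ 2 * W ^ 4)
      + nu * W ^ 2 * U) + (1 - W ^ 30) <= -1.
Proof.
move=> hW hU hnu hmu.
have P j k : (j <= k)%N -> W ^ j <= W ^ k by move=> /leP h; apply: Rle_pow => //; lra.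
have W1 : 1 <= W by lra.
have U2 : U * U <= 4 * W ^ 16.
  have -> : 4 * W ^ 16 = (2 * W ^ 8) * (2 * W ^ 8) by ring.
  by apply: Rmult_le_compat; lra.
have U3 : U * (U * U) <= 8 * W ^ 24.
  have -> : 8 * W ^ 24 = (2 * W ^ 8) * (4 * W ^ 16) by ring.
  by apply: Rmult_le_compat; try lra; nra.
have UU0 : 0 <= U * U by nra.
have nuU3 : nu * U * (U * U) <= 8 * W ^ 25.
  have -> : 8 * W ^ 25 = W * (8 * W ^ 24) by ring.
  rewrite Rmult_assoc; apply: Rmult_le_compat; try lra.
  by apply: Rmult_le_pos; lra.
have WU2 : W * (U * U) <= 4 * W ^ 17.
  have -> : 4 * W ^ 17 = W * (4 * W ^ 16) by ring.
  by apply: Rmult_le_compat_l; lra.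
have p2 : 0 <= W ^ 2 by apply: pow_le; lra.
have p6 : 0 <= W ^ 6 by apply: pow_le; lra.
have nLU : nu * W ^ 2 * U <= 2 * W ^ 11.
  have -> : 2 * W ^ 11 = W * W ^ 2 * (2 * W ^ 8) by ring.
  apply: Rmult_le_compat; try lra; first by apply: Rmult_le_pos; lra.
  by apply: Rmult_le_compat; lra.
have mL : mu * W ^ 2 * W ^ 4 <= W ^ 7.
  have -> : mu * W ^ 2 * W ^ 4 = mu * W ^ 6 by ring.
  have -> : W ^ 7 = W * W ^ 6 by ring.
  by apply: Rmult_le_compat_r; lra.
have e1 : W ^ 1 = W by ring.
have e7 : W * (2 * W ^ 6) = 2 * W ^ 7 by ring.
have q1 := P 1%N 25%N isT; have q7 := P 7%N 25%N isT.
have q11 := P 11%N 25%N isT; have q17 := P 17%N 25%N isT.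
have q26 := P 26%N 30%N isT.
have q25 : 40 * W ^ 25 <= W ^ 26.
  by have -> : W ^ 26 = W * W ^ 25 by []; apply: Rmult_le_compat_r; [apply: pow_le; lra | lra].
have q0 : W <= W ^ 25 by lra.
have -> : 3 * W * (2 * W ^ 6) = 6 * W ^ 7 by ring.
rewrite Rmult_plus_distr_r Rmult_assoc e7.
lra.
Qed.

(** The exponent of the interpolation error, where U U is the number of nodes
and U is at least W^4: the number of nodes beats both the powers of m, of
total exponent of order W K, and the growth of the exponentials, of exponent of
order W^2 U. *)
Lemma exponent_extrapolation (W U nu mu : R) :
  40 <= W -> W ^ 4 <= U -> 0 <= nu <= W / 10 -> 0 <= mu <= nu ->
  W * (2 * W ^ 6) + (2 * W + (W + 3 * W * (2 * W ^ 6) + mu * W ^ 2 * W ^ 4)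
     + W * (2 * W ^ 6)) + (4 * (nu * W ^ 2 * U) + 3 * (2 * W ^ 6) - U * U) <= -1.
Proof.
move=> hW hU hnu hmu.
have P j k : (j <= k)%N -> W ^ j <= W ^ k by move=> /leP h; apply: Rle_pow => //; lra.
have p k : 0 <= W ^ k by apply: pow_le; lra.
have U0 : 0 <= U by have := p 4%N; lra.
have mL : mu * W ^ 2 * W ^ 4 <= W ^ 7.
  have -> : mu * W ^ 2 * W ^ 4 = mu * W ^ 6 by ring.
  have -> : W ^ 7 = W * W ^ 6 by ring.
  by apply: Rmult_le_compat_r => //; lra.
have nLU : nu * W ^ 2 * U <= W ^ 3 * U / 10.
  have -> : W ^ 3 * U / 10 = W / 10 * W ^ 2 * U by field.
  by apply: Rmult_le_compat_r => //; apply: Rmult_le_compat_r => //; lra.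
have UU1 : W ^ 4 * U <= U * U by apply: Rmult_le_compat_r.
have UU2 : W ^ 8 <= U * U.
  have -> : W ^ 8 = W ^ 4 * W ^ 4 by ring.
  by apply: Rmult_le_compat.
have W8 : 40 * W ^ 7 <= W ^ 8 by have -> : W ^ 8 = W * W ^ 7 by []; apply: Rmult_le_compat_r.
have W4 : 40 * (W ^ 3 * U) <= W ^ 4 * U.
  have -> : W ^ 4 * U = W * (W ^ 3 * U) by ring.
  by apply: Rmult_le_compat_r; [apply: Rmult_le_pos | lra].
have W3U : 0 <= W ^ 3 * U by apply: Rmult_le_pos.
have e1 : W ^ 1 = W by ring.
have e7 : W * (2 * W ^ 6) = 2 * W ^ 7 by ring.
have q1 := P 1%N 7%N isT; have q6 := P 6%N 7%N isT.
have -> : 3 * W * (2 * W ^ 6) = 6 * W ^ 7 by ring.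
lra.
Qed.

Definition int_form (a b m n K L : nat) (c : nat -> nat -> R) (u v : nat) : R :=
  \rsum_(l < L) \rsum_(k < K) (c k l * INR (int_value a b m n K k l u v)).

Lemma coef_norm_bound (K L : nat) (c : nat -> nat -> R) (H r : R) :
  1 <= r -> (forall k l, Rabs (c k l) <= H) ->
  coef_norm K L r c <= INR L * (INR K * (H * r ^ K)).
Proof.
move=> r1 hc; apply: rsum_bound => l; apply: rsum_bound => k.
apply: Rmult_le_compat => //; first exact: Rabs_pos.
  by apply: pow_le; lra.
by apply: Rle_pow => //; apply/leP; apply: ltnW.
Qed.

(** The extrapolation step: integrality turns the vanishing on a box into the
vanishing on the next larger one, because a value of modulus less than one
must be zero. With m at most exp W, the parameters are K = 2 W^6 and L = W^2,
and the boxes have sides between W^4 and K L = 2 W^8; any powers of W would do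
for which K L is twice the square of the first side, and the first side exceeds
L and the square root of W K by a power of W. *)
Lemma int_form_step (a b m n w U : nat) (c : nat -> nat -> R) :
  let A := ln (INR a) in let B := ln (INR b) in let W := INR w in
  let nu := A + B + 1 in
  (2 <= a)%N -> (2 <= b)%N -> mult_independent a b ->
  40 <= W -> nu <= W / 10 ->
  2 * W ^ 8 <= exp W -> (1 + B / A + / A) * (2 * W ^ 8) <= exp W ->
  (0 < m)%N -> INR m <= exp W -> Rabs (INR n * A - INR m * B) <= exp (- W ^ 30) ->
  degree_below (2 * w ^ 6) c ->
  (forall k l, Rabs (c k l) <= exp (W + 3 * W * (2 * W ^ 6) + (A + B) * W ^ 2 * W ^ 4)) ->
  (w ^ 4 <= U)%N -> (U <= 2 * w ^ 8)%N ->
  (forall u v, (u < U)%N -> (v < U)%N -> int_form a b m n (2 * w ^ 6) (w ^ 2) c u v = 0) ->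
  forall u v, (u <= U)%N -> (v <= U)%N ->
    Rabs (int_form a b m n (2 * w ^ 6) (w ^ 2) c u v) < 1.
Proof.
move=> A B W nu ha hb hab hW hnu hE1 hE2 m0 hm hLam hdeg hc hU1 hU2 hz u v hu hv.
have la : / 2 < A := ln_nat_ge _ ha; have lb : / 2 < B := ln_nat_ge _ hb.
set K := (2 * w ^ 6)%N in hdeg hz *; set L := (w ^ 2)%N in hz *.
have KE : INR K = 2 * W ^ 6 by rewrite /K INR_mul INR_exp.
have LE : INR L = W ^ 2 by rewrite /L INR_exp.
have U1 : W ^ 4 <= INR U by rewrite /W -INR_exp; apply: le_INR; apply/leP.
have U2 : INR U <= 2 * W ^ 8.
  by rewrite -[2]/(INR 2) /W -INR_exp -INR_mul; apply: le_INR; apply/leP.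
have p k : 0 <= W ^ k by apply: pow_le; lra.
have P j k : (j <= k)%N -> W ^ j <= W ^ k by move=> /leP h; apply: Rle_pow => //; lra.
have U0 : 1 <= INR U by have := P 0%N 4%N isT; rewrite /=; lra.
have eW := exp_pos W.
have KW : INR K <= exp W by rewrite KE; have := P 6%N 8%N isT; lra.
have LW : INR L <= exp W by rewrite LE; have := P 2%N 8%N isT; have := p 8%N; lra.
have UW : INR U <= exp W by lra.
have mp : 1 <= INR m by apply: (le_INR 1); apply/leP.
set th := 1 + B / A + / A in hE2.
have iA : 0 < / A by apply: Rinv_0_lt_compat; lra.
have BA : 0 < B / A by apply: Rdiv_lt_0_compat; lra.
have th1 : 1 <= th by rewrite /th; lra.
(* The summand / A of th makes [0,r] contain the approximate nodes u + v n/m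
   as well as the exact ones. *)
pose r := th * INR U.
have r1 : 1 <= r by rewrite -[1]Rmult_1_l; apply: Rmult_le_compat; lra.
have rW : r <= exp W by apply: Rle_trans hE2; apply: Rmult_le_compat_l; lra.
have Ar : A * r = nu * INR U by rewrite /r /th /nu; field; lra.
pose eta := Rabs (B / A - INR n / INR m).
have eta0 : 0 <= eta by apply: Rabs_pos.
have etaE : eta <= Rabs (INR n * A - INR m * B) * / A.
  have -> : eta = Rabs (INR n * A - INR m * B) * / (INR m * A).
    rewrite /eta -(Rabs_pos_eq (/ (INR m * A))).
      rewrite -Rabs_mult -Rabs_Ropp; congr Rabs; field; lra.
    by apply: Rlt_le; apply: Rinv_0_lt_compat; nra.
  apply: Rmult_le_compat_l; first exact: Rabs_pos.
  by apply: Rinv_le_contravar; nra.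
have eta1 : eta <= exp (1 - W ^ 30).
  have h2 : 2 <= exp 1 by have := exp_ineq1_le 1; lra.
  have h3 : / A <= 2 by rewrite -(Rinv_inv 2); apply: Rinv_le_contravar; lra.
  have h4 := exp_pos (- W ^ 30).
  rewrite exp_plus; have := Rabs_pos (INR n * A - INR m * B).
  by move=> h5; apply: (Rle_trans _ _ _ etaE); rewrite Rmult_comm; apply: Rmult_le_compat; lra.
have etaA : eta <= / A.
  apply: (Rle_trans _ _ _ etaE); rewrite -[X in _ <= X]Rmult_1_l; apply: Rmult_le_compat_r; first lra.
  apply: (Rle_trans _ _ _ hLam); rewrite -exp_0; apply: exp_le; have := p 30%N; lra.
have node_le u' v' : (u' <= U)%N -> (v' <= U)%N -> 0 <= node a b (u', v') <= r.
  move=> /leP /le_INR hu' /leP /le_INR hv'; have := pos_INR u'; have := pos_INR v' => v0 u0.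
  rewrite /node /= -/A -/B /r /th; split; first by nra.
  have : INR v' * (B / A) <= INR U * (B / A) by apply: Rmult_le_compat_r; lra.
  nra.
have rat_le u' v' : (u' <= U)%N -> (v' <= U)%N -> INR u' + INR v' * (INR n / INR m) <= r.
  move=> /leP /le_INR hu' /leP /le_INR hv'; have := pos_INR u'; have := pos_INR v' => v0 u0.
  have h1 : INR n / INR m <= B / A + / A.
    have := Rle_abs (- (B / A - INR n / INR m)); rewrite Rabs_Ropp -/eta; lra.
  have h2 : 0 <= INR n / INR m by apply: Rdiv_le_0_compat; [exact: pos_INR | lra].
  have : INR v' * (INR n / INR m) <= INR U * (B / A + / A) by apply: Rmult_le_compat.
  rewrite /r /th; nra.
(* exp h bounds the coefficients, and delta0 the effect of replacing theta by
   n/m; h is kept abstract so that exp_plus does not split it. *)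
have [h hE] : exists h, h = W + 3 * W * (2 * W ^ 6) + (A + B) * W ^ 2 * W ^ 4 by eexists.
rewrite -hE in hc.
pose delta0 := INR L * (INR K * (exp h * (INR K * r ^ K * (INR U * eta)) * exp (A * INR L * r))).
have approx u' v' : (u' <= U)%N -> (v' <= U)%N ->
    Rabs (expoly A K L c (node a b (u', v')) - int_form a b m n K L c u' v' / INR m ^ K) <= delta0.
  move=> hu' hv'; have [_ nr] := node_le _ _ hu' hv'; have rr := rat_le _ _ hu' hv'.
  have v'U : INR v' <= INR U by apply: le_INR; apply/leP.
  apply: (Rle_trans _ _ _ (expoly_node_approx a b m n K L u' v' c (exp h) r ha hb m0 r1 nr rr hc)).
  have L0 := pos_INR L; have K0 := pos_INR K; have v0 := pos_INR v'.
  have rK0 : 0 <= r ^ K by apply: pow_le; lra.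
  apply: Rmult_le_compat_l => //; apply: Rmult_le_compat_l => //.
  apply: Rmult_le_compat_r; first by apply: Rlt_le; apply: exp_pos.
  apply: Rmult_le_compat_l; first by apply: Rlt_le; apply: exp_pos.
  apply: Rmult_le_compat_l; first exact: Rmult_le_pos.
  exact: Rmult_le_compat_r.
have rK : r ^ K <= exp (W * (2 * W ^ 6)) by rewrite -KE; apply: pow_exp_le; lra.
have rK0 : 0 <= r ^ K by apply: pow_le; lra.
have ph := exp_pos h.
have E4 : exp (4 * W) = exp W * (exp W * (exp W * exp W)) by rewrite -!exp_plus; congr exp; ring.
have delta0E : delta0 <= exp (4 * W + W * (2 * W ^ 6) + h + nu * W ^ 2 * INR U) * eta.
  have -> : delta0 = (INR L * (INR K * (INR K * INR U))) * r ^ K * exp h * exp (nu * W ^ 2 * INR U) * eta.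
    have -> : nu * W ^ 2 * INR U = A * INR L * r by rewrite LE; have := Ar; nra.
    by rewrite /delta0; ring.
  rewrite !exp_plus E4; apply: Rmult_le_compat_r => //.
  apply: Rmult_le_compat_r; first by apply: Rlt_le; apply: exp_pos.
  apply: Rmult_le_compat_r; first lra.
  have K0 := pos_INR K; have L0 := pos_INR L.
  apply: Rmult_le_compat => //; first by apply: Rmult_le_pos => //; nra.
  apply: Rmult_le_compat => //; first by nra.
  by apply: Rmult_le_compat => //; [nra | apply: Rmult_le_compat => //; lra].
have delta00 : 0 <= delta0.
  by apply: Rle_trans (approx 0%N 0%N (leq0n _) (leq0n _)); apply: Rabs_pos.
(* The form vanishes on the box, so F is at most delta0 at its nodes, whose
   mutual distances are at least g. *)
pose g := exp (- (INR U * (A + B))) / A.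
have g0 : 0 < g by apply: Rdiv_lt_0_compat; [apply: exp_pos | lra].
have gr : g <= r.
  have : g <= 1 * / A.
    apply: Rmult_le_compat_r; first lra.
    by rewrite -exp_0; apply: exp_le; nra.
  have : th <= r by rewrite /r -{1}[th]Rmult_1_r; apply: Rmult_le_compat_l; lra.
  rewrite /th; lra.
pose s := [seq (i, j) | i <- iota 0 U, j <- iota 0 U].
have ss : size s = (U * U)%N by rewrite size_allpairs size_iota.
have us : uniq s by apply: allpairs_uniq; rewrite ?iota_uniq // => -[? ?] [? ?].
have ins i : i \in s -> (i.1 < U)%N /\ (i.2 < U)%N.
  by case/allpairsP => -[x y] /= []; rewrite !mem_iota /= !add0n => ? ? ->.
have F_small y : 0 <= y <= r -> Rabs (expoly A K L c y) <=
    INR (size s) * (delta0 * (r / g) ^ (size s).-1)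
    + coef_norm K L r c * exp (4 * (A * INR L * r) + 3 * INR K - INR (size s)).
  move=> hy; apply: (expoly_small _ s (node a b)) => //.
  - lra.
  - by move=> [i j] /ins [/= hi hj]; apply: node_le; apply: ltnW.
  - move=> i j /ins [i1 i2] /ins [j1 j2]; apply: node_gap => //; exact: ltnW.
  - move=> [i j] /ins [/= hi hj].
    by have := approx i j (ltnW hi) (ltnW hj); rewrite hz // /Rdiv Rmult_0_l Rminus_0_r.
have ssE : INR (size s) = INR U * INR U by rewrite ss INR_mul.
have := F_small _ (node_le u v hu hv); rewrite ssE.
set q := (r / g) ^ _ => hF.
have qE : 1 <= q <= exp ((2 * W + nu * INR U) * (INR U * INR U)).
  have rg1 : 1 <= r / g by apply/Rle_div_r; lra.
  split; first exact: pow_R1_Rle.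
  apply: (Rle_trans _ ((r / g) ^ size s)); first by apply: Rle_pow => //; lia.
  rewrite -ssE; apply: pow_exp_le; first lra.
  have -> : r / g = r * (A * exp (INR U * (A + B))).
    rewrite /g exp_Ropp; have := exp_pos (INR U * (A + B)) => ?; field; split; lra.
  have -> : 2 * W + nu * INR U = W + (W + nu * INR U) by ring.
  rewrite !exp_plus; apply: Rmult_le_compat => //; try lra.
    by apply: Rmult_le_pos; [lra | apply: Rlt_le; apply: exp_pos].
  apply: Rmult_le_compat => //; try lra.
  - by apply: Rlt_le; apply: exp_pos.
  - by have := exp_ineq1_le W; rewrite /nu in hnu; lra.
  - by apply: exp_le; rewrite /nu; nra.
have cn : coef_norm K L r c <= exp (2 * W + h + W * (2 * W ^ 6)).
  apply: (Rle_trans _ _ _ (coef_norm_bound K L c _ r r1 hc)).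
  have -> : INR L * (INR K * (exp h * r ^ K)) = INR L * INR K * exp h * r ^ K by ring.
  have -> : exp (2 * W + h + W * (2 * W ^ 6)) = exp W * exp W * exp h * exp (W * (2 * W ^ 6)).
    by rewrite -!exp_plus; congr exp; ring.
  have K0 := pos_INR K; have L0 := pos_INR L.
  apply: Rmult_le_compat => //; first by apply: Rmult_le_pos; [nra | lra].
  by apply: Rmult_le_compat_r; [lra | apply: Rmult_le_compat].
have mK : 0 < INR m ^ K by apply: pow_lt; lra.
have mKW : INR m ^ K <= exp (W * (2 * W ^ 6)) by rewrite -KE; apply: pow_exp_le; lra.
(* The two summands are the effect of the rational approximation and the
   interpolation error; each turns out to be less than one half. *)
have I_le : Rabs (int_form a b m n K L c u v) <= INR m ^ K * (INR U * INR U * (delta0 * q) + delta0)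
   + INR m ^ K * (coef_norm K L r c * exp (4 * (A * INR L * r) + 3 * INR K - INR U * INR U)).
  have := approx u v hu hv; set F := expoly _ _ _ _ _ in hF *; set I := int_form _ _ _ _ _ _ _ _ _.
  move=> hap.
  have -> : I = INR m ^ K * (F - (F - I / INR m ^ K)) by field; lra.
  rewrite Rabs_mult (Rabs_pos_eq (INR m ^ K)); last lra.
  rewrite -Rmult_plus_distr_l; apply: Rmult_le_compat_l; first lra.
  have := Rabs_triang F (- (F - I / INR m ^ K)); rewrite Rabs_Ropp /Rminus; rewrite /Rminus in hap hF; lra.
have nu0 : 0 <= nu <= W / 10 by rewrite /nu in hnu *; lra.
have mu0 : 0 <= A + B <= nu by rewrite /nu; lra.
have U00 : 0 <= INR U <= 2 * W ^ 8 by lra.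
have part1 : INR m ^ K * (INR U * INR U * (delta0 * q) + delta0) < / 2.
  apply: Rle_lt_trans exp_neg1_lt.
  apply: Rle_trans (exp_le _ _ (exponent_perturbation W (INR U) nu (A + B) hW U00 nu0 mu0)).
  rewrite -hE -[X in exp X]Rplus_assoc.
  set Q := exp ((2 * W + nu * INR U) * (INR U * INR U)) in qE.
  have UUq : 1 <= INR U * INR U * q by nra.
  apply: (Rle_trans _ (exp (W * (2 * W ^ 6)) * (exp 1 * (exp (2 * W) * Q) * delta0))).
    have UU2 : INR U * INR U <= exp (2 * W).
      have -> : exp (2 * W) = exp W * exp W by rewrite -exp_plus; congr exp; ring.
      by apply: Rmult_le_compat; lra.
    apply: Rmult_le_compat => //; try lra; first by nra.
    have -> : INR U * INR U * (delta0 * q) + delta0 = (INR U * INR U * q + 1) * delta0 by ring.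
    apply: Rmult_le_compat_r => //.
    have h2 : 2 <= exp 1 by have := exp_ineq1_le 1; lra.
    have h3 : INR U * INR U * q <= exp (2 * W) * Q by apply: Rmult_le_compat; nra.
    nra.
  rewrite /Q; set t1 := 4 * W + _ + _ + _ in delta0E *.
  have d1 : delta0 <= exp t1 * exp (1 - W ^ 30).
    by apply: (Rle_trans _ _ _ delta0E); apply: Rmult_le_compat_l => //; apply: Rlt_le; apply: exp_pos.
  set X := exp (W * _); set Y := exp 1 * _.
  have X0 : 0 < X by apply: exp_pos.
  have Y0 : 0 < Y by repeat apply: Rmult_lt_0_compat; apply: exp_pos.
  apply: (Rle_trans _ (X * (Y * (exp t1 * exp (1 - W ^ 30))))).
    by apply: Rmult_le_compat_l; [lra | apply: Rmult_le_compat_l; lra].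
  right; rewrite /X /Y -!exp_plus; congr exp; ring.
have part2 : INR m ^ K * (coef_norm K L r c * exp (4 * (A * INR L * r) + 3 * INR K - INR U * INR U)) < / 2.
  apply: Rle_lt_trans exp_neg1_lt.
  apply: Rle_trans (exp_le _ _ (exponent_extrapolation W (INR U) nu (A + B) hW U1 nu0 mu0)).
  rewrite -hE.
  have c0 : 0 <= coef_norm K L r c by apply: coef_norm_ge0; lra.
  have -> : A * INR L * r = nu * W ^ 2 * INR U by rewrite LE; have := Ar; nra.
  rewrite KE; set z := 4 * _ + _ - _; have z0 := exp_pos z.
  rewrite [X in _ <= exp X]Rplus_assoc exp_plus exp_plus.
  apply: Rmult_le_compat => //; try lra.
    by apply: Rmult_le_pos => //; lra.
  by apply: Rmult_le_compat_r => //; lra.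
lra.
Qed.

Lemma sorted_iota (m n : nat) : StronglySorted Rlt (map INR (iota m n)).
Proof.
elim: n m => [|n IH] m /=; constructor; first exact: IH.
apply/List.Forall_forall => x /In_map_mem [i]; rewrite mem_iota => /andP [hi _] ->.
by apply: lt_INR; apply/ltP.
Qed.

(** Siegel's lemma produces functions on pairs of ordinals; they are extended
by zero to all pairs of natural numbers. *)
Definition coef_of (K L : nat) (f : 'I_K * 'I_L -> nat) (k l : nat) : nat :=
  if insub k is Some k' then if insub l is Some l' then f (k', l') else 0%N else 0%N.

Lemma coef_ofE (K L : nat) (f : 'I_K * 'I_L -> nat) (k : 'I_K) (l : 'I_L) :
  coef_of K L f k l = f (k, l).
Proof. by rewrite /coef_of !valK. Qed.

Lemma coef_of_le (K L : nat) (f : 'I_K * 'I_L -> nat) (H k l : nat) :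
  (forall x, (f x <= H)%N) -> (coef_of K L f k l <= H)%N.
Proof. by move=> h; rewrite /coef_of; case: insub => // k'; case: insub. Qed.

Lemma coef_of_high (K L : nat) (f : 'I_K * 'I_L -> nat) (k l : nat) :
  (K <= k)%N -> coef_of K L f k l = 0%N.
Proof. by move=> h; rewrite /coef_of insubF //; apply/negbTE; rewrite -leqNgt. Qed.

Lemma INR_sum (I : finType) (f : I -> nat) :
  INR (\sum_i f i)%N = \big[Rplus/0]_i INR (f i).
Proof. by apply: (big_morph INR) => [x y|]; [exact: plus_INR | exact: INR_0]. Qed.

Lemma int_form_coef_of (a b m n K L u v : nat) (f : 'I_K * 'I_L -> nat) :
  int_form a b m n K L (fun k l => INR (coef_of K L f k l)) u v
  = INR (\sum_x f x * int_value a b m n K x.1 x.2 u v)%N.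
Proof.
rewrite INR_sum /int_form exchange_big pair_big /=.
by apply: eq_bigr => -[k l] _; rewrite coef_ofE INR_mul.
Qed.

Lemma int_form_sub (a b m n K L u v : nat) (c c' : nat -> nat -> R) :
  int_form a b m n K L (fun k l => c k l - c' k l) u v
  = int_form a b m n K L c u v - int_form a b m n K L c' u v.
Proof.
rewrite /int_form rsum_sub; apply: eq_bigr => l _; rewrite rsum_sub.
by apply: eq_bigr => k _; ring.
Qed.

Lemma nat_threshold (C : R) : exists w0 : nat, forall w, (w0 <= w)%N -> C <= INR w.
Proof.
have [k hk] := INR_unbounded C; exists k => w /leP /le_INR; lra.
Qed.

(** Gelfond's method: the coefficients given by Siegel's lemma make the
integer form vanish on a box, hence on larger and larger boxes; the nodes with
second coordinate zero involve no approximation and become genuine zeros, too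
many for an exponential polynomial. *)
Lemma log_form_lower_independent (a b : nat) :
  (2 <= a)%N -> (2 <= b)%N -> mult_independent a b ->
  exists w0 : nat, forall w m n, (w0 <= w)%N -> (0 < m)%N ->
    INR m <= exp (INR w) -> INR n <= exp (INR w) ->
    exp (- INR w ^ 30) < Rabs (INR n * ln (INR a) - INR m * ln (INR b)).
Proof.
move=> ha hb hab; set A := ln (INR a); set B := ln (INR b).
have [x1 hx1] := exp_dominates 2 8.
have [x2 hx2] := exp_dominates ((1 + B / A + / A) * 2) 8.
have [n1 hn1] := nat_threshold x1; have [n2 hn2] := nat_threshold x2.
have [n3 hn3] := nat_threshold (10 * (A + B + 1)).
exists (maxn (maxn n1 n2) (maxn n3 40)) => w m n; rewrite !geq_max.
move=> /andP [/andP [/hn1 /hx1 w1 /hn2 /hx2 w2] /andP [/hn3 w3 w4]] m0 hm hn.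
have W40 : 40 <= INR w.
  have -> : 40 = INR 40 by rewrite INR_IZR_INZ.
  by apply: le_INR; apply/leP.
apply: Rnot_le_lt => hLam.
set W := INR w in W40 w1 w2 w3 hm hn hLam.
have la : / 2 < A := ln_nat_ge _ ha; have lb : / 2 < B := ln_nat_ge _ hb.
pose K := (2 * w ^ 6)%N; pose L := (w ^ 2)%N; pose U0 := (w ^ 4)%N.
have w0 : (0 < w)%N by apply: leq_trans w4.
have P j k : (j <= k)%N -> W ^ j <= W ^ k by move=> /leP h; apply: Rle_pow => //; lra.
have KL : (K * L = 2 * w ^ 8)%N by rewrite /K /L -mulnA -expnD.
pose Bd := ((U0 * (m + n)) ^ K * (a * b) ^ (L * U0))%N.
pose h := W + 3 * W * (2 * W ^ 6) + (A + B) * W ^ 2 * W ^ 4.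
have HB : INR (2 * w ^ 8 * Bd)%N <= exp h.
  have -> : INR (2 * w ^ 8 * Bd)%N = 2 * W ^ 8 *
      ((INR U0 * (INR m + INR n)) ^ K * (INR a * INR b) ^ (L * U0)).
    rewrite INR_mul (INR_mul 2) INR_exp /Bd INR_mul (INR_exp (_ * (m + n))).
    by rewrite (INR_exp (a * b)) (INR_mul U0) (INR_mul a) plus_INR.
  rewrite /h Rplus_assoc (exp_plus W) (exp_plus (3 * W * _)); apply: Rmult_le_compat.
  - by apply: Rmult_le_pos; [lra | apply: pow_le; lra].
  - apply: Rmult_le_pos; apply: pow_le; last by apply: Rmult_le_pos; exact: pos_INR.
    apply: Rmult_le_pos; [exact: pos_INR | have := pos_INR m; have := pos_INR n; lra].
  - exact: w1.
  have KE : INR K = 2 * W ^ 6 by rewrite /K INR_mul INR_exp.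
  apply: Rmult_le_compat.
  - apply: pow_le; apply: Rmult_le_pos; [exact: pos_INR | have := pos_INR m; have := pos_INR n; lra].
  - by apply: pow_le; apply: Rmult_le_pos; exact: pos_INR.
  - rewrite -KE; apply: pow_exp_le.
      apply: Rmult_le_pos; [exact: pos_INR | have := pos_INR m; have := pos_INR n; lra].
    have -> : 3 * W = W + (W + W) by ring.
    rewrite !exp_plus; apply: Rmult_le_compat; try exact: pos_INR.
    + have := pos_INR m; have := pos_INR n; lra.
    + rewrite /U0 INR_exp -/W; have := P 4%N 8%N isT; have := pow_le W 8; lra.
    have e2 : 2 <= exp W by have := exp_ineq1_le W; lra.
    have := pos_INR m; have := pos_INR n; nra.
  - have lnab : ln (INR (a * b)%N) = A + B.
      by rewrite INR_mul ln_mult //; apply: lt_0_INR; apply/ltP; apply: ltnW.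
    rewrite -(INR_mul a b) -(INR_exp (a * b)) -(exp_mul_ln (a * b) (L * U0)); last first.
      by rewrite muln_gt0 (ltnW ha) (ltnW hb).
    apply: exp_le; right; rewrite lnab (INR_mul L U0) (INR_exp w 2) (INR_exp w 4) -/W.
    ring.
have Bd0 : (0 < Bd)%N.
  have U00 : (0 < U0)%N by rewrite /U0 expn_gt0 w0.
  rewrite /Bd muln_gt0 (expn_gt0 (U0 * _)) (expn_gt0 (a * b)) (muln_gt0 U0) (muln_gt0 a) U00 addn_gt0 m0 /=.
  by rewrite !(ltnW ha, ltnW hb).
have cardE : #|{: 'I_U0 * 'I_U0}| = (w ^ 8)%N by rewrite card_prod !card_ord /U0 -expnD.
have cardX : #|{: 'I_K * 'I_L}| = (2 * w ^ 8)%N by rewrite card_prod !card_ord KL.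
have [||||f [g [hf hg [x0 hfg] hI]]] := @siegel ('I_U0 * 'I_U0)%type ('I_K * 'I_L)%type
  (fun uv x => int_value a b m n K x.1 x.2 uv.1 uv.2) Bd.
- by rewrite cardE expn_gt0 w0.
- by rewrite cardX cardE.
- exact: Bd0.
- move=> [u v] [k l] /=; apply: int_value_bound => //; try exact: ltnW.
  by rewrite /U0 expn_gt0 w0.
rewrite cardX in hf hg.
pose c k l := INR (coef_of K L f k l) - INR (coef_of K L g k l).
have IE u v : int_form a b m n K L c u v =
    INR (\sum_x f x * int_value a b m n K x.1 x.2 u v)%N
    - INR (\sum_x g x * int_value a b m n K x.1 x.2 u v)%N.
  by rewrite /c int_form_sub !int_form_coef_of.
have cdeg : degree_below K c.
  by move=> k l hk; rewrite /c !coef_of_high // Rminus_diag.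
have cH k l : Rabs (c k l) <= exp h.
  have hle f' : (forall x, (f' x <= 2 * w ^ 8 * Bd)%N) -> 0 <= INR (coef_of K L f' k l) <= exp h.
    move=> hf'; split; first exact: pos_INR.
    by apply: Rle_trans HB; apply: le_INR; apply/leP; apply: coef_of_le.
  by have := hle f hf; have := hle g hg; rewrite /c => ? ?; apply: Rabs_le; lra.
(* The box is enlarged by one at each step, from the side U0 of Siegel's
   lemma to the number K L of coefficients. *)
have vanish j : (U0 + j <= 2 * w ^ 8)%N -> forall u v, (u < U0 + j)%N -> (v < U0 + j)%N ->
    int_form a b m n K L c u v = 0.
  elim: j => [|j IH] hj u v hu hv.
    rewrite addn0 in hu hv.
    by have /= e := hI (Ordinal hu, Ordinal hv); rewrite IE e Rminus_diag.
  rewrite addnS in hj hu hv.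
  have h1 : Rabs (int_form a b m n K L c u v) < 1.
    apply: (int_form_step a b m n w (U0 + j) c) => //; try lra.
    + by rewrite -/A -/B -/W; lra.
    + by have e := w2; rewrite Rmult_assoc in e; exact: e.
    + by rewrite leq_addr.
    + exact: ltnW.
    + by apply: IH; apply: ltnW.
  rewrite IE in h1 *; apply: NNPP => hne.
  have := nat_dist _ _ (fun e => hne (Rminus_diag_eq _ _ (f_equal INR e))); lra.
(* At v = 0 the error bound of expoly_node_approx is zero. *)
have zeros u : (u < K * L)%N -> expoly A K L c (INR u) = 0.
  rewrite KL => hu; have hU0 : (U0 <= 2 * w ^ 8)%N.
    apply: (@leq_trans (w ^ 8)); first by rewrite leq_pexp2l.
    by rewrite leq_pmull.
  have Iz : int_form a b m n K L c u 0 = 0.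
    apply: (vanish (2 * w ^ 8 - U0)%N); rewrite ?subnKC //.
    exact: leq_ltn_trans hu.
  have := expoly_node_approx a b m n K L u 0 c (exp h) (Rmax 1 (INR u)) ha hb m0.
  have nE : node a b (u, 0%N) = INR u by rewrite /node /= INR_0; ring.
  rewrite -/(int_form a b m n K L c u 0) Iz nE INR_0 !(Rmult_0_l, Rmult_0_r) Rplus_0_r.
  rewrite /Rdiv Rmult_0_l Rminus_0_r => H.
  have := H (Rmax_l _ _) (Rmax_r _ _) (Rmax_r _ _) cH => H'.
  have := Rabs_pos (expoly A K L c (INR u)) => H''.
  by apply: NNPP => hne; have := Rabs_pos_lt _ hne; rewrite -/A in H'; lra.
have L1 : (0 < L)%N by rewrite /L expn_gt0 w0.
have cz k l : (l <= L.-1)%N -> c k l = 0.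
  move=> hl; apply: (expoly_zeros A K L.-1 K c (map INR (iota 0 (K * L)))) => //.
  - lra.
  - by move=> k' hk'; apply: cdeg.
  - exact: sorted_iota.
  - by rewrite size_map size_iota -mulnS prednK.
  - apply/List.Forall_forall => x /In_map_mem [u]; rewrite mem_iota => /andP [_ hu] ->.
    by rewrite prednK //; apply: zeros.
case: x0 hfg => k l; apply.
have := cz k l; rewrite -ltnS prednK // => /(_ (ltn_ord l)); rewrite /c !coef_ofE.
by move=> e; apply: INR_eq; apply: Rminus_diag_uniq.
Qed.

(** * Gaps between powers of two integers *)

Lemma exp_diff_lower (x y : R) :
  exp y * Rabs (x - y) <= (1 + Rabs (x - y)) * Rabs (exp x - exp y).
Proof.
have ey := exp_pos y; have ex := exp_pos x.
have [xy|yx] := Rle_lt_dec x y.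
  have := exp_le _ _ xy => h; rewrite !Rabs_left1; try lra.
  have h1 := exp_ineq1_le (y - x).
  have e1 : exp (y - x) * exp x = exp y by rewrite -exp_plus; congr exp; ring.
  nra.
have h : exp y <= exp x by apply: exp_le; lra.
rewrite !Rabs_pos_eq; try lra.
have h1 := exp_ineq1_le (x - y).
have e1 : exp (x - y) * exp y = exp x by rewrite -exp_plus; congr exp; ring.
nra.
Qed.

(** If a^p = b^q then q times the linear form is an integral multiple of log a. *)
Lemma log_form_dependent (a b : nat) : (2 <= a)%N -> (2 <= b)%N ->
  ~ mult_independent a b ->
  exists c, 0 < c /\ forall n m : nat, (a ^ n)%N <> (b ^ m)%N ->
    c <= Rabs (INR n * ln (INR a) - INR m * ln (INR b)).
Proof.
move=> ha hb hdep; have la := ln_nat_ge _ ha; have lb := ln_nat_ge _ hb.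
have [p [q [e hpq]]] : exists p q, (a ^ p)%N = (b ^ q)%N /\ ~ (p = 0%N /\ q = 0%N).
  apply: NNPP => hn; apply: hdep => p q e; apply: NNPP => h; apply: hn.
  by exists p, q.
have a0 := ltnW ha; have b0 := ltnW hb.
set A := ln (INR a) in la *; set B := ln (INR b) in lb *.
have E : INR p * A = INR q * B.
  by apply: exp_inv; rewrite !exp_mul_ln // e.
have q0 : (0 < q)%N.
  case: (posnP q) => // q0; case: hpq; split=> //; move: E; rewrite q0 INR_0 Rmult_0_l.
  by move=> /Rmult_integral [|]; [exact: (INR_eq p 0) | lra].
have qp : 1 <= INR q by apply: (le_INR 1); apply/leP.
exists (A / INR q); split; first by apply: Rdiv_lt_0_compat; lra.
move=> n m hne.
have hd : (n * q <> m * p)%N.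
  move=> e2; apply: hne; apply: INR_eq; rewrite -!exp_mul_ln // -/A -/B.
  congr exp; apply: (Rmult_eq_reg_r (INR q)); last lra.
  have := congr1 INR e2; rewrite !INR_mul => e3.
  by transitivity (INR n * INR q * A); [ring | rewrite e3 Rmult_assoc E; ring].
have h1 := nat_dist _ _ hd; rewrite !INR_mul in h1.
have -> : INR n * A - INR m * B = (INR n * INR q - INR m * INR p) * (A / INR q).
  have -> : INR m * B = INR m * (INR p * A) / INR q by rewrite E; field; lra.
  by field; lra.
have c0 : 0 < A / INR q by apply: Rdiv_lt_0_compat; lra.
by rewrite Rabs_mult (Rabs_pos_eq (A / INR q)); [nra | lra].
Qed.

(** The logarithm of m raised to the power 30 is eventually below eta m log b.
The finitely many m for which this fails are covered by Liouville's bound, in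
which n is under control because the linear form is less than one. *)
Lemma log_form_lower (a b : nat) (eta : R) : (2 <= a)%N -> (2 <= b)%N -> 0 < eta ->
  exists c, 0 < c /\ forall n m : nat, (a ^ n)%N <> (b ^ m)%N ->
    Rabs (INR n * ln (INR a) - INR m * ln (INR b)) < 1 ->
    c <= exp (eta * (INR m * ln (INR b))) * Rabs (INR n * ln (INR a) - INR m * ln (INR b)).
Proof.
move=> ha hb eta0; have la := ln_nat_ge _ ha; have lb := ln_nat_ge _ hb.
have exp_ge1 x : 0 <= x -> 1 <= exp x by move=> /exp_le; rewrite exp_0.
have [hab|hab] := classic (mult_independent a b); last first.
  have [c [c0 hc]] := log_form_dependent a b ha hb hab.
  exists c; split=> // n m hne _; have h := hc n m hne.
  have m0 := pos_INR m.
  have : 1 <= exp (eta * (INR m * ln (INR b))).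
    by apply: exp_ge1; apply: Rmult_le_pos; [lra | apply: Rmult_le_pos; lra].
  nra.
have [w0 hw0] := log_form_lower_independent a b ha hb hab.
set A := ln (INR a) in la hw0 *; set B := ln (INR b) in lb hw0 *.
(* n <= C1 m, since log a > 1/2 and n log a <= m log b + 1. *)
pose C1 := 2 * B + 2.
have [x1 hx1] := exp_dominates (exp 1 * C1 / (eta * B)) 30.
have [w1 hw1] := nat_threshold x1.
pose M := exp (INR (maxn w0 w1)).
exists (Rmin 1 (exp (- (2 * (M * B) + 1)))); split.
  by apply: Rmin_pos; [lra | exact: exp_pos].
move=> n m hne hlt.
have m0 := pos_INR m; have n0 := pos_INR n.
have yp : 0 <= INR m * B by apply: Rmult_le_pos; lra.
have eta1 : 1 <= exp (eta * (INR m * B)) by apply: exp_ge1; apply: Rmult_le_pos; lra.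
have xy : INR n * A <= INR m * B + 1 by have := Rle_abs (INR n * A - INR m * B); lra.
have := Rabs_pos (INR n * A - INR m * B) => t0.
have [mM|Mm] := Rle_lt_dec (INR m) M.
  have h := log_form_liouville a b n m ha hb hne; rewrite -/A -/B in h.
  apply: (Rle_trans _ _ _ (Rmin_r _ _)).
  have : exp (- (2 * (M * B) + 1)) <= exp (- (INR n * A + INR m * B)).
    by apply: exp_le; have : INR m * B <= M * B; [apply: Rmult_le_compat_r; lra | lra].
  nra.
apply: (Rle_trans _ _ _ (Rmin_l _ _)).
have M1 : 1 <= M by apply: exp_ge1; apply: pos_INR.
have m1 : 1 <= INR m by lra.
have nC : INR n <= C1 * INR m.
  have : INR n * / 2 <= INR n * A by apply: Rmult_le_compat_l; lra.
  rewrite /C1; nra.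
have C11 : 1 <= C1 by rewrite /C1; lra.
have C1m : 1 <= C1 * INR m by nra.
have ln0 : 0 <= ln (C1 * INR m) by rewrite -ln_1; apply: ln_le; lra.
have [w [wlo whi]] : exists w : nat, ln (C1 * INR m) <= INR w < ln (C1 * INR m) + 1.
  have [k [hk1 hk2]] := nfloor_ex _ ln0.
  have [e|hk] := Req_dec (INR k) (ln (C1 * INR m)); first by exists k; lra.
  by exists k.+1; rewrite S_INR; lra.
have eln : exp (ln (C1 * INR m)) = C1 * INR m by apply: exp_ln; lra.
have ew1 : C1 * INR m <= exp (INR w) by rewrite -eln; apply: exp_le.
have ew2 : exp (INR w) <= exp 1 * C1 * INR m.
  by rewrite Rmult_assoc -eln -exp_plus; apply: exp_le; lra.
have wmax : (maxn w0 w1 <= w)%N.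
  rewrite leqNgt; apply/negP => /ltnW /leP /le_INR h.
  have := exp_le _ _ h; rewrite -/M; nra.
move: wmax; rewrite geq_max => /andP [hw_0 hw_1].
have h := hw0 w m n hw_0.
have {}h : exp (- INR w ^ 30) < Rabs (INR n * A - INR m * B).
  apply: h; first by apply/ltP; apply: INR_lt; rewrite INR_0; lra.
    by nra.
  by lra.
have h30 := hx1 _ (hw1 _ hw_1).
have eB : 0 < eta * B by apply: Rmult_lt_0_compat; lra.
have e1p := exp_pos 1.
have w30 : INR w ^ 30 <= eta * (INR m * B).
  apply: (Rmult_le_reg_l (exp 1 * C1 / (eta * B))).
    by apply: Rdiv_lt_0_compat => //; nra.
  apply: (Rle_trans _ _ _ h30); apply: (Rle_trans _ _ _ ew2); right; field; lra.
have : exp (- (eta * (INR m * B))) <= exp (- INR w ^ 30) by apply: exp_le; lra.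
move=> h2; rewrite -(exp_0) -(Rplus_opp_r (eta * (INR m * B))) exp_plus.
by apply: Rmult_le_compat_l; lra.
Qed.

(** Powers of two integers stay apart, up to an arbitrarily small power of
their size: this is the lower bound for the linear form n log a - m log b
carried over to the powers. *)
Lemma power_gap (a b : nat) (eta : R) : (2 <= a)%N -> (2 <= b)%N -> 0 < eta ->
  exists C, 0 < C /\ forall n m : nat, INR a ^ n <> INR b ^ m ->
    INR b ^ m <= C * exp (eta * (INR m * ln (INR b))) * Rabs (INR a ^ n - INR b ^ m).
Proof.
move=> ha hb eta0; have lb := ln_nat_ge _ hb.
have [c [c0 hc]] := log_form_lower a b eta ha hb eta0.
exists (2 + 2 / c); split; first by have := Rinv_0_lt_compat _ c0; lra.
move=> n m; rewrite -!INR_exp => hne.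
have hne' : (a ^ n)%N <> (b ^ m)%N by move=> e; apply: hne; rewrite e.
have a0 := ltnW ha; have b0 := ltnW hb.
have := hc n m hne'; rewrite -!exp_mul_ln //; set x := INR n * _; set y := INR m * _.
have y0 : 0 <= y by apply: Rmult_le_pos; [exact: pos_INR | lra].
have e1 : 1 <= exp (eta * y) by rewrite -exp_0; apply: exp_le; nra.
have := exp_diff_lower x y; set t := Rabs (x - y); set d := Rabs (exp x - exp y).
have d0 : 0 <= d by apply: Rabs_pos.
have ey := exp_pos y; have ic : 0 < 2 / c by apply: Rdiv_lt_0_compat; lra.
move=> h1 h2; have [t1|t1] := Rlt_le_dec t 1.
  have {}h2 := h2 t1.
  have h3 : c * exp y <= 2 * (exp (eta * y) * d).
    have t0 : 0 <= t by apply: Rabs_pos.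
    apply: (Rle_trans _ (exp (eta * y) * t * exp y)); first by apply: Rmult_le_compat_r; lra.
    have : exp y * t <= 2 * d by nra.
    nra.
  have : exp y <= 2 / c * (exp (eta * y) * d).
    apply: (Rmult_le_reg_l c) => //; apply: (Rle_trans _ _ _ h3); right; field; lra.
  have := Rmult_le_pos _ _ (Rlt_le _ _ (exp_pos (eta * y))) d0; lra.
have h3 : exp y <= 2 * d by nra.
have h4 : d <= exp (eta * y) * d by nra.
have h5 : 0 <= 2 / c * (exp (eta * y) * d) by apply: Rmult_le_pos; nra.
lra.
Qed.

(** * Riemann-Stieltjes integrals against a smooth integrator *)

Lemma pointed_subdiv_cons (h x xi : R) (t : seq (R * R)) :
  pointed_subdiv (mkSF_seq h ((x, xi) :: t)) ->
  h <= xi <= x /\ pointed_subdiv (mkSF_seq x t).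
Proof.
move=> hp; split; first by apply: (hp 0%N); rewrite /SF_size /=; lia.
by move=> i hi; apply: (hp i.+1); rewrite /SF_size /= in hi *; lia.
Qed.

(** Second-order accuracy of the increments of g makes each Riemann-Stieltjes
sum differ from the Riemann sum of f g' by at most the mesh times the length. *)
Lemma RS_sum_Riemann_sum (f g dg : R -> R) (C delta h z : R) (t : seq (R * R)) :
  0 <= C ->
  (forall x xi y, x <= xi <= y ->
     Rabs ((g y - g x) * f xi - (y - x) * (f xi * dg xi)) <= C * (y - x) ^ 2) ->
  pointed_subdiv (mkSF_seq h t) -> seq_step (SF_lx (mkSF_seq h t)) <= delta ->
  Rabs (foldr Rplus 0 (pairmap (fun x y : R * R => (g y.1 - g x.1) * f y.2) (h, z) t)
    - foldr Rplus 0 (pairmap (fun x y : R * R => (y.1 - x.1) * (f y.2 * dg y.2)) (h, z) t))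
  <= C * delta * (last h (unzip1 t) - h).
Proof.
move=> C0 hC; elim: t h z => [|[x xi] t IH] h z hp hs /=.
  by rewrite !Rminus_diag Rabs_R0; lra.
have [h0 hp'] := pointed_subdiv_cons _ _ _ _ hp.
have [hs1 hs2] : Rabs (x - h) <= delta /\ seq_step (SF_lx (mkSF_seq x t)) <= delta.
  move: hs; rewrite /seq_step /= => hs; split.
    by apply: Rle_trans hs; apply: Rmax_l.
  by apply: Rle_trans hs; apply: Rmax_r.
have := IH x xi hp' hs2; have := hC h xi x h0.
rewrite Rabs_pos_eq in hs1; last lra.
have : C * (x - h) ^ 2 <= C * delta * (x - h).
  rewrite Rmult_assoc; apply: Rmult_le_compat_l => //; rewrite /= Rmult_1_r.
  by apply: Rmult_le_compat_r; lra.
set S1 := foldr _ _ _; set S2 := foldr _ _ _ => h1 h2 h3.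
set p := (g x - g h) * f xi in h2 *; set q := (x - h) * _ in h2 *.
have -> : p + S1 - (q + S2) = (p - q) + (S1 - S2) by ring.
have := Rabs_triang (p - q) (S1 - S2); lra.
Qed.

Lemma pointed_subdiv_last (h : R) (t : seq (R * R)) :
  pointed_subdiv (mkSF_seq h t) -> h <= last h (unzip1 t).
Proof.
elim: t h => [|[x xi] t IH] h /=; first by move=> _; lra.
by move=> /pointed_subdiv_cons [h0 /IH]; lra.
Qed.

(** All points of a subdivision of a one-point interval coincide. *)
Lemma RS_sum_degenerate (f g : R -> R) (h z : R) (t : seq (R * R)) :
  pointed_subdiv (mkSF_seq h t) -> last h (unzip1 t) <= h ->
  foldr Rplus 0 (pairmap (fun x y : R * R => (g y.1 - g x.1) * f y.2) (h, z) t) = 0.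
Proof.
elim: t h z => [|[x xi] t IH] h z //= /pointed_subdiv_cons [h0 hp] hl.
have := pointed_subdiv_last _ _ hp => h1.
have e : x = h by lra.
by rewrite IH //; [rewrite e; ring | lra].
Qed.

Lemma is_RSInt_smooth (f g dg : R -> R) (C a b l : R) : a <= b -> 0 <= C ->
  (forall x xi y, x <= xi <= y ->
     Rabs ((g y - g x) * f xi - (y - x) * (f xi * dg xi)) <= C * (y - x) ^ 2) ->
  is_RInt (fun r => f r * dg r) a b l -> is_RSInt f g a b l.
Proof.
case=> [ab|->] C0 hC hint; last first.
  rewrite -(is_RInt_unique _ _ _ _ hint) RInt_point.
  apply/filterlim_locally => eps; exists (mkposreal 1 Rlt_0_1) => -[h t] _ [hp [hh hl]].
  have -> : RS_sum f g (mkSF_seq h t) = 0; last exact: ball_center.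
  rewrite Rmin_left in hh; last lra; rewrite Rmax_left in hl; last lra.
  by apply: RS_sum_degenerate => //=; rewrite /= in hh hl; lra.
have hint' : filterlim (Riemann_sum (fun r => f r * dg r)) (Riemann_fine a b) (locally l).
  apply: (filterlim_ext _ _ _ hint) => ptd.
  by rewrite sign_eq_1; [apply: scal_one | lra].
have FF : Filter (Riemann_fine a b) by apply: filter_filter; apply: Riemann_fine_filter.
apply/filterlim_locally => eps; have ep := cond_pos eps.
have Cba : 0 <= C * (b - a) by apply: Rmult_le_pos; lra.
pose delta := eps / 2 / (C * (b - a) + 1).
have d0 : 0 < delta by apply: Rdiv_lt_0_compat; lra.
have Cd : C * delta * (b - a) < eps / 2.
  have -> : C * delta * (b - a) = eps / 2 * (C * (b - a) / (C * (b - a) + 1)) by rewrite /delta; field; lra.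
  rewrite -[X in _ < X]Rmult_1_r; apply: Rmult_lt_compat_l; first lra.
  by apply/Rlt_div_l; lra.
have e2 : 0 < eps / 2 by lra.
have h1 := proj1 (filterlim_locally _ _) hint' (mkposreal _ e2).
have h2 : Riemann_fine a b (fun ptd =>
    Rabs (RS_sum f g ptd - Riemann_sum (fun r => f r * dg r) ptd) < eps / 2).
  exists (mkposreal _ d0) => -[h t] /= hstep [hp [hh hl]].
  rewrite Rmin_left in hh; last lra; rewrite Rmax_right in hl; last lra.
  have := RS_sum_Riemann_sum f g dg C delta h 0 t C0 hC hp (Rlt_le _ _ hstep).
  by rewrite /= in hh hl; rewrite hl hh => h3; apply: Rle_lt_trans Cd.
have [d1 {}h1] := h1 FF; have [d2 {}h2] := h2.
have d12 : 0 < Rmin d1 d2 by apply: Rmin_pos; apply: cond_pos.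
exists (mkposreal _ d12) => ptd /= hd hp.
have k1 := h1 ptd (Rlt_le_trans _ _ _ hd (Rmin_l _ _)) hp.
have k2 := h2 ptd (Rlt_le_trans _ _ _ hd (Rmin_r _ _)) hp.
rewrite /ball /= /AbsRing_ball /= /abs /minus /plus /opp /= in k1 *.
set A := RS_sum _ _ _ in k2 *; set B := Riemann_sum _ _ in k1 k2.
have -> : A + - l = (A - B) + (B + - l) by ring.
have := Rabs_triang (A - B) (B + - l); lra.
Qed.

Lemma is_RSInt_unique (f g : R -> R) (a b l : R) :
  is_RSInt f g a b l -> RSInt f g a b = l.
Proof. by move=> h; apply: (iota_filterlim_locally _ _ h). Qed.

(** * Iterated integrals of cosines *)

Definition freq (b n : nat) : R := INR b ^ n * PI.
Definition amp (b : nat) (alpha : R) (n : nat) : R := Rpower (INR b) (- (INR n * alpha)).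

Definition trunc_deriv (b : nat) (alpha : R) (N : nat) (t : R) : R :=
  sum_n (fun n => - (amp b alpha n * freq b n * sin (freq b n * t))) N.

Lemma sin_lipschitz (x y : R) : Rabs (sin x - sin y) <= Rabs (x - y).
Proof.
have [c [_ ->]] := MVT_gen sin y x cos
  (fun z _ => proj2 (is_derive_Reals _ _ _) (derivable_pt_lim_sin z))
  (fun z _ => continuity_sin z).
rewrite Rabs_mult -[X in _ <= X]Rmult_1_l; apply: Rmult_le_compat_r; first exact: Rabs_pos.
by apply: Rabs_le; have := COS_bound c; lra.
Qed.

Lemma cos_lipschitz (x y : R) : Rabs (cos x - cos y) <= Rabs (x - y).
Proof.
have h z : is_derive cos z (- sin z).
  by apply/is_derive_Reals; exact: derivable_pt_lim_cos.
have [c [_ ->]] := MVT_gen cos y x _ (fun z _ => h z) (fun z _ => continuity_cos z).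
rewrite Rabs_mult Rabs_Ropp -[X in _ <= X]Rmult_1_l; apply: Rmult_le_compat_r; first exact: Rabs_pos.
by apply: Rabs_le; have := SIN_bound c; lra.
Qed.

(** What the comparison of Riemann-Stieltjes sums with Riemann sums uses of a
trigonometric polynomial, in a form that is stable under addition. *)
Definition tame (g dg : R -> R) : Prop :=
  [/\ forall x, is_derive g x (dg x), exists M, forall x, Rabs (g x) <= M
    & exists L, forall x y, Rabs (dg x - dg y) <= L * Rabs (x - y)].

Lemma tame_plus (f g df dg : R -> R) : tame f df -> tame g dg ->
  tame (fun x => f x + g x) (fun x => df x + dg x).
Proof.
case=> [f1 [M hM] [L hL]] [g1 [M' hM'] [L' hL']]; split.
- by move=> x; apply: (is_derive_plus f g).
- exists (M + M') => x; have := Rabs_triang (f x) (g x); have := hM x; have := hM' x; lra.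
- exists (L + L') => x y.
  have -> : df x + dg x - (df y + dg y) = (df x - df y) + (dg x - dg y) by ring.
  have := Rabs_triang (df x - df y) (dg x - dg y); have := hL x y; have := hL' x y; lra.
Qed.

Lemma tame_wave (a lam : R) :
  tame (fun x => a * cos (lam * x)) (fun x => - (a * lam * sin (lam * x))).
Proof.
split.
- by move=> x; auto_derive => //; ring.
- exists (Rabs a) => x; rewrite Rabs_mult -[X in _ <= X]Rmult_1_r.
  apply: Rmult_le_compat_l; first exact: Rabs_pos.
  by apply: Rabs_le; have := COS_bound (lam * x); lra.
exists (Rabs (a * lam) * Rabs lam) => x y.
have -> : - (a * lam * sin (lam * x)) - - (a * lam * sin (lam * y))
   = - (a * lam * (sin (lam * x) - sin (lam * y))) by ring.
rewrite Rabs_Ropp Rabs_mult [X in _ <= X]Rmult_assoc; apply: Rmult_le_compat_l; first exact: Rabs_pos.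
by rewrite -Rabs_mult Rmult_minus_distr_l; apply: sin_lipschitz.
Qed.

Lemma tame_trunc (b : nat) (alpha : R) (N : nat) :
  tame (weierstrass_trunc b alpha N) (trunc_deriv b alpha N).
Proof.
rewrite /weierstrass_trunc /trunc_deriv; elim: N => [|N IH].
  have [h1 [M h2] [L h3]] := tame_wave (amp b alpha 0) (freq b 0).
  split.
  - move=> x; rewrite sum_O; apply: (is_derive_ext _ _ _ _ _ (h1 x)) => t; by rewrite sum_O.
  - exists M => x; rewrite sum_O; exact: h2.
  - exists L => x y; rewrite !sum_O; exact: h3.
have [h1 [M h2] [L h3]] := tame_plus _ _ _ _ IH (tame_wave (amp b alpha N.+1) (freq b N.+1)).
split.
- move=> x; rewrite sum_Sn; apply: (is_derive_ext _ _ _ _ _ (h1 x)) => t; by rewrite sum_Sn.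
- exists M => x; rewrite sum_Sn; exact: h2.
- exists L => x y; rewrite !sum_Sn; exact: h3.
Qed.

Lemma tame_increment (g dg : R -> R) (L x xi y : R) :
  (forall x, is_derive g x (dg x)) ->
  (forall x y, Rabs (dg x - dg y) <= L * Rabs (x - y)) -> x <= xi <= y ->
  Rabs (g y - g x - (y - x) * dg xi) <= Rabs L * (y - x) ^ 2.
Proof.
move=> hd hL hxi.
have [c [hc ->]] := MVT_gen g x y dg (fun z _ => hd z)
  (fun z _ => proj2 (continuity_pt_filterlim g z) (ex_derive_continuous _ _ (ex_intro _ _ (hd z)))).
rewrite Rmin_left ?Rmax_right in hc; try lra.
have -> : dg c * (y - x) - (y - x) * dg xi = (dg c - dg xi) * (y - x) by ring.
rewrite Rabs_mult (Rabs_pos_eq (y - x)); last lra.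
have -> : Rabs L * (y - x) ^ 2 = Rabs L * (y - x) * (y - x) by ring.
apply: Rmult_le_compat_r; first lra.
apply: (Rle_trans _ _ _ (hL _ _)); apply: (Rle_trans _ (Rabs L * Rabs (c - xi))).
  by apply: Rmult_le_compat_r; [exact: Rabs_pos | exact: Rle_abs].
by apply: Rmult_le_compat_l; [exact: Rabs_pos | apply: Rabs_le; lra].
Qed.

Lemma is_RSInt_tame (f df g dg : R -> R) (s a b l : R) :
  tame f df -> tame g dg -> a <= b ->
  is_RInt (fun r => (f r - f s) * dg r) a b l ->
  is_RSInt (fun r => f r - f s) g a b l.
Proof.
case=> [_ [M hM] _] [g1 _ [L hL]] ab.
apply: (is_RSInt_smooth _ _ _ (2 * M * Rabs L)) => //.
  have := Rle_trans _ _ _ (Rabs_pos _) (hM 0) => M0.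
  by apply: Rmult_le_pos; [lra | exact: Rabs_pos].
move=> x xi y hxi.
have -> : (g y - g x) * (f xi - f s) - (y - x) * ((f xi - f s) * dg xi)
   = (f xi - f s) * (g y - g x - (y - x) * dg xi) by ring.
rewrite Rabs_mult Rmult_assoc; apply: Rmult_le_compat; try exact: Rabs_pos.
  have := Rabs_triang (f xi) (- f s); rewrite Rabs_Ropp; have := hM xi; have := hM s; rewrite /Rminus; lra.
exact: tame_increment.
Qed.

Definition cell_integrand (a lam a' mu s r : R) : R :=
  (a * cos (lam * r) - a * cos (lam * s)) * (- (a' * mu * sin (mu * r))).

Definition cell (a lam a' mu s t : R) : R := RInt (cell_integrand a lam a' mu s) s t.

Lemma is_RInt_cell (a lam a' mu s u t : R) :
  is_RInt (cell_integrand a lam a' mu s) u t (RInt (cell_integrand a lam a' mu s) u t).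
Proof.
apply: RInt_correct; apply: ex_RInt_continuous => z _.
by apply: ex_derive_continuous; rewrite /cell_integrand; auto_derive.
Qed.

Lemma cell_short (a lam a' mu s t : R) : 0 <= a -> 0 <= a' -> 0 <= lam -> 0 <= mu ->
  s <= t -> Rabs (cell a lam a' mu s t) <= a * a' * (lam * mu * (t - s) ^ 2).
Proof.
move=> a0 a'0 l0 m0 st.
have := abs_RInt_le_const _ s t (a * (lam * (t - s)) * (a' * mu)) st
  (ex_intro _ _ (is_RInt_cell a lam a' mu s s t)) => h.
apply: (Rle_trans _ _ _ (h _)); last by right; ring.
move=> r hr; rewrite /cell_integrand -Rmult_minus_distr_l !Rabs_mult Rabs_Ropp !Rabs_mult.
rewrite !(Rabs_pos_eq a) // !(Rabs_pos_eq a') // (Rabs_pos_eq mu) //.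
have h1 := cos_lipschitz (lam * r) (lam * s).
have e1 : Rabs (lam * r - lam * s) = lam * (r - s).
  by rewrite -Rmult_minus_distr_l Rabs_pos_eq //; apply: Rmult_le_pos; lra.
have h2 : Rabs (sin (mu * r)) <= 1 by apply: Rabs_le; have := SIN_bound (mu * r); lra.
have am : 0 <= a' * mu by apply: Rmult_le_pos.
have p1 := Rabs_pos (cos (lam * r) - cos (lam * s)); have p2 := Rabs_pos (sin (mu * r)).
apply: Rmult_le_compat; try (by apply: Rmult_le_pos).
  apply: Rmult_le_compat_l => //; rewrite e1 in h1; apply: (Rle_trans _ _ _ h1).
  by apply: Rmult_le_compat_l => //; lra.
by rewrite -[X in _ <= X]Rmult_1_r; apply: Rmult_le_compat_l.
Qed.

(** The product of a cosine and a sine is a sum of two sines, without constant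
term; the integral is therefore bounded independently of the length of the
interval, except for the small denominator mu - lam. *)
Lemma cell_long (a lam a' mu s t Q : R) : 0 <= a -> 0 <= a' -> 0 < lam -> 0 < mu -> 0 <= Q ->
  (lam <> mu -> mu <= Q * Rabs (lam - mu)) ->
  Rabs (cell a lam a' mu s t) <= a * a' * (3 + Q).
Proof.
move=> a0 a'0 l0 m0 Q0 hQ.
have aa : 0 <= a * a' by apply: Rmult_le_pos.
have C := COS_bound.
(* Each of the two cases below exhibits a bounded primitive G. *)
have bound G : (forall r, is_derive G r (cell_integrand a lam a' mu s r)) ->
    cell a lam a' mu s t = G t - G s.
  move=> hG; apply: is_RInt_unique; apply: (is_RInt_derive G) => x _; first exact: hG.
  by apply: ex_derive_continuous; rewrite /cell_integrand; auto_derive.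
have [e|ne] := Req_dec lam mu.
  rewrite (bound (fun r => a * a' * (cos (lam * r) * cos (lam * r) / 2 - cos (lam * s) * cos (lam * r)))).
    rewrite -Rmult_minus_distr_l Rabs_mult (Rabs_pos_eq (a * a')) //.
    apply: Rmult_le_compat_l => //.
    have := C (lam * t); have := C (lam * s).
    set x := cos _; set y := cos _ => hx hy; apply: Rabs_le; nra.
  by move=> r; rewrite /cell_integrand -e; auto_derive => //; field.
rewrite (bound (fun r => a * a' * (mu / 2 * (cos ((mu + lam) * r) / (mu + lam)
    + cos ((mu - lam) * r) / (mu - lam)) - cos (lam * s) * cos (mu * r)))); last first.
  move=> r; rewrite /cell_integrand; auto_derive => //.
  have -> : (mu + lam) * r = mu * r + lam * r by ring.
  have -> : (mu - lam) * r = mu * r - lam * r by ring.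
  rewrite sin_plus sin_minus; field; lra.
rewrite -Rmult_minus_distr_l Rabs_mult (Rabs_pos_eq (a * a')) //.
apply: Rmult_le_compat_l => //.
set c1 := cos ((mu + lam) * t); set c2 := cos ((mu - lam) * t).
set d1 := cos ((mu + lam) * s); set d2 := cos ((mu - lam) * s).
set x := cos (mu * t); set y := cos (mu * s); set z := cos (lam * s).
have -> : mu / 2 * (c1 / (mu + lam) + c2 / (mu - lam)) - z * x
    - (mu / 2 * (d1 / (mu + lam) + d2 / (mu - lam)) - z * y)
  = (c1 - d1) / 2 * (mu / (mu + lam)) + ((c2 - d2) / 2 * (mu / (mu - lam)) + z * (y - x)).
  by field; lra.
have k1 : 0 <= mu / (mu + lam) <= 1.
  split; first by apply: Rdiv_le_0_compat; lra.
  by apply/Rle_div_l; lra.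
have k2 : Rabs (mu / (mu - lam)) <= Q.
  rewrite /Rdiv Rabs_mult Rabs_inv (Rabs_pos_eq mu); last lra.
  have p : 0 < Rabs (mu - lam) by apply: Rabs_pos_lt; lra.
  by apply/Rle_div_l => //; rewrite Rabs_minus_sym; apply: hQ.
have e1 : Rabs ((c1 - d1) / 2) <= 1.
  by apply: Rabs_le; have := C ((mu + lam) * t); have := C ((mu + lam) * s); rewrite -/c1 -/d1; lra.
have e2 : Rabs ((c2 - d2) / 2) <= 1.
  by apply: Rabs_le; have := C ((mu - lam) * t); have := C ((mu - lam) * s); rewrite -/c2 -/d2; lra.
have e3 : Rabs (z * (y - x)) <= 2.
  rewrite Rabs_mult -[2]Rmult_1_l; apply: Rmult_le_compat; try exact: Rabs_pos.
    by apply: Rabs_le; have := C (lam * s); rewrite -/z; lra.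
  by apply: Rabs_le; have := C (mu * t); have := C (mu * s); rewrite -/x -/y; lra.
have e4 : Rabs ((c1 - d1) / 2 * (mu / (mu + lam))) <= 1.
  rewrite Rabs_mult -[X in _ <= X]Rmult_1_l; apply: Rmult_le_compat; try exact: Rabs_pos; first exact: e1.
  by rewrite Rabs_pos_eq; lra.
have e5 : Rabs ((c2 - d2) / 2 * (mu / (mu - lam))) <= Q.
  by rewrite Rabs_mult -[X in _ <= X]Rmult_1_l; apply: Rmult_le_compat => //; exact: Rabs_pos.
apply: (Rle_trans _ _ _ (Rabs_triang _ _)).
have := Rabs_triang ((c2 - d2) / 2 * (mu / (mu - lam))) (z * (y - x)); lra.
Qed.

Lemma is_RInt_sum_n (f : nat -> R -> R) (l : nat -> R) (a b : R) (N : nat) :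
  (forall n, is_RInt (f n) a b (l n)) ->
  is_RInt (fun r => sum_n (fun n => f n r) N) a b (sum_n l N).
Proof.
move=> h; elim: N => [|N IH].
  by rewrite sum_O; apply: (is_RInt_ext (f 0%N)) => // r _; rewrite sum_O.
rewrite sum_Sn; apply: (is_RInt_ext (fun r => plus (sum_n (fun n => f n r) N) (f N.+1 r))).
  by move=> r _; rewrite sum_Sn.
exact: is_RInt_plus.
Qed.

Lemma sum_n_minus (f g : nat -> R) (N : nat) :
  sum_n f N - sum_n g N = sum_n (fun n => f n - g n) N.
Proof.
by elim: N => [|N IH]; rewrite ?sum_O // !sum_Sn -IH /plus /=; ring.
Qed.

Lemma sum_n_scal (c : R) (f : nat -> R) (N : nat) :
  sum_n (fun n => c * f n) N = c * sum_n f N.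
Proof.
by elim: N => [|N IH]; rewrite ?sum_O // !sum_Sn IH /plus /=; ring.
Qed.

Lemma is_RInt_area (b b' : nat) (alpha alpha' : R) (N M : nat) (s t : R) :
  is_RInt (fun r => (weierstrass_trunc b alpha N r - weierstrass_trunc b alpha N s)
                    * trunc_deriv b' alpha' M r) s t
    (sum_n (fun n => sum_n (fun m =>
       cell (amp b alpha n) (freq b n) (amp b' alpha' m) (freq b' m) s t) M) N).
Proof.
apply: (is_RInt_ext (fun r => sum_n (fun n => sum_n (fun m =>
       cell_integrand (amp b alpha n) (freq b n) (amp b' alpha' m) (freq b' m) s r) M) N)).
  move=> r _; rewrite /weierstrass_trunc sum_n_minus /trunc_deriv Rmult_comm.
  rewrite -sum_n_scal; apply: sum_n_ext => n.
  by rewrite [RHS]Rmult_comm -sum_n_scal.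
apply: is_RInt_sum_n => n; apply: is_RInt_sum_n => m; exact: is_RInt_cell.
Qed.

(** * Geometric convergence of the truncations *)

Lemma exp_pow (x : R) (n : nat) : exp x ^ n = exp (INR n * x).
Proof. by rewrite -Rpower_pow; [rewrite /Rpower ln_exp | exact: exp_pos]. Qed.

Lemma sum_n_abs_le (f g : nat -> R) (N : nat) :
  (forall n, Rabs (f n) <= g n) -> Rabs (sum_n f N) <= sum_n g N.
Proof.
move=> h; elim: N => [|N IH]; rewrite ?sum_O // !sum_Sn.
by apply: (Rle_trans _ _ _ (Rabs_triang _ _)); apply: Rplus_le_compat.
Qed.

Lemma sum_n_geom_le (rho : R) (N : nat) : 0 < rho < 1 ->
  sum_n (fun n => rho ^ n) N <= / (1 - rho).
Proof.
move=> hr; have -> : sum_n (fun n => rho ^ n) N = (1 - rho ^ N.+1) * / (1 - rho).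
  elim: N => [|N IH]; first by rewrite sum_O /=; field; lra.
  by rewrite sum_Sn IH /plus /=; field; lra.
rewrite -[X in _ <= X]Rmult_1_l; apply: Rmult_le_compat_r.
  by apply: Rlt_le; apply: Rinv_0_lt_compat; lra.
by have := pow_lt rho N.+1 (proj1 hr); lra.
Qed.

(** Telescoping the geometrically small increments. *)
Lemma geometric_limit (u : nat -> R) (K rho : R) : 0 < rho < 1 ->
  (forall N, Rabs (u N.+1 - u N) <= K * rho ^ N) ->
  ex_finite_lim_seq u /\ forall N, Rabs (real (Lim_seq u) - u N) <= K / (1 - rho) * rho ^ N.
Proof.
move=> hr hu; have K0 : 0 <= K.
  by have := hu 0%N; rewrite /= Rmult_1_r; apply: Rle_trans; apply: Rabs_pos.
have K1 : 0 <= K / (1 - rho) by apply: Rdiv_le_0_compat; lra.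
have pw n : 0 < rho ^ n by apply: pow_lt; lra.
have tele N k : Rabs (u (N + k)%N - u N) <= K / (1 - rho) * rho ^ N * (1 - rho ^ k).
  elim: k => [|k IH]; first by rewrite addn0 Rminus_diag Rabs_R0 /=; lra.
  rewrite addnS; have -> : u (N + k).+1 - u N = (u (N + k).+1 - u (N + k)%N) + (u (N + k)%N - u N) by ring.
  apply: (Rle_trans _ _ _ (Rabs_triang _ _)).
  have := hu (N + k)%N; have -> : rho ^ (N + k) = rho ^ N * rho ^ k by rewrite -pow_add.
  have -> : K / (1 - rho) * rho ^ N * (1 - rho ^ k.+1)
     = K * (rho ^ N * rho ^ k) + K / (1 - rho) * rho ^ N * (1 - rho ^ k) by rewrite /=; field; lra.
  by move: IH; lra.
have tele' N k : Rabs (u (N + k)%N - u N) <= K / (1 - rho) * rho ^ N.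
  apply: (Rle_trans _ _ _ (tele N k)).
  rewrite -[X in _ <= X]Rmult_1_r; apply: Rmult_le_compat_l; last by have := pw k; lra.
  by apply: Rmult_le_pos => //; have := pw N; lra.
have ex : ex_finite_lim_seq u.
  apply/ex_lim_seq_cauchy_corr => eps; have ep := cond_pos eps.
  have [n0 hn0] : exists n0, forall n, (n0 <= n)%coq_nat -> Rabs (rho ^ n) < eps / 2 / (K / (1 - rho) + 1).
    apply: pow_lt_1_zero; first by rewrite Rabs_pos_eq; lra.
    by apply: Rdiv_lt_0_compat; lra.
  have h0 := hn0 n0 (Nat.le_refl _); rewrite Rabs_pos_eq in h0; last by have := pw n0; lra.
  have hK : K / (1 - rho) * rho ^ n0 < eps / 2.
    have : (K / (1 - rho) + 1) * rho ^ n0 < eps / 2.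
      by rewrite Rmult_comm; apply/Rlt_div_r; lra.
    by have := pw n0; lra.
  have near n : (n0 <= n)%coq_nat -> Rabs (u n - u n0) < eps / 2.
    move=> /leP hn; rewrite -(subnKC hn); apply: Rle_lt_trans hK; exact: tele'.
  exists n0 => n m /near hn /near hm.
  have -> : u n - u m = (u n - u n0) - (u m - u n0) by ring.
  have := Rabs_triang (u n - u n0) (- (u m - u n0)).
  by rewrite Rabs_Ropp /Rminus; rewrite /Rminus in hn hm; lra.
split=> // N; have [l hl] := ex; rewrite (is_lim_seq_unique _ _ hl) /=.
have h1 : is_lim_seq (fun k => Rabs (u (N + k)%N - u N)) (Rabs (l - u N)).
  apply: (is_lim_seq_abs _ (l - u N)); apply: is_lim_seq_minus'; last exact: is_lim_seq_const.
  have h := proj1 (is_lim_seq_incr_n u N l) hl.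
  by apply: is_lim_seq_ext h => k; rewrite addnC.
exact: (is_lim_seq_le _ _ (Rbar.Finite _) (Rbar.Finite _) (tele' N) h1 (is_lim_seq_const _)).
Qed.

Lemma exp_interpolate (X A1 A2 g : R) : 0 < g < 1 -> X <= exp A1 -> X <= exp A2 ->
  X <= exp ((1 - g) * A1 + g * A2).
Proof.
move=> hg h1 h2; have [X0|X0] := Rle_lt_dec X 0.
  by apply: (Rle_trans _ _ _ X0); apply: Rlt_le; apply: exp_pos.
rewrite -(exp_ln X X0); apply: exp_le.
have l1 : ln X <= A1 by rewrite -(ln_exp A1); apply: ln_le.
have l2 : ln X <= A2 by rewrite -(ln_exp A2); apply: ln_le.
nra.
Qed.

(** The geometric ratio left when a Hoelder exponent delta has been spent on a
term of the Weierstrass series. *)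
Definition ratio (b : nat) (alpha delta : R) : R := Rpower (INR b) (delta - alpha).

Lemma ampE (b : nat) (alpha : R) (n : nat) :
  amp b alpha n = exp (- (INR n * alpha) * ln (INR b)).
Proof. by []. Qed.

Lemma freqE (b n : nat) : (2 <= b)%N -> freq b n = exp (INR n * ln (INR b) + ln PI).
Proof.
move=> hb; have PI0 := PI_RGT_0.
by rewrite exp_plus exp_ln // exp_mul_ln ?INR_exp //; apply: ltnW.
Qed.

(** Interpolation between the bounds 2 and freq |t - s| for the increment of a
cosine. *)
Lemma wave_increment (b : nat) (alpha g eta rho : R) : (2 <= b)%N ->
  0 < g < 1 -> 0 < eta -> ratio b alpha (g + eta) <= rho ->
  exists K, 0 <= K /\ forall (s t : R) (n : nat), s <> t ->
    Rabs (weierstrass_term b alpha t n - weierstrass_term b alpha s n)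
      <= K * rho ^ n * Rpower (Rabs (t - s)) g.
Proof.
move=> hb hg eta0 hrho; have lb := ln_nat_ge _ hb; have PI0 := PI_RGT_0.
exists (exp ((1 - g) * ln 2 + g * ln PI)); split; first by apply: Rlt_le; apply: exp_pos.
move=> s t n st; have h0 : 0 < Rabs (t - s) by apply: Rabs_pos_lt; lra.
set B := ln (INR b) in lb *; have n0 := pos_INR n.
have a0 : 0 < amp b alpha n by apply: exp_pos.
have E : weierstrass_term b alpha t n - weierstrass_term b alpha s n
   = amp b alpha n * (cos (freq b n * t) - cos (freq b n * s)).
  by rewrite /weierstrass_term -/(amp b alpha n) /freq; ring.
have f0 : 0 < freq b n by rewrite freqE //; apply: exp_pos.
set X := Rabs _.
have X1 : X <= exp (- (INR n * alpha) * B + ln 2).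
  rewrite /X E Rabs_mult (Rabs_pos_eq (amp _ _ _)); last lra.
  rewrite exp_plus exp_ln; last lra.
  rewrite ampE; apply: Rmult_le_compat_l; first by apply: Rlt_le; apply: exp_pos.
  by apply: Rabs_le; have := COS_bound (freq b n * t); have := COS_bound (freq b n * s); lra.
have X2 : X <= exp (- (INR n * alpha) * B + ((INR n * B + ln PI) + ln (Rabs (t - s)))).
  rewrite /X E Rabs_mult (Rabs_pos_eq (amp _ _ _)); last lra.
  rewrite exp_plus (exp_plus (_ + _)) exp_ln // -freqE // ampE.
  apply: Rmult_le_compat_l; first by apply: Rlt_le; apply: exp_pos.
  apply: (Rle_trans _ _ _ (cos_lipschitz _ _)).
  by rewrite -Rmult_minus_distr_l Rabs_mult (Rabs_pos_eq (freq b n)); lra.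
apply: (Rle_trans _ _ _ (exp_interpolate X _ _ g hg X1 X2)).
apply: (Rle_trans _ (exp ((1 - g) * ln 2 + g * ln PI)
   * ratio b alpha (g + eta) ^ n * Rpower (Rabs (t - s)) g)).
  rewrite /ratio /Rpower exp_pow -!exp_plus -/B; apply: exp_le.
  have : 0 <= eta * (INR n * B) by apply: Rmult_le_pos; [lra | apply: Rmult_le_pos; lra].
  lra.
apply: Rmult_le_compat_r; first by apply: Rlt_le; apply: exp_pos.
apply: Rmult_le_compat_l; first by apply: Rlt_le; apply: exp_pos.
by apply: pow_incr; split=> //; apply: Rlt_le; apply: exp_pos.
Qed.

(** Interpolation between the two bounds for a cell; this is where the gap
between powers of the two bases enters, through the small denominators. *)
Lemma cell_geometric (b b' : nat) (alpha alpha' g eta rho : R) :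
  (2 <= b)%N -> (2 <= b')%N -> 0 < g < 1 -> 0 < eta ->
  ratio b alpha (g + eta) <= rho -> ratio b' alpha' (g + eta) <= rho ->
  exists K, 0 <= K /\ forall (s t : R) (n m : nat), s < t ->
    Rabs (cell (amp b alpha n) (freq b n) (amp b' alpha' m) (freq b' m) s t)
      <= K * (rho ^ n * rho ^ m) * Rpower (Rabs (t - s)) (2 * g).
Proof.
move=> hb hb' hg eta0 hrho hrho'.
have [C [C0 hC]] := power_gap b b' eta hb hb' eta0.
have lb := ln_nat_ge _ hb; have lb' := ln_nat_ge _ hb'; have PI0 := PI_RGT_0.
exists (exp ((1 - g) * ln (3 + C) + g * (2 * ln PI))); split; first by apply: Rlt_le; apply: exp_pos.
move=> s t n m st; have h0 : 0 < Rabs (t - s) by apply: Rabs_pos_lt; lra.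
have hts : Rabs (t - s) = t - s by rewrite Rabs_pos_eq; lra.
set B := ln (INR b) in lb *; set B' := ln (INR b') in lb' hC *.
have n0 := pos_INR n; have m0 := pos_INR m.
have a0 : 0 < amp b alpha n by apply: exp_pos.
have a0' : 0 < amp b' alpha' m by apply: exp_pos.
have f0 : 0 < freq b n by rewrite freqE //; apply: exp_pos.
have f0' : 0 < freq b' m by rewrite freqE //; apply: exp_pos.
have nB : 0 <= INR n * B by apply: Rmult_le_pos; lra.
have mB : 0 <= INR m * B' by apply: Rmult_le_pos; lra.
set X := Rabs _.
have X1 : X <= exp (- (INR n * alpha) * B + - (INR m * alpha') * B' + (ln (3 + C) + eta * (INR m * B'))).
  have Q0 : 0 <= C * exp (eta * (INR m * B')).
    by apply: Rmult_le_pos; [lra | apply: Rlt_le; apply: exp_pos].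
  have := cell_long (amp b alpha n) (freq b n) (amp b' alpha' m) (freq b' m) s t _
    (Rlt_le _ _ a0) (Rlt_le _ _ a0') f0 f0' Q0 => h.
  have {}h := h _; rewrite -/X in h; apply: (Rle_trans _ _ _ (h _)).
    move=> hne; rewrite /freq -Rmult_minus_distr_r Rabs_mult (Rabs_pos_eq PI); last lra.
    rewrite -Rmult_assoc; apply: Rmult_le_compat_r; first lra.
    by apply: hC => e; apply: hne; rewrite /freq e.
  rewrite exp_plus (exp_plus (_ * B)) (exp_plus (ln _)) exp_ln; last lra.
  rewrite !ampE -/B -/B'; apply: Rmult_le_compat_l.
    by apply: Rmult_le_pos; apply: Rlt_le; apply: exp_pos.
  have : 1 <= exp (eta * (INR m * B')) by rewrite -exp_0; apply: exp_le; apply: Rmult_le_pos; lra.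
  nra.
have X2 : X <= exp (- (INR n * alpha) * B + - (INR m * alpha') * B'
   + ((INR n * B + ln PI) + (INR m * B' + ln PI) + (ln (Rabs (t - s)) + ln (Rabs (t - s))))).
  have := cell_short (amp b alpha n) (freq b n) (amp b' alpha' m) (freq b' m) s t
    (Rlt_le _ _ a0) (Rlt_le _ _ a0') (Rlt_le _ _ f0) (Rlt_le _ _ f0') (Rlt_le _ _ st).
  rewrite -/X => h; apply: (Rle_trans _ _ _ h); right.
  rewrite exp_plus (exp_plus (_ * B)) (exp_plus (_ + _) (_ + _)) (exp_plus (_ + _) (_ + _)).
  rewrite (exp_plus (ln _) (ln _)).
  by rewrite exp_ln // -!freqE // !ampE -/B -/B' hts; ring.
apply: (Rle_trans _ _ _ (exp_interpolate X _ _ g hg X1 X2)).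
apply: (Rle_trans _ (exp ((1 - g) * ln (3 + C) + g * (2 * ln PI))
   * (ratio b alpha (g + eta) ^ n * ratio b' alpha' (g + eta) ^ m) * Rpower (Rabs (t - s)) (2 * g))).
  rewrite /ratio /Rpower !exp_pow -!exp_plus -/B -/B'; apply: exp_le.
  have p1 : 0 <= eta * (INR n * B) by apply: Rmult_le_pos; lra.
  have p2 : 0 <= eta * (INR m * B') by apply: Rmult_le_pos; lra.
  have p3 : 0 <= g * (eta * (INR m * B')) by apply: Rmult_le_pos; lra.
  lra.
apply: Rmult_le_compat_r; first by apply: Rlt_le; apply: exp_pos.
apply: Rmult_le_compat_l; first by apply: Rlt_le; apply: exp_pos.
have r0 : 0 <= ratio b alpha (g + eta) by apply: Rlt_le; apply: exp_pos.
have r0' : 0 <= ratio b' alpha' (g + eta) by apply: Rlt_le; apply: exp_pos.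
by apply: Rmult_le_compat; try exact: pow_le; apply: pow_incr.
Qed.

Lemma weierstrass_lim (b : nat) (alpha t : R) : (2 <= b)%N -> 0 < alpha ->
  is_lim_seq (fun N => weierstrass_trunc b alpha N t) (weierstrass b alpha t).
Proof.
move=> hb ha; have lb := ln_nat_ge _ hb.
have hex : ex_series (weierstrass_term b alpha t).
  apply: (ex_series_le (K := R_AbsRing) (V := R_CompleteNormedModule) _
    (fun n => exp (- alpha * ln (INR b)) ^ n)).
    move=> n; rewrite /norm /= /abs /= /weierstrass_term Rabs_mult exp_pow.
    rewrite -[X in _ <= X]Rmult_1_r; apply: Rmult_le_compat; try exact: Rabs_pos.
      by rewrite Rabs_pos_eq; [right; rewrite /Rpower; congr exp; ring | apply: Rlt_le; apply: exp_pos].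
    by apply: Rabs_le; have := COS_bound (INR b ^ n * PI * t); lra.
  apply: ex_series_geom; rewrite Rabs_pos_eq; last by apply: Rlt_le; apply: exp_pos.
  rewrite -exp_0; apply: exp_increasing.
  have : 0 < alpha * ln (INR b) by apply: Rmult_lt_0_compat; lra.
  lra.
exact: (Series_correct _ hex).
Qed.

Lemma increment_truncation_rate (b : nat) (alpha g eta rho : R) :
  (2 <= b)%N -> 0 < alpha -> 0 < g < 1 -> 0 < eta -> 0 < rho < 1 ->
  ratio b alpha (g + eta) <= rho ->
  exists K, 0 <= K /\ forall s t, s <> t ->
    (forall N, Rabs ((weierstrass b alpha t - weierstrass b alpha s)
        - (weierstrass_trunc b alpha N t - weierstrass_trunc b alpha N s))
      <= K * rho ^ N * Rpower (Rabs (t - s)) g) /\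
    Rabs (weierstrass b alpha t - weierstrass b alpha s) <= K * Rpower (Rabs (t - s)) g.
Proof.
move=> hb ha hg eta0 hr hrho.
have [K [K0 hK]] := wave_increment b alpha g eta rho hb hg eta0 hrho.
have K1 : 0 <= K / (1 - rho) by apply: Rdiv_le_0_compat; lra.
exists (K / (1 - rho) + K); split; first lra.
move=> s t st; set H := Rpower _ _; have H0 : 0 < H by apply: exp_pos.
pose u N := weierstrass_trunc b alpha N t - weierstrass_trunc b alpha N s.
have hu N : Rabs (u N.+1 - u N) <= K * H * rho ^ N.
  have -> : u N.+1 - u N = weierstrass_term b alpha t N.+1 - weierstrass_term b alpha s N.+1.
    by rewrite /u /weierstrass_trunc !sum_Sn /plus /=; ring.
  apply: (Rle_trans _ _ _ (hK s t N.+1 st)).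
  have -> : K * rho ^ N.+1 * Rpower (Rabs (t - s)) g = rho * (K * H * rho ^ N) by rewrite /= /H; ring.
  rewrite -[X in _ <= X]Rmult_1_l; apply: Rmult_le_compat_r; last lra.
  by repeat apply: Rmult_le_pos; try lra; apply: pow_le; lra.
have [_ hlim] := geometric_limit u (K * H) rho hr hu.
have E : real (Lim_seq u) = weierstrass b alpha t - weierstrass b alpha s.
  rewrite (is_lim_seq_unique u (weierstrass b alpha t - weierstrass b alpha s)) //.
  by apply: is_lim_seq_minus'; apply: weierstrass_lim.
rewrite E in hlim; have KH : 0 <= K * H by apply: Rmult_le_pos; lra.
split=> [N|].
  apply: (Rle_trans _ _ _ (hlim N)).
  have -> : K * H / (1 - rho) * rho ^ N = K / (1 - rho) * (rho ^ N * H) by rewrite /Rdiv; ring.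
  rewrite Rmult_assoc; apply: Rmult_le_compat_r; last lra.
  by apply: Rmult_le_pos; [apply: pow_le; lra | lra].
have := hlim 0%N; rewrite /= Rmult_1_r => h1.
have h2 : Rabs (u 0%N) <= K * H.
  by rewrite /u /weierstrass_trunc !sum_O; have := hK s t 0%N st; rewrite /= Rmult_1_r.
have -> : weierstrass b alpha t - weierstrass b alpha s
  = (weierstrass b alpha t - weierstrass b alpha s - u 0%N) + u 0%N by ring.
have e : K * H / (1 - rho) = K / (1 - rho) * H by rewrite /Rdiv; ring.
have := Rabs_triang (weierstrass b alpha t - weierstrass b alpha s - u 0%N) (u 0%N); lra.
Qed.

Lemma sum_n_add (f g : nat -> R) (N : nat) :
  sum_n (fun n => f n + g n) N = sum_n f N + sum_n g N.
Proof. by elim: N => [|N IH]; rewrite ?sum_O // !sum_Sn IH /plus /=; ring. Qed.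

Definition area_sum (b b' : nat) (alpha alpha' s t : R) (N : nat) : R :=
  sum_n (fun n => sum_n (fun m =>
    cell (amp b alpha n) (freq b n) (amp b' alpha' m) (freq b' m) s t) N) N.

Lemma area_truncation_rate (b b' : nat) (alpha alpha' g eta rho : R) :
  (2 <= b)%N -> (2 <= b')%N -> 0 < g < 1 -> 0 < eta -> 0 < rho < 1 ->
  ratio b alpha (g + eta) <= rho -> ratio b' alpha' (g + eta) <= rho ->
  exists K, 0 <= K /\ forall s t, s < t ->
    let A := area_sum b b' alpha alpha' s t in
    [/\ ex_finite_lim_seq A,
      forall N, Rabs (real (Lim_seq A) - A N) <= K * rho ^ N * Rpower (Rabs (t - s)) (2 * g)
    & Rabs (real (Lim_seq A)) <= K * Rpower (Rabs (t - s)) (2 * g)].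
Proof.
move=> hb hb' hg eta0 hr hrho hrho'.
have [K [K0 hK]] := cell_geometric b b' alpha alpha' g eta rho hb hb' hg eta0 hrho hrho'.
pose S := / (1 - rho); have S0 : 0 < S by apply: Rinv_0_lt_compat; lra.
have SE N : sum_n (fun n => rho ^ n) N <= S := sum_n_geom_le rho N hr.
have K1 : 0 <= 2 * K * S * S by repeat apply: Rmult_le_pos; lra.
exists (2 * K * S * S + K); split; first lra.
move=> s t st A; set H := Rpower _ _; have H0 : 0 < H by apply: exp_pos.
have KH : 0 <= K * H by apply: Rmult_le_pos; lra.
have pw n : 0 < rho ^ n by apply: pow_lt; lra.
pose c n m := cell (amp b alpha n) (freq b n) (amp b' alpha' m) (freq b' m) s t.
have hc n m : Rabs (c n m) <= K * H * rho ^ n * rho ^ m.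
  by apply: (Rle_trans _ _ _ (hK s t n m st)); right; rewrite /H; ring.
have hu N : Rabs (A N.+1 - A N) <= 2 * K * S * H * rho ^ N.
  have -> : A N.+1 - A N = sum_n (fun n => c n N.+1) N + sum_n (fun m => c N.+1 m) N.+1.
    rewrite /A /area_sum sum_Sn.
    have -> : sum_n (fun n => sum_n (fun m =>
        cell (amp b alpha n) (freq b n) (amp b' alpha' m) (freq b' m) s t) N.+1) N
      = sum_n (fun n => sum_n (c n) N) N + sum_n (fun n => c n N.+1) N.
      by rewrite -sum_n_add; apply: sum_n_ext => n; rewrite sum_Sn.
    by rewrite /plus /= /c; ring.
  have row (f : nat -> R) M : (forall n, Rabs (f n) <= K * H * rho ^ N * rho ^ n) ->
      Rabs (sum_n f M) <= K * H * S * rho ^ N.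
    move=> hf; apply: (Rle_trans _ _ _ (sum_n_abs_le _ _ M hf)); rewrite sum_n_scal.
    have -> : K * H * S * rho ^ N = K * H * rho ^ N * S by ring.
    by apply: Rmult_le_compat_l => //; apply: Rmult_le_pos; [lra | have := pw N; lra].
  (* The new cells form a column and a row of the square of size N + 1. *)
  have step : rho ^ N.+1 <= rho ^ N by rewrite /=; have := pw N; nra.
  have big n : K * H * rho ^ N.+1 * rho ^ n <= K * H * rho ^ N * rho ^ n.
    apply: Rmult_le_compat_r; first by have := pw n; lra.
    exact: Rmult_le_compat_l.
  have h1 := row (fun n => c n N.+1) N.
  have h2 := row (fun m => c N.+1 m) N.+1.
  have {}h1 := h1 _; have {}h2 := h2 _.
  have k1 n : Rabs (c n N.+1) <= K * H * rho ^ N * rho ^ n.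
    by apply: Rle_trans (big n); apply: (Rle_trans _ _ _ (hc n N.+1)); right; ring.
  have k2 m : Rabs (c N.+1 m) <= K * H * rho ^ N * rho ^ m.
    by apply: Rle_trans (big m); exact: hc.
  have := h1 k1; have := h2 k2.
  have := Rabs_triang (sum_n (fun n => c n N.+1) N) (sum_n (fun m => c N.+1 m) N.+1); lra.
have [hex hlim] := geometric_limit A (2 * K * S * H) rho hr hu.
have e : 2 * K * S * H / (1 - rho) = 2 * K * S * S * H by rewrite /Rdiv -/S; ring.
rewrite e in hlim; split=> // [N|].
  apply: (Rle_trans _ _ _ (hlim N)).
  have -> : 2 * K * S * S * H * rho ^ N = 2 * K * S * S * (rho ^ N * H) by ring.
  rewrite [X in _ <= X]Rmult_assoc; apply: Rmult_le_compat_r; last lra.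
  by apply: Rmult_le_pos; [have := pw N; lra | lra].
have := hlim 0%N; rewrite /= Rmult_1_r => h1.
have h2 : Rabs (A 0%N) <= K * H.
  by rewrite /A /area_sum !sum_O; have := hc 0%N 0%N; rewrite /= !Rmult_1_r.
have -> : real (Lim_seq A) = (real (Lim_seq A) - A 0%N) + A 0%N by ring.
have := Rabs_triang (real (Lim_seq A) - A 0%N) (A 0%N); lra.
Qed.

Lemma is_RSInt_trunc (b b' : nat) (alpha alpha' : R) (N : nat) (s t : R) : s <= t ->
  is_RSInt (fun r => weierstrass_trunc b alpha N r - weierstrass_trunc b alpha N s)
    (weierstrass_trunc b' alpha' N) s t (area_sum b b' alpha alpha' s t N).
Proof.
move=> st; apply: (is_RSInt_tame _ _ _ _ _ _ _ _ (tame_trunc b alpha N) (tame_trunc b' alpha' N) st).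
exact: is_RInt_area.
Qed.

Lemma areaN_sum (d : nat) (b : 'I_d -> nat) (alpha : 'I_d -> R) (N : nat) (s t : R) (i j : 'I_d) :
  s <= t -> areaN b alpha N s t i j = area_sum (b i) (b j) (alpha i) (alpha j) s t N.
Proof. by move=> st; apply: is_RSInt_unique; apply: is_RSInt_trunc. Qed.

Lemma areaN_RInt (d : nat) (b : 'I_d -> nat) (alpha : 'I_d -> R) (N : nat) (s t : R) (i j : 'I_d) :
  s <= t -> is_RInt (fun r => (weierstrass_trunc (b i) (alpha i) N r
                    - weierstrass_trunc (b i) (alpha i) N s)
                    * trunc_deriv (b j) (alpha j) N r) s t (areaN b alpha N s t i j).
Proof. by move=> st; rewrite areaN_sum //; apply: is_RInt_area. Qed.

Lemma areaN_point (d : nat) (b : 'I_d -> nat) (alpha : 'I_d -> R) (N : nat) (s : R) (i j : 'I_d) :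
  areaN b alpha N s s i j = 0.
Proof.
rewrite -(is_RInt_unique _ _ _ _ (areaN_RInt d b alpha N s s i j (Rle_refl s))); exact: RInt_point.
Qed.

(** The integral over [s,t] splits at u, and on [u,t] the integrand with base
point s exceeds the one with base point u by a constant times g'. *)
Lemma areaN_chen (d : nat) (b : 'I_d -> nat) (alpha : 'I_d -> R) (N : nat) (s u t : R) (i j : 'I_d) :
  s <= u -> u <= t ->
  areaN b alpha N s t i j - areaN b alpha N s u i j - areaN b alpha N u t i j
  = (weierstrass_trunc (b i) (alpha i) N u - weierstrass_trunc (b i) (alpha i) N s)
    * (weierstrass_trunc (b j) (alpha j) N t - weierstrass_trunc (b j) (alpha j) N u).
Proof.
move=> su ut; have st : s <= t by lra.
set f := weierstrass_trunc (b i) _ _; set g := weierstrass_trunc (b j) _ _.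
have [g1 _ [L hL]] := tame_trunc (b j) (alpha j) N.
have I1 := areaN_RInt d b alpha N s t i j st; have I2 := areaN_RInt d b alpha N s u i j su.
have I3 := areaN_RInt d b alpha N u t i j ut.
have I4 : is_RInt (trunc_deriv (b j) (alpha j) N) u t (g t - g u).
  apply: (is_RInt_derive g) => x _; first exact: g1.
  apply/filterlim_locally => eps; have ep := cond_pos eps.
  have L1 : 0 < Rabs L + 1 by have := Rabs_pos L; lra.
  exists (mkposreal _ (Rdiv_lt_0_compat _ _ ep L1)) => y /=.
  rewrite /ball /= /AbsRing_ball /= /abs /minus /plus /opp /= => hy.
  apply: (Rle_lt_trans _ _ _ (hL y x)).
  have : (Rabs L + 1) * Rabs (y + - x) < eps by rewrite Rmult_comm; apply/Rlt_div_r.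
  have := Rle_abs L; have := Rabs_pos (y + - x); rewrite /Rminus; nra.
have I5 := is_RInt_scal _ u t (f u - f s) _ I4.
have I6 := is_RInt_plus _ _ u t _ _ I3 I5.
have I7 : is_RInt (fun r => (f r - f s) * trunc_deriv (b j) (alpha j) N r) u t
    (areaN b alpha N u t i j + (f u - f s) * (g t - g u)).
  apply: is_RInt_ext I6 => r _; rewrite /plus /scal /= /mult /= -/f; ring.
have I8 := is_RInt_Chasles _ s u t _ _ I2 I7.
have := is_RInt_unique _ _ _ _ I8; rewrite (is_RInt_unique _ _ _ _ I1) /plus /= => ->.
ring.
Qed.

(** * Rough path norms *)

(** Expansion in the canonical basis: the norm is at most a weighted l^1 norm. *)
Lemma norm_bound (I : finType) (nrm : (I -> R) -> R) : is_norm nrm ->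
  exists C, 0 <= C /\ forall (x : I -> R) M, (forall i, Rabs (x i) <= M) -> nrm x <= C * M.
Proof.
case=> tri hom _.
have nrm0 : nrm (fun _ => 0) = 0.
  transitivity (nrm (fun i => 0 * (fun _ => 0) i)).
    by congr nrm; apply: functional_extensionality => i; ring.
  by rewrite (hom 0) Rabs_R0 Rmult_0_l.
have nrm_ge0 x : 0 <= nrm x.
  have := tri x (fun i => -1 * x i); rewrite hom.
  have -> : (fun i => x i + -1 * x i) = (fun _ => 0) by apply: functional_extensionality => i; ring.
  by rewrite nrm0 Rabs_left; lra.
pose e (i : I) : I -> R := fun j => if j == i then 1 else 0.
exists (\big[Rplus/0]_(i : I) nrm (e i)); split; first by apply: rsum_ge0.
move=> x M hM.
have sub (s : seq I) :
    nrm (fun j => \rsum_(i <- s) (x i * e i j)) <= \rsum_(i <- s) (Rabs (x i) * nrm (e i)).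
  elim: s => [|i s IH].
    rewrite big_nil; have -> : (fun j => \rsum_(i <- [::]) (x i * e i j)) = (fun _ => 0).
      by apply: functional_extensionality => j; rewrite big_nil.
    by rewrite nrm0; lra.
  rewrite big_cons; have -> : (fun j => \rsum_(i <- (i :: s)) (x i * e i j))
      = (fun j => x i * e i j + \rsum_(i <- s) (x i * e i j)).
    by apply: functional_extensionality => j; rewrite big_cons.
  apply: (Rle_trans _ _ _ (tri (fun j => x i * e i j) _)); rewrite hom.
  exact: Rplus_le_compat_l.
have xE : x = (fun j => \big[Rplus/0]_(i : I) (x i * e i j)).
  apply: functional_extensionality => j; rewrite (bigD1 j) //= big1.
    by rewrite /e eqxx; ring.
  by move=> i ij; rewrite /e eq_sym (negbTE ij); ring.
rewrite {1}xE; apply: (Rle_trans _ _ _ (sub _)).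
rewrite Rmult_comm -rsum_mull; apply: rsum_le => i.
by apply: Rmult_le_compat_r.
Qed.

Lemma two_param_sup_le (I : Type) (nrm : (I -> R) -> R) (C g K : R) (A : R -> R -> I -> R) :
  (forall (x : I -> R) M, (forall i, Rabs (x i) <= M) -> nrm x <= C * M) ->
  (forall s t, 0 <= s -> s < t -> t <= 1 ->
     forall i, Rabs (A s t i) <= K * Rpower (Rabs (t - s)) g) ->
  Rbar_le (two_param_sup nrm g A) (C * K).
Proof.
move=> hC hA; apply: (proj2 (Lub_Rbar_correct _)) => r [s [t [h0 hst h1 ->]]].
have H0 : 0 < Rpower (Rabs (t - s)) g by apply: exp_pos.
rewrite /=; apply/Rle_div_l => //.
by rewrite Rmult_assoc; apply: hC; apply: hA.
Qed.

Lemma rp_norm_le (d : nat) (nv : vec d -> R) (nm : mat d -> R) : is_norm nv -> is_norm nm ->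
  exists C, 0 <= C /\ forall g K (X : two_param d), 0 <= K ->
    (forall s t, 0 <= s -> s < t -> t <= 1 ->
      (forall i, Rabs (fst (X s t) i) <= K * Rpower (Rabs (t - s)) g) /\
      (forall ij, Rabs (snd (X s t) ij) <= K * Rpower (Rabs (t - s)) (2 * g))) ->
    Rbar_le (rp_norm nv nm g X) (C * K).
Proof.
move=> hv hm.
have [C1 [C10 hC1]] := norm_bound _ nv hv; have [C2 [C20 hC2]] := norm_bound _ nm hm.
exists (C1 + C2); split; first lra.
move=> g K X K0 hX; rewrite Rmult_plus_distr_r.
apply: (Rbar_plus_le_compat _ (C1 * K) _ (C2 * K)).
  by apply: two_param_sup_le hC1 _ => s t h0 h1 h2; have [] := hX s t h0 h1 h2.
by apply: two_param_sup_le hC2 _ => s t h0 h1 h2; have [] := hX s t h0 h1 h2.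
Qed.

Lemma bound_all (I : finType) (P : I -> R -> Prop) :
  (forall i K K', P i K -> K <= K' -> P i K') ->
  (forall i, exists K, 0 <= K /\ P i K) -> exists K, 0 <= K /\ forall i, P i K.
Proof.
move=> mono h; have [f hf] := fin_all_exists h.
exists (\big[Rplus/0]_(i : I) f i); split.
  by apply: rsum_ge0 => i; case: (hf i).
move=> i; apply: mono (proj2 (hf i)) _; apply: rsum_term_le => j; by case: (hf j).
Qed.

Lemma smooth01_trunc (b : nat) (alpha : R) (N : nat) :
  smooth01 (weierstrass_trunc b alpha N).
Proof.
pose D k t := sum_n (fun n => amp b alpha n * freq b n ^ k
   * cos (freq b n * t + INR k * (PI / 2))) N.
(* Each differentiation of a cosine is a shift of its argument by pi/2. *)
exists D; split.
  move=> x _; apply: sum_n_ext => n; rewrite INR_0 /weierstrass_term /amp /freq.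
  by rewrite /= Rmult_0_l Rplus_0_r Rmult_1_r.
move=> k x _.
have hD : is_derive (D k) x (D k.+1 x).
  have term n : is_derive (fun t => amp b alpha n * freq b n ^ k * cos (freq b n * t + INR k * (PI / 2))) x
      (amp b alpha n * freq b n ^ k.+1 * cos (freq b n * x + INR k.+1 * (PI / 2))).
    auto_derive => //; rewrite S_INR.
    have -> : freq b n * x + (INR k + 1) * (PI / 2) = PI / 2 + (freq b n * x + INR k * (PI / 2)) by field.
    by rewrite cos_plus cos_PI2 sin_PI2 /=; ring.
  rewrite /D; elim: N {D} => [|N IH].
    rewrite sum_O; apply: (is_derive_ext _ _ _ _ _ (term 0%N)) => t; by rewrite sum_O.
  rewrite sum_Sn; apply: (is_derive_ext _ _ _ _ _ (is_derive_plus _ _ _ _ _ IH (term N.+1))) => t.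
  by rewrite sum_Sn.
have := proj2 (derivable_pt_lim_D_in (D k) (D k.+1) x) (proj1 (is_derive_Reals _ _ _) hD).
rewrite /D_in /limit1_in /limit_in => h eps heps.
have [del [hdel h1]] := h eps heps; exists del; split=> // y [[hy hne] hdist].
by apply: h1; split=> //; split.
Qed.

Lemma big_Rmin_le (I : eqType) (s : seq I) (v : I -> R) (i : I) :
  i \in s -> \big[Rmin/1]_(j <- s) v j <= v i.
Proof.
elim: s => [|j s IH] //; rewrite in_cons big_cons => /orP [/eqP ->|/IH h]; first exact: Rmin_l.
by apply: Rle_trans h; apply: Rmin_r.
Qed.

Lemma big_Rmax_ge (I : eqType) (s : seq I) (v : I -> R) (i : I) :
  i \in s -> v i <= \big[Rmax/0]_(j <- s) v j.
Proof.
elim: s => [|j s IH] //; rewrite in_cons big_cons => /orP [/eqP ->|/IH h]; first exact: Rmax_l.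
by apply: (Rle_trans _ _ _ h); apply: Rmax_r.
Qed.

(** With g = alpha - eps, the claim for the index i is the inequality
kappa (alpha_i - eps') <= alpha_i - g - eta. Since kappa alpha_i equals
alpha_i - g alpha_i / beta, it holds for eta = g (alpha / beta - 1), which is
positive because beta < alpha: the gap between beta and alpha pays for the loss
eta in the small denominators. *)
Lemma rate_params (d : nat) (b : 'I_d -> nat) (alphas : 'I_d -> R) (eps beta eps' : R) :
  (1 <= d)%N -> (forall i, (2 <= b i)%N) -> (forall i, 0 < alphas i < 1) ->
  0 < eps < min1 alphas -> min1 alphas - eps < beta < min1 alphas -> 0 < eps' < min1 alphas ->
  let kappa := 1 - (min1 alphas - eps) / beta in
  let rho := Rpower (max0 (fun i => Rpower (INR (b i)) (- alphas i + eps'))) kappa in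
  [/\ 0 < kappa < 1, 0 < rho < 1 & exists eta, 0 < eta /\
      forall i, ratio (b i) (alphas i) (min1 alphas - eps + eta) <= rho].
Proof.
move=> hd hb ha he hbeta he' kappa rho.
have amin i : min1 alphas <= alphas i by apply: big_Rmin_le; apply: mem_index_enum.
set al := min1 alphas in he hbeta he' amin kappa rho *.
set g := al - eps in hbeta kappa rho *; have g0 : 0 < g by rewrite /g; lra.
have ib : 0 < / beta by apply: Rinv_0_lt_compat; lra.
have gb : 0 < g / beta < 1.
  split; first by apply: Rdiv_lt_0_compat; lra.
  by apply/Rlt_div_l; lra.
have k01 : 0 < kappa < 1 by rewrite /kappa; lra.
pose v i := Rpower (INR (b i)) (- alphas i + eps').
have v1 i : 0 < v i < 1.
  split; first exact: exp_pos.
  rewrite -exp_0; apply: exp_increasing; have := ln_nat_ge _ (hb i); have := amin i; nra.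
have M0 : 0 < max0 v.
  apply: (Rlt_le_trans _ (v (Ordinal hd))); first by case: (v1 (Ordinal hd)).
  by apply: big_Rmax_ge; apply: mem_index_enum.
have M1 : max0 v < 1.
  rewrite /max0; elim/big_rec: _ => [|i x _ hx]; first lra.
  by apply: Rmax_lub_lt => //; case: (v1 i).
have r01 : 0 < rho < 1.
  split; first exact: exp_pos.
  rewrite -exp_0; apply: exp_increasing; have : ln (max0 v) < 0 by rewrite -ln_1; apply: ln_increasing.
  rewrite -/v; nra.
split=> //; exists (g * (al / beta - 1)); split.
  apply: Rmult_lt_0_compat => //; have : 1 < al / beta by apply/Rlt_div_r; lra.
  lra.
move=> i; have vi : ln (v i) <= ln (max0 v).
  by apply: ln_le; [case: (v1 i) | apply: big_Rmax_ge; apply: mem_index_enum].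
rewrite /ratio /rho /Rpower -/(v _) -/v; apply: exp_le.
apply: (Rle_trans _ (kappa * ln (v i))); last first.
  by apply: Rmult_le_compat_l; [lra | exact: vi].
have lb := ln_nat_ge _ (hb i).
rewrite /v /Rpower ln_exp -Rmult_assoc; apply: Rmult_le_compat_r; first lra.
have := amin i => hai.
have e1 : g * (al / beta - 1) = al * (g / beta) - g by field; lra.
have p : al * (g / beta) <= alphas i * (g / beta) by apply: Rmult_le_compat_r; lra.
rewrite e1 /kappa; have : 0 < (1 - g / beta) * eps' by apply: Rmult_lt_0_compat; lra.
lra.
Qed.

(** * The Weierstrass rough path *)

Lemma weierstrass_rates (d : nat) (b : 'I_d -> nat) (alphas : 'I_d -> R) (g eta rho : R) :
  (forall i, (2 <= b i)%N) -> (forall i, 0 < alphas i < 1) ->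
  0 < g < 1 -> 0 < eta -> 0 < rho < 1 ->
  (forall i, ratio (b i) (alphas i) (g + eta) <= rho) ->
  exists K, 0 <= K /\
  (forall i s t, s <> t ->
    (forall N, Rabs ((weierstrass (b i) (alphas i) t - weierstrass (b i) (alphas i) s)
       - (weierstrass_trunc (b i) (alphas i) N t - weierstrass_trunc (b i) (alphas i) N s))
       <= K * rho ^ N * Rpower (Rabs (t - s)) g) /\
    Rabs (weierstrass (b i) (alphas i) t - weierstrass (b i) (alphas i) s)
       <= K * Rpower (Rabs (t - s)) g) /\
  (forall ij s t, s < t ->
    [/\ ex_finite_lim_seq (fun N => areaN b alphas N s t ij.1 ij.2),
     forall N, Rabs (area b alphas s t ij.1 ij.2 - areaN b alphas N s t ij.1 ij.2)
       <= K * rho ^ N * Rpower (Rabs (t - s)) (2 * g)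
   & Rabs (area b alphas s t ij.1 ij.2) <= K * Rpower (Rabs (t - s)) (2 * g)]).
Proof.
move=> hb ha hg eta0 hr hrho.
have mono K K' H r : 0 <= r -> 0 <= H -> K <= K' -> K * r * H <= K' * r * H.
  by move=> r0 H0 h; apply: Rmult_le_compat_r => //; apply: Rmult_le_compat_r.
have pw n : 0 <= rho ^ n by apply: pow_le; lra.
have Rp x y : 0 <= Rpower x y by apply: Rlt_le; apply: exp_pos.
have [K1 [K10 h1]] : exists K, 0 <= K /\ forall i : 'I_d, forall s t, s <> t ->
    (forall N, Rabs ((weierstrass (b i) (alphas i) t - weierstrass (b i) (alphas i) s)
       - (weierstrass_trunc (b i) (alphas i) N t - weierstrass_trunc (b i) (alphas i) N s))
       <= K * rho ^ N * Rpower (Rabs (t - s)) g) /\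
    Rabs (weierstrass (b i) (alphas i) t - weierstrass (b i) (alphas i) s)
       <= K * Rpower (Rabs (t - s)) g.
  apply: bound_all => [i K K' h KK' s t st | i].
    have [h1 h2] := h s t st; split=> [N|]; first by apply: (Rle_trans _ _ _ (h1 N)); apply: mono.
    by apply: (Rle_trans _ _ _ h2); apply: Rmult_le_compat_r.
  by apply: (increment_truncation_rate _ _ _ eta) => //; case: (ha i).
have [K2 [K20 h2]] : exists K, 0 <= K /\ forall ij : 'I_d * 'I_d, forall s t, s < t ->
    let A := area_sum (b ij.1) (b ij.2) (alphas ij.1) (alphas ij.2) s t in
    [/\ ex_finite_lim_seq A,
      forall N, Rabs (real (Lim_seq A) - A N) <= K * rho ^ N * Rpower (Rabs (t - s)) (2 * g)
    & Rabs (real (Lim_seq A)) <= K * Rpower (Rabs (t - s)) (2 * g)].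
  apply: bound_all => [ij K K' h KK' s t st | ij].
    have [h1' h2 h3] := h s t st; split=> // [N|]; first by apply: (Rle_trans _ _ _ (h2 N)); apply: mono.
    by apply: (Rle_trans _ _ _ h3); apply: Rmult_le_compat_r.
  exact: (area_truncation_rate _ _ _ _ _ eta).
exists (K1 + K2); split; first lra; split=> [i s t st | ij s t st].
  have [k1 k2] := h1 i s t st; split=> [N|].
    by apply: (Rle_trans _ _ _ (k1 N)); apply: mono => //; lra.
  by apply: (Rle_trans _ _ _ k2); apply: Rmult_le_compat_r; [exact: Rp | lra].
have [k1 k2 k3] := h2 ij s t st.
have st' : s <= t by lra.
have E N : areaN b alphas N s t ij.1 ij.2 = area_sum (b ij.1) (b ij.2) (alphas ij.1) (alphas ij.2) s t N.
  exact: areaN_sum.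
have EL : Lim_seq (fun N => areaN b alphas N s t ij.1 ij.2)
   = Lim_seq (area_sum (b ij.1) (b ij.2) (alphas ij.1) (alphas ij.2) s t) by apply: Lim_seq_ext.
split.
- by have [l hl] := k1; exists l; apply: is_lim_seq_ext hl => N; rewrite E.
- move=> N; rewrite /area EL E; apply: (Rle_trans _ _ _ (k2 N)); apply: mono => //; lra.
- by rewrite /area EL; apply: (Rle_trans _ _ _ k3); apply: Rmult_le_compat_r; [exact: Rp | lra].
Qed.

Lemma area_lim (d : nat) (b : 'I_d -> nat) (alphas : 'I_d -> R) (s t : R) (i j : 'I_d) :
  (forall i, (2 <= b i)%N) -> (forall i, 0 < alphas i < 1) -> s <= t ->
  is_lim_seq (fun N => areaN b alphas N s t i j) (area b alphas s t i j).
Proof.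
move=> hb ha [st|->]; last first.
  rewrite /area; have e : Lim_seq (fun N => areaN b alphas N t t i j) = 0.
    rewrite -(Lim_seq_const 0); apply: Lim_seq_ext => N; exact: areaN_point.
  rewrite e; apply: is_lim_seq_ext (is_lim_seq_const 0) => N; by rewrite areaN_point.
have am : 0 < min1 alphas.
  by rewrite /min1; elim/big_rec: _ => [|k x _ hx]; [lra | apply: Rmin_pos => //; case: (ha k)].
have am1 : min1 alphas <= alphas i by apply: big_Rmin_le; apply: mem_index_enum.
have ai := ha i; have hd : (1 <= d)%N by apply: leq_ltn_trans (ltn_ord i).
(* Any admissible exponents serve for the mere existence of the limit. *)
have [| | | _ r01 [eta [eta0 hr]]] := rate_params d b alphas (min1 alphas / 2)
  (3 / 4 * min1 alphas) (min1 alphas / 2) hd hb ha; try lra.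
have g01 : 0 < min1 alphas - min1 alphas / 2 < 1 by lra.
have [K [_ [_ hK]]] := weierstrass_rates d b alphas _ eta _ hb ha g01 eta0 r01 hr.
have [hex _ _] := hK (i, j) s t st.
exact: (Lim_seq_correct' _ hex).
Qed.

Lemma area_chen (d : nat) (b : 'I_d -> nat) (alphas : 'I_d -> R) (s u t : R) (i j : 'I_d) :
  (forall i, (2 <= b i)%N) -> (forall i, 0 < alphas i < 1) -> s <= u -> u <= t ->
  area b alphas s t i j - area b alphas s u i j - area b alphas u t i j
  = (weierstrass (b i) (alphas i) u - weierstrass (b i) (alphas i) s)
    * (weierstrass (b j) (alphas j) t - weierstrass (b j) (alphas j) u).
Proof.
move=> hb ha su ut; have st : s <= t by lra.
have L k x := weierstrass_lim (b k) (alphas k) x (hb k) (proj1 (ha k)).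
have l1 := is_lim_seq_minus' _ _ _ _ (is_lim_seq_minus' _ _ _ _
  (area_lim d b alphas s t i j hb ha st) (area_lim d b alphas s u i j hb ha su))
  (area_lim d b alphas u t i j hb ha ut).
have l2 := is_lim_seq_mult' _ _ _ _ (is_lim_seq_minus' _ _ _ _ (L i u) (L i s))
  (is_lim_seq_minus' _ _ _ _ (L j t) (L j u)).
have {}l2 := is_lim_seq_ext _ _ _ (fun N => esym (areaN_chen d b alphas N s u t i j su ut)) l2.
have := is_lim_seq_unique _ _ l1; rewrite (is_lim_seq_unique _ _ l2) => e.
by case: e.
Qed.

(** The approximant is any Y that agrees with the truncation for s < t, which
covers both the truncations themselves and their description as smooth lifts. *)
Lemma W_truncation_rate (d : nat) (nv : vec d -> R) (nm : mat d -> R)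
    (b : 'I_d -> nat) (alphas : 'I_d -> R) (g eta rho : R) :
  is_norm nv -> is_norm nm ->
  (forall i, (2 <= b i)%N) -> (forall i, 0 < alphas i < 1) ->
  0 < g < 1 -> 0 < eta -> 0 < rho < 1 ->
  (forall i, ratio (b i) (alphas i) (g + eta) <= rho) ->
  exists C, forall (N : nat) (Y : two_param d),
    (forall s t, 0 <= s -> s < t -> t <= 1 -> Y s t = WN b alphas N s t) ->
    Rbar_le (rp_norm nv nm g (rp_sub (W b alphas) Y)) (C * rho ^ N).
Proof.
move=> hv hm hb ha hg eta0 hr hrho.
have [C [C0 hC]] := rp_norm_le d nv nm hv hm.
have [K [K0 [h1 h2]]] := weierstrass_rates d b alphas g eta rho hb ha hg eta0 hr hrho.
exists (C * K) => N Y hY; rewrite Rmult_assoc; apply: hC.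
  by apply: Rmult_le_pos => //; apply: pow_le; lra.
move=> s t h0 st ht1; rewrite /rp_sub hY //=; split=> [i|ij].
  by have [k _] := h1 i s t (Rlt_not_eq _ _ st); apply: k.
by have [_ k _] := h2 ij s t st; apply: k.
Qed.

Lemma smooth_lift_trunc (d : nat) (b : 'I_d -> nat) (alphas : 'I_d -> R) (N : nat) (s t : R) :
  s <= t ->
  smooth_lift (fun r (i : 'I_d) => weierstrass_trunc (b i) (alphas i) N r) s t = WN b alphas N s t.
Proof.
move=> st; rewrite /smooth_lift /WN; congr pair.
apply: functional_extensionality => -[i j] /=.
rewrite -(is_RInt_unique _ _ _ _ (areaN_RInt d b alphas N s t i j st)).
apply: RInt_ext => r _; congr Rmult.
by apply: is_derive_unique; case: (tame_trunc (b j) (alphas j) N) => h _ _; apply: h.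
Qed.

(** The truncations are lifts of smooth paths and converge in the rough path
norm. *)
Lemma W_geometric (d : nat) (nv : vec d -> R) (nm : mat d -> R)
    (b : 'I_d -> nat) (alphas : 'I_d -> R) (g eta rho : R) :
  is_norm nv -> is_norm nm ->
  (forall i, (2 <= b i)%N) -> (forall i, 0 < alphas i < 1) ->
  0 < g < 1 -> 0 < eta -> 0 < rho < 1 ->
  (forall i, ratio (b i) (alphas i) (g + eta) <= rho) ->
  geometric_rough_path nv nm g (W b alphas).
Proof.
move=> hv hm hb ha hg eta0 hr hrho; split; last first.
  have [C hC] := W_truncation_rate d nv nm b alphas g eta rho hv hm hb ha hg eta0 hr hrho.
  move=> delta delta0.
  have C1 : 0 < Rabs C + 1 by have := Rabs_pos C; lra.
  have [N hN] : exists N, forall n, (n >= N)%coq_nat -> Rabs (rho ^ n) < delta / (Rabs C + 1).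
    apply: pow_lt_1_zero; first by rewrite Rabs_pos_eq; lra.
    exact: Rdiv_lt_0_compat.
  exists (fun r i => weierstrass_trunc (b i) (alphas i) N r); split.
    by move=> i; apply: smooth01_trunc.
  apply: Rbar_le_lt_trans (hC N _ _) _.
    by move=> s t _ st _; apply: smooth_lift_trunc; lra.
  have := hN N (Nat.le_refl N); have p : 0 < rho ^ N by apply: pow_lt; lra.
  rewrite /= Rabs_pos_eq; last lra.
  move=> /Rlt_div_r h; have {}h := h C1.
  have := Rle_abs C; nra.
have [K [K0 [h1 h2]]] := weierstrass_rates d b alphas g eta rho hb ha hg eta0 hr hrho.
have [C [C0 hC]] := rp_norm_le d nv nm hv hm.
have [Cv [Cv0 hCv]] := norm_bound _ nv hv.
exists (fun t i => weierstrass (b i) (alphas i) t); split.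
- apply: (Rbar_le_lt_trans _ (Cv * K)) => //.
  apply: (proj2 (Lub_Rbar_correct _)) => r [s [t [_ _ st ->]]].
  have H0 : 0 < Rpower (Rabs (t - s)) g by apply: exp_pos.
  rewrite /=; apply/Rle_div_l => //; rewrite Rmult_assoc; apply: hCv => i.
  by have [_ k] := h1 i s t st.
- by [].
- by move=> s u t h0 su ut ht1 i j; apply: area_chen.
- apply: (Rbar_le_lt_trans _ (C * K)) => //; apply: hC => // s t h0 st ht1; split=> [i|ij].
    by have [_ k] := h1 i s t (Rlt_not_eq _ _ st).
  by have [_ _ k] := h2 ij s t st.
Qed.

Theorem theorem3p5 (d : nat) (hd : (1 <= d)%N)
    (nv : vec d -> R) (nm : mat d -> R) (hnv : is_norm nv) (hnm : is_norm nm)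
    (b : 'I_d -> nat) (hb : forall i, (2 <= b i)%N)
    (alphas : 'I_d -> R) (halpha01 : forall i, 0 < alphas i < 1)
    (halpha3 : forall i, 1 / 3 < alphas i) :
  let alpha := min1 alphas in
  (forall (N : nat) (s t : R), 0 <= s -> s <= t -> t <= 1 ->
    forall i j : 'I_d,
      ex_RSInt (fun r => weierstrass_trunc (b i) (alphas i) N r
                         - weierstrass_trunc (b i) (alphas i) N s)
               (weierstrass_trunc (b j) (alphas j) N) s t) /\
  (forall s t : R, 0 <= s -> s <= t -> t <= 1 ->
    forall i j : 'I_d, ex_finite_lim_seq (fun N => areaN b alphas N s t i j)) /\
  (forall eps : R, 0 < eps < alpha ->
    geometric_rough_path nv nm (alpha - eps) (W b alphas)) /\
  (forall eps beta eps' : R,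
    0 < eps < alpha -> alpha - eps < beta < alpha -> 0 < eps' < alpha ->
    let kappa := 1 - (alpha - eps) / beta in
    let rho :=
      Rpower (max0 (fun i => Rpower (INR (b i)) (- alphas i + eps'))) kappa in
    0 < kappa < 1 /\ 0 < rho < 1 /\
    exists C : R, forall N : nat,
      Rbar_le (rp_norm nv nm (alpha - eps) (rp_sub (W b alphas) (WN b alphas N)))
              (C * rho ^ N)).
Proof.
move=> alpha.
have a1 : alpha < 1.
  apply: (Rle_lt_trans _ (alphas (Ordinal hd))); last by case: (halpha01 (Ordinal hd)).
  by apply: big_Rmin_le; apply: mem_index_enum.
split; [|split; [|split]].
- move=> N s t _ st _ i j.
  exists (area_sum (b i) (b j) (alphas i) (alphas j) s t N); exact: is_RSInt_trunc.
- move=> s t _ st _ i j; exists (area b alphas s t i j); exact: area_lim.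
- move=> eps heps.
  have hbeta : alpha - eps < (alpha - eps + alpha) / 2 < alpha by lra.
  have heps' : 0 < alpha / 2 < alpha by lra.
  have [_ r01 [eta [eta0 hr]]] := rate_params d b alphas eps _ _ hd hb halpha01 heps hbeta heps'.
  by apply: W_geometric hnv hnm hb halpha01 _ eta0 r01 hr; rewrite -/alpha; lra.
move=> eps beta eps' heps hbeta heps' kappa rho.
have [k01 r01 [eta [eta0 hr]]] := rate_params d b alphas eps beta eps' hd hb halpha01 heps hbeta heps'.
split=> //; split=> //.
have g01 : 0 < alpha - eps < 1 by lra.
have [C hC] := W_truncation_rate d nv nm b alphas _ eta rho hnv hnm hb halpha01 g01 eta0 r01 hr.
by exists C => N; apply: hC.
Qed.
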